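(* Let $f \in \mathsf{R}^{+}$ be factored as $f = K_{f} R_{f}$, where $K_f$ is a Koebe inner function and $R_{f} \in \mathsf{RO}$. If the argument of $R_f$ (a continuous branch of $\arg R_f$ on $\mathbb{D}$) is bounded, then there are inner functions $\phi_1,\phi_2,\ldots,\phi_N$ so that $$f = K_f \prod_{1 \leq n \leq N} T(\phi_n).$$ Moreover, the product $\prod_{1\le n\le N}T(\phi_n)$ belongs to $H^p$ whenever $f$ belongs to $H^p$.
   Context: $\mathbb{D}$ is the open unit disk, $\mathbb{T}$ the unit circle. The Smirnov class is $N^+ = \{f/g : f,g \in H^\infty,\ g \text{ outer}\}$. $\mathsf{R}^+$ is the set of $f\in N^+$ whose radial boundary values are real a.e.~on $\mathbb{T}$; $\mathsf{RO}$ is the set of outer functions in $\mathsf{R}^+$. A Koebe inner function is $K\circ\phi$ with $\phi$ inner and $K(z) = -4z/(1-z)^2$. $T(z) = i\frac{1-iz}{1+iz}$, and $T(\phi_n)$ means $T\circ\phi_n$. *)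

(* Defs.v *)
From HB Require Import structures.
From mathcomp Require Import all_boot all_order all_algebra.
From mathcomp Require Import all_classical all_reals all_analysis.
From mathcomp Require Import complex.
Export ComplexField.
Import Order.TTheory GRing.Theory Num.Theory numFieldNormedType.Exports.

Set Implicit Arguments.
Unset Strict Implicit.
Unset Printing Implicit Defensive.

Local Open Scope classical_set_scope.
Local Open Scope ring_scope.
Local Open Scope complex_scope.

Section Defs.
Variable R : realType.
Local Notation C := (R[i]).

Definition cabs (z : C) : R := Num.sqrt (complex.Re z ^+ 2 + complex.Im z ^+ 2).

Definition period : set R := `[0, 2 * pi]%classic.

Definition expi (t : R) : C := ((cos t) +i* (sin t))%C.

Definition cexp (w : C) : C := (expR (complex.Re w))%:C * expi (complex.Im w).

Definition disk (z : C) : Prop := cabs z < 1.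

Definition holo (f : C -> C) : Prop :=
  forall z, disk z -> @derivable _ C^o C^o f z 1.

Definition Hinf (f : C -> C) : Prop :=
  holo f /\ exists M : R, forall z, disk z -> cabs (f z) <= M.

Definition radlim (f : C -> C) (t : R) (l : C) : Prop :=
  (fun r : R => (f (r%:C * expi t) : C^o)) @ (1 : R)^'- --> (l : C^o).

Definition ae_circle (P : R -> Prop) : Prop :=
  {ae (@lebesgue_measure R), forall t, period t -> P t}.

Definition inner (phi : C -> C) : Prop :=
  Hinf phi /\ ae_circle (fun t => exists l, radlim phi t l /\ cabs l = 1).

Definition schwarz (t : R) (z : C) : C := (expi t + z) / (expi t - z).

(* outer function:
     g(z) = c exp( (1/2pi) \int_0^{2pi} (e^{it}+z)/(e^{it}-z) u(t) dt )
   with |c| = 1 and u (= log of the boundary modulus) integrable on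
   [0, 2pi]; the complex integral is split into real and imaginary parts *)
Definition outer (g : C -> C) : Prop :=
  exists (c : C) (u : R -> R),
    cabs c = 1 /\
    (@lebesgue_measure R).-integrable period (EFin \o u) /\
    forall z, disk z ->
      g z = c * cexp (((2 * pi)^-1)%:C *
              ((Rintegral (@lebesgue_measure R) period
                  (fun t => complex.Re (schwarz t z) * u t))
               +i* (Rintegral (@lebesgue_measure R) period
                  (fun t => complex.Im (schwarz t z) * u t)))).

Definition smirnov (f : C -> C) : Prop :=
  exists F G : C -> C, Hinf F /\ Hinf G /\ outer G /\
    forall z, disk z -> f z = F z / G z.

Definition Rplus (f : C -> C) : Prop :=
  smirnov f /\ ae_circle (fun t => exists l, radlim f t l /\ complex.Im l = 0).

Definition RO (f : C -> C) : Prop := Rplus f /\ outer f.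

Definition koebe (z : C) : C := - (4%:R * z) / (1 - z) ^+ 2.

(* Koebe inner function: K o phi with phi inner (K o phi is required to be
   defined on D, i.e. phi never takes the value 1 there) *)
Definition koebe_inner (F : C -> C) : Prop :=
  exists phi, inner phi /\
    forall z, disk z -> phi z != 1 /\ F z = koebe (phi z).

Definition Tmap (z : C) : C := 'i%C * (1 - 'i%C * z) / (1 + 'i%C * z).

Definition bounded_arg (g : C -> C) : Prop :=
  exists a : C -> R,
    (forall z, disk z -> {for z, continuous (a : C^o -> R)}) /\
    (forall z, disk z -> g z = (cabs (g z))%:C * expi (a z)) /\
    exists M : R, forall z, disk z -> `|a z| <= M.

Definition Hardy (p : \bar R) (f : C -> C) : Prop :=
  match p with
  | +oo%E => Hinf f
  | (q%:E)%E => 0 < q /\ holo f /\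
      exists M : R, forall r : R, 0 <= r < 1 ->
        (\int[@lebesgue_measure R]_(t in period)
           ((cabs (f (r%:C * expi t))) `^ q)%:E <= M%:E)%E
  | -oo%E => False
  end.

End Defs.

(* Main.v *)
(* Write R_f = c exp (S u / 2 pi), where u = log |R_f| on the circle and S u is
   the integral of (e^{it} + z) / (e^{it} - z) u(t). The argument a of R_f is a
   bounded harmonic function, hence the Poisson integral of its boundary values,
   and these lie in pi Z almost everywhere because R_f has real radial limits.
   So, up to an additive constant in pi Z, a is pi times the Poisson integral of
   a finite sum of indicator functions of sets E_k. The function
   G_k = exp (i S 1_{E_k} / 2) maps the disk to the closed upper half plane and
   has real boundary values, so its Cayley transform phi_k = T^{-1} G_k is inner.
   The quotient of R_f by the product of the G_k is real-valued, hence a real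
   constant, which is T of a unimodular constant.

   The radial limits of S 1_E exist although the conjugate function of 1_E is
   unbounded: by Bessel's inequality S 1_E has square summable coefficients, so
   it is the Poisson integral of an integrable function, and Fatou's theorem
   applies.

   For the Hardy classes, |K_f| has radial limits at least 1, so Fatou's lemma
   makes e^{q u} integrable, and by Jensen's inequality |R_f|^q is at most the
   Poisson integral of e^{q u}. *)

(* Real radial limits of [R_f] give only [sin a -> 0] along almost every radius. It is the
   continuity of [a] on the radius that keeps it from moving between multiples of [pi], so that [a]
   itself converges. Boundedness of [a] enters twice: it dominates the dilates [a (r z)], whose
   Poisson integrals can then pass to the limit [r -> 1], and it bounds the integers that occur as
   boundary values, so that finitely many [E_k] suffice. The additive constant, a multiple of [pi],
   survives only as a sign in the quotient. Identities for Poisson integrals, such as the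
   reproduction of a holomorphic function from a circle of radius [r < 1], rest on the geometric
   expansion of the kernel: orthogonality of the exponentials settles every truncation exactly, and
   the error is geometric in the truncation order. Inside the disk [|K_f|] may be small or even
   vanish, so [|R_f|] is not controlled by [|f|] there. The comparison is made at the boundary and
   carried back inside by the integral representation of the outer function. *)
Require Import Defs.
From HB Require Import structures.
From mathcomp Require Import all_boot all_order all_algebra.
From mathcomp Require Import all_classical all_reals all_analysis.
From mathcomp Require Import complex.
From mathcomp Require Import measurable_realfun.
From mathcomp Require Import ring lra zify.
Import ComplexField.
Import Order.TTheory GRing.Theory Num.Theory numFieldNormedType.Exports.
Set Implicit Arguments.
Unset Strict Implicit.
Unset Printing Implicit Defensive.
Local Open Scope classical_set_scope.
Local Open Scope ring_scope.

(** * Complex numbers and holomorphic functions *)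

Section ComplexBasics.
Variable R : realType.
Local Notation C := (R[i]).
Implicit Types (z w : C) (x y t : R).

Lemma normC_cabs z : `|z| = (cabs z)%:C%C.
Proof. exact: normc_def. Qed.

Lemma cabs_normc z : cabs z = Normc.normc z.
Proof. by case: z. Qed.

Lemma cabs_ge0 z : 0 <= cabs z. Proof. exact: sqrtr_ge0. Qed.
Lemma cabsM z w : cabs (z * w) = cabs z * cabs w.
Proof. by rewrite !cabs_normc Normc.normcM. Qed.
Lemma cabsV z : cabs z^-1 = (cabs z)^-1.
Proof. by rewrite !cabs_normc Normc.normcV. Qed.
Lemma cabsN z : cabs (- z) = cabs z.
Proof. by apply: complexI; rewrite -!normC_cabs normrN. Qed.
Lemma cabs0 : cabs (0 : C) = 0.
Proof. by rewrite cabs_normc Normc.normc0. Qed.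
Lemma cabs1 : cabs (1 : C) = 1.
Proof. by rewrite cabs_normc Normc.normc1. Qed.
Lemma cabsX z n : cabs (z ^+ n) = cabs z ^+ n.
Proof. by elim: n => [|n IH]; rewrite ?expr0 ?cabs1// !exprS cabsM IH. Qed.
Lemma cabsD z w : cabs (z + w) <= cabs z + cabs w.
Proof. by rewrite -lecR rmorphD/= -!normC_cabs ler_normD. Qed.
Lemma cabsB z w : cabs (z - w) <= cabs z + cabs w.
Proof. by rewrite (le_trans (cabsD _ _))// cabsN. Qed.
Lemma cabsC z w : cabs (z - w) = cabs (w - z).
Proof. by rewrite -cabsN opprB. Qed.
Lemma cabs_eq0 z : (cabs z == 0) = (z == 0).
Proof.
apply/eqP/eqP => [|->]; last exact: cabs0.
by rewrite cabs_normc; apply: Normc.eq0_normc.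
Qed.
Lemma cabs_gt0 z : (0 < cabs z) = (z != 0).
Proof. by rewrite lt_def cabs_eq0 cabs_ge0 andbT. Qed.
Lemma cabsR x : cabs (x%:C)%C = `|x|.
Proof. by rewrite /cabs /= expr0n addr0 sqrtr_sqr. Qed.
Lemma Re_le_cabs z : `|complex.Re z| <= cabs z.
Proof. by rewrite -sqrtr_sqr ler_wsqrtr// lerDl sqr_ge0. Qed.
Lemma Im_le_cabs z : `|complex.Im z| <= cabs z.
Proof. by rewrite -sqrtr_sqr ler_wsqrtr// lerDr sqr_ge0. Qed.
Lemma cabs_le_ReIm z : cabs z <= `|complex.Re z| + `|complex.Im z|.
Proof.
case: z => x y; have -> : (x +i* y = x%:C + 'i * y%:C)%C by simpc.
apply: le_trans (cabsD _ _) _.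
rewrite cabsM !cabsR [cabs 'i]/cabs /= expr0n expr1n add0r sqrtr1 mul1r.
by rewrite !(mulr0, mul0r, mul1r, addr0, subr0, add0r).
Qed.
Lemma cReD z w : complex.Re (z + w) = complex.Re z + complex.Re w.
Proof. by case: z; case: w. Qed.
Lemma cImD z w : complex.Im (z + w) = complex.Im z + complex.Im w.
Proof. by case: z; case: w. Qed.
Lemma cReN z : complex.Re (- z) = - complex.Re z.
Proof. by case: z. Qed.
Lemma cImN z : complex.Im (- z) = - complex.Im z.
Proof. by case: z. Qed.
Lemma cReM z w :
  complex.Re (z * w) = complex.Re z * complex.Re w - complex.Im z * complex.Im w.
Proof. by case: z; case: w. Qed.
Lemma cImM z w :
  complex.Im (z * w) = complex.Re z * complex.Im w + complex.Im z * complex.Re w.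
Proof. by case: z; case: w. Qed.
Lemma cReZ x z : complex.Re (x%:C%C * z) = x * complex.Re z.
Proof. by rewrite cReM /= mul0r subr0. Qed.
Lemma cImZ x z : complex.Im (x%:C%C * z) = x * complex.Im z.
Proof. by rewrite cImM /= mul0r addr0. Qed.
Lemma sqr_cabs z : cabs z ^+ 2 = complex.Re z ^+ 2 + complex.Im z ^+ 2.
Proof. by rewrite sqr_sqrtr// addr_ge0// sqr_ge0. Qed.
Lemma complexP z w :
  complex.Re z = complex.Re w -> complex.Im z = complex.Im w -> z = w.
Proof. by case: z; case: w => ? ? ? ? /= -> ->. Qed.

Lemma cabs_expi t : cabs (expi t) = 1.
Proof. by rewrite /cabs/= cos2Dsin2 sqrtr1. Qed.
Lemma expiD t y : expi (t + y) = expi t * expi y.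
Proof. by apply: complexP; rewrite ?cReM ?cImM /= ?cosD ?sinD; ring. Qed.
Lemma expi0 : expi (0 : R) = 1.
Proof. by rewrite /expi cos0 sin0. Qed.
Lemma expiN t : expi (- t) = (expi t)^-1.
Proof.
apply: (@mulfI _ (expi t)); first by rewrite -cabs_eq0 cabs_expi oner_eq0.
rewrite -expiD subrr expi0 divff// -cabs_eq0 cabs_expi oner_eq0 //.
Qed.
Lemma expi_neq0 t : expi t != 0.
Proof. by rewrite -cabs_eq0 cabs_expi oner_eq0. Qed.
Lemma expiMn t n : expi (n%:R * t) = expi t ^+ n.
Proof.
by elim: n => [|n IH]; rewrite ?mul0r ?expi0// exprS -IH -expiD -natr1 mulrDl mul1r addrC.
Qed.
Lemma cabs_cexp z : cabs (cexp z) = expR (complex.Re z).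
Proof. by rewrite /cexp cabsM cabs_expi mulr1 cabsR gtr0_norm// expR_gt0. Qed.
Lemma cexpD z w : cexp (z + w) = cexp z * cexp w.
Proof.
rewrite /cexp cReD cImD expRD expiD rmorphM/= -!mulrA; congr (_ * _).
by rewrite mulrCA.
Qed.
Lemma cexp_neq0 z : cexp z != 0.
Proof. by rewrite -cabs_gt0 cabs_cexp expR_gt0. Qed.

Lemma disk_radius r t : 0 <= r < 1 -> disk (r%:C%C * expi t : C).
Proof. by case/andP=> r0 r1; rewrite /disk cabsM cabs_expi mulr1 cabsR ger0_norm. Qed.

Lemma disk_scale r z : 0 <= r <= 1 -> disk z -> disk (r%:C%C * z).
Proof.
case/andP=> r0 r1; rewrite /disk cabsM cabsR ger0_norm//; apply: le_lt_trans.
by rewrite ler_piMl// cabs_ge0.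
Qed.

Lemma cvgCP (T : Type) (F : set_system T) (FF : Filter F) (f : T -> C) (l : C) :
  ((fun s => f s : C^o) @ F --> (l : C^o)) <->
  ((fun s => complex.Re (f s)) @ F --> complex.Re l /\
   (fun s => complex.Im (f s)) @ F --> complex.Im l).
Proof.
split.
- move=> /cvgrPdist_lt H; split; apply/cvgrPdist_lt => e e0;
    have /H : 0 < (e%:C%C : C) by rewrite ltcR.
  + apply: filterS => s; rewrite normC_cabs ltcR; apply: le_lt_trans.
    by apply: le_trans (Re_le_cabs _); rewrite cReD cReN.
  + apply: filterS => s; rewrite normC_cabs ltcR; apply: le_lt_trans.
    by apply: le_trans (Im_le_cabs _); rewrite cImD cImN.
- move=> [/cvgrPdist_lt H1 /cvgrPdist_lt H2]; apply/cvgrPdist_lt => e.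
  case: e => e e' ; rewrite ltcE /= => /andP[/eqP-> e0].
  have e20 : 0 < e / 2 by rewrite divr_gt0.
  near=> s; rewrite normC_cabs ltcR.
  apply: le_lt_trans (cabs_le_ReIm _) _; rewrite cReD cReN cImD cImN (splitr e).
  by apply: ltrD; near: s; [apply: H1|apply: H2].
Unshelve. all: by end_near. Qed.

Lemma cvgC_dist (T : Type) (F : set_system T) (FF : Filter F) (f : T -> C) (l : C) :
  ((fun s => f s : C^o) @ F --> (l : C^o)) <->
  (fun s => cabs (f s - l)) @ F --> (0 : R).
Proof.
split.
- move=> /cvgrPdist_lt H; apply/cvgrPdist_lt => e e0.
  have /H : 0 < (e%:C%C : C) by rewrite ltcR.
  apply: filterS => s; rewrite normC_cabs ltcR sub0r normrN (ger0_norm (cabs_ge0 _)).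
  by rewrite cabsC.
- move=> /cvgrPdist_lt H; apply/cvgrPdist_lt => e.
  case: e => e e'; rewrite ltcE /= => /andP[/eqP-> e0].
  have := H _ e0; apply: filterS => s; rewrite normC_cabs ltcR sub0r normrN.
  by rewrite (ger0_norm (cabs_ge0 _)) cabsC.
Qed.

Lemma cvg_cabs (T : Type) (F : set_system T) (FF : Filter F) (f : T -> C) (l : C) :
  ((fun s => f s : C^o) @ F --> (l : C^o)) -> (fun s => cabs (f s)) @ F --> cabs l.
Proof.
move=> /cvgC_dist /cvgrPdist_lt H; apply/cvgrPdist_lt => e e0.
have := H _ e0; apply: filterS => s; rewrite sub0r normrN (ger0_norm (cabs_ge0 _)).
apply: le_lt_trans; rewrite ler_norml; apply/andP; split.
  rewrite lerNl opprB lerBlDr -{1}(subrK l (f s)); exact: cabsD.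
by rewrite lerBlDr cabsC -{1}(subrK (f s) l); exact: cabsD.
Qed.

Lemma cvgCV (T : Type) (F : set_system T) (FF : Filter F) (f : T -> C) (l : C) :
  l != 0 ->
  ((fun s => f s : C^o) @ F --> (l : C^o)) -> (fun s => (f s)^-1 : C^o) @ F --> (l^-1 : C^o).
Proof. move=> l0 H. exact: (@cvgV C T F FF f l l0 H). Qed.
Lemma cvgCM (T : Type) (F : set_system T) (FF : Filter F) (f g : T -> C) (l m : C) :
  ((fun s => f s : C^o) @ F --> (l : C^o)) -> ((fun s => g s : C^o) @ F --> (m : C^o)) ->
  (fun s => f s * g s : C^o) @ F --> (l * m : C^o).
Proof. move=> H G. exact: (@cvgM C T F FF f g l m H G). Qed.
Lemma cvgCD (T : Type) (F : set_system T) (FF : Filter F) (f g : T -> C) (l m : C) :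
  ((fun s => f s : C^o) @ F --> (l : C^o)) -> ((fun s => g s : C^o) @ F --> (m : C^o)) ->
  (fun s => f s + g s : C^o) @ F --> (l + m : C^o).
Proof. move=> H G. exact: (@cvgD C C^o T F FF f g l m H G). Qed.
Lemma cvgCB (T : Type) (F : set_system T) (FF : Filter F) (f g : T -> C) (l m : C) :
  ((fun s => f s : C^o) @ F --> (l : C^o)) -> ((fun s => g s : C^o) @ F --> (m : C^o)) ->
  (fun s => f s - g s : C^o) @ F --> (l - m : C^o).
Proof. move=> H G. exact: (@cvgB C C^o T F FF f g l m H G). Qed.
Lemma cvgC_cst (T : Type) (F : set_system T) (FF : Filter F) (l : C) :
  (fun s : T => l : C^o) @ F --> (l : C^o).
Proof. exact: cvg_cst. Qed.

Lemma cvg_realC (T : Type) (F : set_system T) (FF : Filter F) (f : T -> R) (l : R) :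
  f @ F --> l -> (fun s => (f s)%:C%C : C^o) @ F --> (l%:C%C : C^o).
Proof. by move=> H; apply/cvgCP; split => //=; apply: cvg_cst. Qed.

Lemma cvg_expi (T : Type) (F : set_system T) (FF : Filter F) (f : T -> R) (l : R) :
  f @ F --> l -> (fun s => expi (f s) : C^o) @ F --> (expi l : C^o).
Proof.
move=> H; apply/cvgCP; split => /=.
  exact: (continuous_cvg _ (@continuous_cos R l)).
exact: (continuous_cvg _ (@continuous_sin R l)).
Qed.

Lemma cvg_cexp (T : Type) (F : set_system T) (FF : Filter F) (f : T -> C) (l : C) :
  ((fun s => f s : C^o) @ F --> (l : C^o)) ->
  (fun s => cexp (f s) : C^o) @ F --> (cexp l : C^o).
Proof.
move=> /cvgCP[H1 H2]; rewrite /cexp.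
apply: cvgCM; last exact: cvg_expi.
by apply: cvg_realC; apply: (continuous_cvg _ (@continuous_expR R _)).
Qed.

End ComplexBasics.

(** * Complex derivatives and the exponential function *)

Section Holomorphic.
Variable R : realType.
Local Notation C := (R[i]).
Implicit Types (z w : C) (x y t : R).

Lemma derivableCP (f : C -> C) z :
  @derivable _ C^o C^o f z 1 <->
  exists L : C, (fun h : C^o => h^-1 * (f (h + z) - f z) : C^o) @ 0^' --> (L : C^o).
Proof.
rewrite /derivable; split.
  move=> /cvg_ex[L HL]; exists L; apply: cvg_trans HL.
  by apply: near_eq_cvg; near=> h; rewrite /= scaler1.
move=> [L HL]; apply/cvg_ex; exists L; apply: cvg_trans HL.
by apply: near_eq_cvg; near=> h; rewrite /= scaler1.
Unshelve. all: by end_near. Qed.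

(** Stated on a full neighbourhood, with [x = 0] included, because it is applied to [Re h] and
    [Im h], either of which may vanish although [h] does not. *)
Lemma derive_remainder (f : R -> R) (l : R) :
  is_derive (0 : R) (1 : R) f l -> forall e, 0 < e ->
  \forall x \near (0 : R), `|f x - f 0 - x * l| <= e * `|x|.
Proof.
move=> [df dl] e e0; have : 'D_1 f 0 = l by [].
move=> fl; have /cvgrPdist_le/(_ e e0) := df.
rewrite -[lim _]/('D_1 f 0) fl; rewrite near_withinE.
apply: filterS => x H.
have [->|x0] := eqVneq x 0; first by rewrite mul0r subr0 subrr normr0 mulr0.
have := H x0; rewrite /= addr0 scaler1.
have -> : l - x^-1 *: (f x - f 0) = - (x^-1 * (f x - f 0 - x * l)).
  by rewrite /GRing.scale/= [in RHS]mulrBr mulKf// opprB.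
by rewrite normrN normrM normfV ler_pdivrMl ?normr_gt0// (mulrC e).
Qed.

Lemma cexp_remainder e : 0 < e ->
  \forall h \near (0 : C^o), cabs (cexp h - 1 - h) <= e * cabs h.
Proof.
move=> e0.
(* The error is split into four terms, [F4], [F1], [F3] and [F2] below, which cost 1, 2, 1 and 2
   multiples of [e / 6 * cabs h]. *)
have d6 : 0 < e / 6 by rewrite divr_gt0.
have re0 : (fun h : C^o => complex.Re h) @ (0 : C^o) --> (0 : R).
  by have /cvgCP[] := @cvg_id C^o (nbhs (0 : C^o)).
have im0 : (fun h : C^o => complex.Im h) @ (0 : C^o) --> (0 : R).
  by have /cvgCP[] := @cvg_id C^o (nbhs (0 : C^o)).
have expr0' : (fun h : C^o => expR (complex.Re h)) @ (0 : C^o) --> (1 : R).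
  have H : (fun h : C^o => expR (complex.Re h)) @ (0 : C^o) --> expR (0 : R).
    exact: (cvg_comp _ _ re0 (@continuous_expR R 0)).
  by move: H; rewrite expR0.
have D1 : is_derive (0 : R) (1 : R) expR 1 by have := is_derive_expR (0 : R); rewrite expR0.
have D2 : is_derive (0 : R) (1 : R) cos 0.
  by have := is_derive_cos (0 : R); rewrite sin0 oppr0.
have D3 : is_derive (0 : R) (1 : R) sin 1.
  by have := is_derive_sin (0 : R); rewrite cos0.
have N1 := re0 _ (derive_remainder D1 d6).
have N2 := im0 _ (derive_remainder D2 d6).
have N3 := im0 _ (derive_remainder D3 d6).
near=> h.
have E1 : `|expR (complex.Re h) - 1 - complex.Re h| <= e / 6 * `|complex.Re h|.
  have : `|expR (complex.Re h) - expR 0 - complex.Re h * 1| <= e / 6 * `|complex.Re h|.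
    by near: h; exact: N1.
  by rewrite expR0 mulr1.
have E2 : `|cos (complex.Im h) - 1| <= e / 6 * `|complex.Im h|.
  have : `|cos (complex.Im h) - cos 0 - complex.Im h * 0| <= e / 6 * `|complex.Im h|.
    by near: h; exact: N2.
  by rewrite cos0 mulr0 subr0.
have E3 : `|sin (complex.Im h) - complex.Im h| <= e / 6 * `|complex.Im h|.
  have : `|sin (complex.Im h) - sin 0 - complex.Im h * 1| <= e / 6 * `|complex.Im h|.
    by near: h; exact: N3.
  by rewrite sin0 mulr1 subr0.
have E4 : `|expR (complex.Re h) - 1| <= e / 6.
  by rewrite distrC; near: h; move/cvgrPdist_le : expr0'; apply.
have E5 : expR (complex.Re h) <= 2.
  have : `|1 - expR (complex.Re h)| <= 1.
    by near: h; move/cvgrPdist_le : expr0'; apply.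
  by rewrite ler_norml => /andP[]; lra.
have hR := Re_le_cabs h; have hI := Im_le_cabs h.
apply: le_trans (cabs_le_ReIm _) _; rewrite !cReD !cImD !cReN !cImN /cexp cReZ cImZ /= oppr0 addr0.
move: E1 E2 E3 E4 E5 hR hI; set x := complex.Re h; set y := complex.Im h.
set X := expR x; set c := cos y; set s := sin y => E1 E2 E3 E4 E5 hR hI.
have X0 : 0 < X by exact: expR_gt0.
have -> : X * c - 1 - x = (X - 1 - x) + X * (c - 1) by ring.
have -> : X * s - y = (X - 1) * y + X * (s - y) by ring.
have F1 : `|X * (c - 1)| <= 2 * (e / 6 * cabs h).
  rewrite normrM (gtr0_norm X0) ler_pM//; first exact: ltW.
  by apply: le_trans E2 _; rewrite ler_wpM2l// ltW.
have F2 : `|X * (s - y)| <= 2 * (e / 6 * cabs h).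
  rewrite normrM (gtr0_norm X0) ler_pM//; first exact: ltW.
  by apply: le_trans E3 _; rewrite ler_wpM2l// ltW.
have F3 : `|(X - 1) * y| <= e / 6 * cabs h by rewrite normrM ler_pM.
have F4 : `|X - 1 - x| <= e / 6 * cabs h.
  by apply: le_trans E1 _; rewrite ler_wpM2l// ltW.
apply: le_trans (lerD (ler_normD _ _) (ler_normD _ _)) _.
have -> : e * cabs h = 6 * (e / 6 * cabs h) by rewrite mulrA mulrCA divff ?mulr1// pnatr_eq0.
lra.
Unshelve. all: by end_near. Qed.

Lemma derivable_cexp z : @derivable _ C^o C^o (@cexp R) z 1.
Proof.
apply/derivableCP; exists (cexp z).
have -> : (fun h : C^o => h^-1 * (cexp (h + z) - cexp z) : C^o) =
   (fun h : C^o => cexp z * (h^-1 * (cexp h - 1)) : C^o).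
  by apply/funext => h; rewrite cexpD -{2}(mul1r (cexp z)) -mulrBl mulrA mulrC.
rewrite -{2}[cexp z]mulr1; apply: (@cvgM C _ (0 : C^o)^'); first exact: cvg_cst.
apply/cvgC_dist/cvgrPdist_le => e e0.
have := @cexp_remainder e e0; rewrite near_withinE.
apply: filterS => h H h0.
rewrite sub0r normrN (ger0_norm (cabs_ge0 _)).
have -> : h^-1 * (cexp h - 1) - 1 = h^-1 * (cexp h - 1 - h).
  by rewrite [in RHS]mulrBr mulVf.
by rewrite cabsM cabsV ler_pdivrMl ?cabs_gt0// mulrC.
Qed.

Lemma derivable_compC (f g : C -> C) z :
  @derivable _ C^o C^o f z 1 -> @derivable _ C^o C^o g (f z) 1 ->
  @derivable _ C^o C^o (g \o f) z 1.
Proof.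
move=> /derivable1_diffP df /derivable1_diffP dg.
have := @differentiable_comp C C^o C^o C^o f g z df dg.
by move/(@derivable1_diffP C C^o).
Qed.

Lemma near_disk z : disk z -> \forall w \near (z : C^o), disk w.
Proof.
rewrite /disk -subr_gt0 => zd.
have /cvgC_dist/cvgrPdist_lt/(_ _ zd) := @cvg_id C^o (nbhs (z : C^o)).
apply: filterS => w; rewrite sub0r normrN (ger0_norm (cabs_ge0 _)) => H.
by rewrite -(subrK z w); apply: le_lt_trans (cabsD _ _) _; lra.
Qed.

Lemma derivable_eq_disk (f g : C -> C) z : disk z ->
  (forall w, disk w -> f w = g w) ->
  @derivable _ C^o C^o f z 1 -> @derivable _ C^o C^o g z 1.
Proof.
move=> zd fg; apply: (@near_eq_derivable C C^o C^o).
  by near=> w; apply: fg; near: w; apply: near_disk.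
Unshelve. all: try by end_near. Qed.

Lemma holo_continuous (f : C -> C) z : holo f -> disk z ->
  {for z, continuous (f : C^o -> C^o)}.
Proof.
move=> hf zd; apply: (@differentiable_continuous C C^o C^o).
by apply/derivable1_diffP; apply: hf.
Qed.

Lemma holo_ray (f : C -> C) z (s : R) : holo f -> disk (s%:C%C * z) ->
  (fun t : R => f (t%:C%C * z) : C^o) @ s --> (f (s%:C%C * z) : C^o).
Proof.
move=> hf zd.
apply: (@continuous_cvg R C^o C^o (nbhs s) _ (fun t => t%:C%C * z : C^o) f (s%:C%C * z)).
  exact: (@holo_continuous f).
by apply: (@cvgM C R (nbhs s)); [apply: cvg_realC; exact: cvg_id|exact: cvg_cst].
Qed.

End Holomorphic.

(** * Holomorphic functions with real values are constant *)

Section RealValued.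
Variable R : realType.
Local Notation C := (R[i]).
Implicit Types (z w : C) (x : R).

Lemma cvg_dnbhs_mulC (v : C) : v != 0 ->
  (fun s : R => s%:C%C * v : C^o) @ (0 : R)^' --> (0 : C^o)^'.
Proof.
move=> v0 P HP.
have lim0 : (fun s : R => s%:C%C * v : C^o) @ (0 : R) --> (0 : C^o).
  rewrite -[X in _ --> X](mul0r v); apply: cvgCM; last exact: cvgC_cst.
  by apply: cvg_realC; exact: cvg_id.
change (\forall s \near (0 : R)^', P (s%:C%C * v)); rewrite near_withinE.
have H : \forall s \near (0 : R), s%:C%C * v != 0 -> P (s%:C%C * v) by exact: (lim0 _ HP).
apply: filterS H => s Hs s0; apply: Hs.
by rewrite mulf_eq0 negb_or v0 andbT; apply: contra s0 => /eqP[->].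
Qed.

(** Restricts the complex difference quotient to real increments in the direction [v], where real
    and imaginary parts can be separated. *)
Lemma holo_slope (f : C -> C) z (v : C) : @derivable _ C^o C^o f z 1 -> v != 0 ->
  (fun s : R => (s%:C%C)^-1 * (f (s%:C%C * v + z) - f z) : C^o) @ (0 : R)^' -->
  (v * 'D_1 (f : C^o -> C^o) z : C^o).
Proof.
move=> fz v0.
have H1 : (fun h : C^o => h^-1 * (f (h + z) - f z) : C^o) @ 0^' -->
    ('D_1 (f : C^o -> C^o) z : C^o).
  apply: cvg_trans fz; apply: near_eq_cvg; near=> h; by rewrite /= scaler1.
have H2 := cvg_comp _ _ (cvg_dnbhs_mulC v0) H1.
have H3 : (fun s : R => v * ((s%:C%C * v)^-1 * (f (s%:C%C * v + z) - f z)) : C^o) @ (0 : R)^' -->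
  (v * 'D_1 (f : C^o -> C^o) z : C^o).
  by apply: cvgCM; [exact: cvgC_cst|exact: H2].
apply: cvg_trans H3; apply: near_eq_cvg; near=> s.
by rewrite invfM mulrA [v * _]mulrCA divff// mulr1.
Unshelve. all: by end_near. Qed.

Lemma near_line_disk z (v : C) : disk z -> \forall s \near (0 : R)^', disk (s%:C%C * v + z).
Proof.
move=> zd; rewrite near_withinE.
have lim0 : (fun s : R => s%:C%C * v + z : C^o) @ (0 : R) --> (z : C^o).
  rewrite -[X in _ --> X]add0r -[X in _ --> X + _](mul0r v).
  apply: cvgCD; last exact: cvgC_cst.
  apply: cvgCM; last exact: cvgC_cst.
  by apply: cvg_realC; exact: cvg_id.
have H : \forall s \near (0 : R), disk (s%:C%C * v + z) by exact: (lim0 _ (near_disk zd)).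
by apply: filterS H.
Qed.

(* The difference quotients of [Q] along the real and the imaginary axis are
   real and purely imaginary, respectively. *)
Lemma derive_real_valued (Q : C -> C) z : holo Q ->
  (forall w, disk w -> complex.Im (Q w) = 0) -> disk z ->
  'D_1 (Q : C^o -> C^o) z = 0.
Proof.
move=> hQ Qr zd; set L := derive _ _ _.
have slope v s : disk (s%:C%C * v + z) -> complex.Im (Q (s%:C%C * v + z) - Q z) = 0.
  by move=> h; rewrite cImD cImN !Qr// subrr.
have i0 : 'i%C != 0 :> C by rewrite eq_complex /= oner_eq0 andbF.
have /cvgCP[_ H1] := holo_slope (hQ z zd) (oner_neq0 C).
have /cvgCP[_ H2] := holo_slope (hQ z zd) i0.
have I0 : forall v, (fun s : R => complex.Im ((s%:C%C)^-1 * (Q (s%:C%C * v + z) - Q z)))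
    @ (0 : R)^' --> (0 : R).
  move=> v; apply: cvg_near_cst; near=> s.
  rewrite -fmorphV /= cImZ slope ?mulr0//.
  by near: s; exact: near_line_disk.
have E1 : complex.Im (1 * L) = 0 by exact: cvg_unique H1 (I0 1).
have E2 : complex.Im ('i%C * L) = 0 by exact: cvg_unique H2 (I0 'i%C).
apply: complexP; first by move: E2; rewrite cImM /= mul0r mul1r add0r.
by move: E1; rewrite mul1r.
Unshelve. all: by end_near. Qed.

(** The disk is star-shaped about 0, so the vanishing derivative can be exploited along the segment
    from 0 to [z]: the mean value theorem applies to the real part there, and the imaginary parts
    are 0 by hypothesis. *)
Lemma holo_real_cst (Q : C -> C) z : holo Q ->
  (forall w, disk w -> complex.Im (Q w) = 0) -> disk z -> Q z = Q 0.
Proof.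
move=> hQ Qr zd.
have [->//|z0] := eqVneq z 0.
have d0 : disk (0 : C) by rewrite /disk cabs0.
pose g := fun s : R => complex.Re (Q (s%:C%C * z)).
have ds (s : R) : 0 <= s <= 1 -> disk (s%:C%C * z) by move=> h; apply: disk_scale.
have gd (s : R) : 0 <= s <= 1 -> is_derive s (1 : R) g 0.
  move=> h; have sd := ds _ h.
  have /cvgCP[H _] := holo_slope (hQ _ sd) z0.
  have {}H : (fun h : R => h^-1 *: ((g \o shift s) (h *: (1 : R)) - g s)) @ (0 : R)^' --> (0 : R).
    rewrite derive_real_valued// mulr0 /= in H.
    apply: cvg_trans H; apply: near_eq_cvg; near=> x.
    rewrite -fmorphV /= cReZ /g /shift /= {1}/GRing.scale /=.
    by rewrite cReD cReN scaler1 rmorphD/= mulrDl.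
  apply: DeriveDef; first by apply/cvg_ex; exists 0.
  exact: cvg_lim.
have [c _] : exists2 c : R, c \in `]0, 1[%R & g 1 - g 0 = 0 * (1 - 0).
  apply: (@MVT _ g (fun=> 0)) => //.
    by move=> x; rewrite in_itv/= => /andP[x0 x1]; apply: gd; rewrite !ltW.
  apply: derivable_within_continuous => x; rewrite in_itv/= => h.
  by have [] := gd x h.
rewrite mul0r /g mul1r mul0r => /eqP; rewrite subr_eq0 => /eqP E.
by apply: complexP => //; rewrite !Qr.
Unshelve. all: by end_near. Qed.

End RealValued.

(** * Integrals over the circle and the Schwarz kernel *)

Section PeriodIntegral.
Variable R : realType.
Local Notation C := (R[i]).
Local Notation mu := (@lebesgue_measure R).
Local Notation per := (@period R).
Implicit Types (u v : R -> R) (f g k : R -> C).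

Definition intg u := mu.-integrable per (EFin \o u).

Lemma measurable_period : measurable (per : set (measurableTypeR R)).
Proof. exact: measurable_itv. Qed.
Local Hint Resolve measurable_period : core.

Lemma mu_period : mu per = (2 * pi)%:E.
Proof.
rewrite /period lebesgue_measure_itv /= lte_fin mulr_gt0 ?pi_gt0//.
by rewrite oppr0 adde0.
Qed.

Lemma intg_meas u : intg u -> measurable_fun per u.
Proof. by move=> /measurable_int/measurable_EFinP. Qed.

Lemma intg_bounded u (B : R) : measurable_fun per u ->
  (forall t, per t -> `|u t| <= B) -> intg u.
Proof.
move=> mu_ ub; apply: measurable_bounded_integrable => //.
  by have := ltry (2 * pi : R); rewrite -mu_period.
exists B; split; first exact: num_real.
by move=> M BM t /= Dt; apply: le_trans (ub _ Dt) (ltW BM).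
Qed.

Lemma intg_cst (c : R) : intg (fun=> c).
Proof. by apply: (@intg_bounded _ `|c|) => //; exact: measurable_cst. Qed.

Lemma intgD u v : intg u -> intg v -> intg (fun t => u t + v t).
Proof. by move=> hu hv; have := integrableD measurable_period hu hv. Qed.

Lemma intgZ (c : R) u : intg u -> intg (fun t => c * u t).
Proof. by move=> hu; have := integrableZl measurable_period c hu. Qed.

Lemma intgN u : intg u -> intg (fun t => - u t).
Proof.
move=> /(intgZ (-1)); congr intg; by apply/funext => t; rewrite mulN1r.
Qed.

Lemma intgB u v : intg u -> intg v -> intg (fun t => u t - v t).
Proof. by move=> hu /intgN; exact: intgD. Qed.

Lemma intg_norm u : intg u -> intg (fun t => `|u t|).
Proof. by move=> hu; have := integrable_abse hu. Qed.

Lemma intg_le u v : measurable_fun per u -> intg v ->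
  (forall t, per t -> `|u t| <= v t) -> intg u.
Proof.
move=> mu_ hv uv; apply: (le_integrable measurable_period _ _ hv).
  exact/measurable_EFinP.
move=> t Dt; rewrite /= lee_fin (le_trans (uv _ Dt))// ler_norm//.
Qed.

Lemma intgM u v (B : R) : measurable_fun per u ->
  (forall t, per t -> `|u t| <= B) -> intg v -> intg (fun t => u t * v t).
Proof.
move=> mu_ ub hv; apply: (@intg_le _ (fun t => B * `|v t|)); last 2 first.
- by apply: intgZ; exact: intg_norm.
- by move=> t Dt; rewrite normrM ler_wpM2r// ub.
by apply: measurable_funM => //; exact: intg_meas.
Qed.

Lemma intg_sum n (h : nat -> R -> R) : (forall i, intg (h i)) ->
  intg (fun t => \sum_(i < n) h i t).
Proof.
move=> hh; elim: n => [|n IH].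
  by under [X in intg X]eq_fun do rewrite big_ord0; exact: intg_cst.
by under [X in intg X]eq_fun do rewrite big_ord_recr /=; exact: intgD.
Qed.

Local Notation "\I u" := (Rintegral mu per u) (at level 10, u at level 9).

Lemma RI_cst (c : R) : \I (fun=> c) = 2 * pi * c.
Proof. by rewrite Rintegral_cst// [X in fine X]mu_period/= mulrC. Qed.

Definition cmeas k := measurable_fun per (fun t => complex.Re (k t)) /\
  measurable_fun per (fun t => complex.Im (k t)).
Definition cintg k := intg (fun t => complex.Re (k t)) /\
  intg (fun t => complex.Im (k t)).
(** Componentwise, in agreement with the split integral in the definition of [outer]. *)
Definition cint k : C := ((\I (fun t => complex.Re (k t))) +i*
  (\I (fun t => complex.Im (k t))))%C.

Lemma cintg_cmeas k : cintg k -> cmeas k.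
Proof. by move=> [h1 h2]; split; exact: intg_meas. Qed.

Lemma cintg_real u : intg u -> cintg (fun t => (u t)%:C%C).
Proof. by move=> hu; split => //=; exact: intg_cst. Qed.

Lemma cint_real u : cint (fun t => (u t)%:C%C) = (\I u)%:C%C.
Proof. by apply: complexP => //=; rewrite RI_cst mulr0. Qed.

Lemma eq_cintg f g : (forall t, f t = g t) -> cintg f -> cintg g.
Proof. by move=> /funext ->. Qed.

Lemma eq_cint f g : (forall t, f t = g t) -> cint f = cint g.
Proof. by move=> /funext ->. Qed.

Lemma cmeas_cont k : (forall t, (fun s => k s : C^o) @ t --> (k t : C^o)) -> cmeas k.
Proof.
move=> kc; split; apply: measurable_funTS; apply: continuous_measurable_fun => t;
  by have /cvgCP[] := kc t.
Qed.

Lemma cintgD f g : cintg f -> cintg g -> cintg (fun t => f t + g t).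
Proof.
move=> [f1 f2] [g1 g2]; split.
- by under [X in intg X]eq_fun do rewrite cReD; exact: intgD.
- by under [X in intg X]eq_fun do rewrite cImD; exact: intgD.
Qed.

Lemma cintgN f : cintg f -> cintg (fun t => - f t).
Proof.
move=> [f1 f2]; split.
- by under [X in intg X]eq_fun do rewrite cReN; exact: intgN.
- by under [X in intg X]eq_fun do rewrite cImN; exact: intgN.
Qed.

Lemma cintgB f g : cintg f -> cintg g -> cintg (fun t => f t - g t).
Proof. by move=> hf /cintgN; exact: cintgD. Qed.

Lemma cintgM k f (B : R) : cmeas k -> (forall t, per t -> cabs (k t) <= B) ->
  cintg f -> cintg (fun t => k t * f t).
Proof.
move=> [m1 m2] kb [f1 f2].
have k1 t : per t -> `|complex.Re (k t)| <= B.
  by move=> Dt; apply: le_trans (kb _ Dt); exact: Re_le_cabs.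
have k2 t : per t -> `|complex.Im (k t)| <= B.
  by move=> Dt; apply: le_trans (kb _ Dt); exact: Im_le_cabs.
split.
- under [X in intg X]eq_fun do rewrite cReM.
  by apply: intgB; apply: (@intgM _ _ B).
- under [X in intg X]eq_fun do rewrite cImM.
  by apply: intgD; apply: (@intgM _ _ B).
Qed.

Lemma cintgZ (c : C) f : cintg f -> cintg (fun t => c * f t).
Proof.
apply: (@cintgM (fun=> c) f (cabs c)) => //.
Qed.

Lemma cintD f g : cintg f -> cintg g -> cint (fun t => f t + g t) = cint f + cint g.
Proof.
move=> [f1 f2] [g1 g2]; rewrite /cint.
under eq_Rintegral do rewrite cReD; rewrite RintegralD//.
by under [X in (_ +i* X)%C]eq_Rintegral do rewrite cImD; rewrite RintegralD.
Qed.

Lemma cintZ (c : C) f : cintg f -> cint (fun t => c * f t) = c * cint f.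
Proof.
move=> [f1 f2]; rewrite /cint.
have i1 (x : R) : intg (fun t => x * complex.Re (f t)) by exact: intgZ.
have i2 (x : R) : intg (fun t => x * complex.Im (f t)) by exact: intgZ.
under eq_Rintegral do rewrite cReM.
under [X in (_ +i* X)%C]eq_Rintegral do rewrite cImM.
rewrite RintegralB ?RintegralD// ?RintegralZl//; try exact: i1; try exact: i2.
by case: c.
Qed.

Lemma cintN f : cintg f -> cint (fun t => - f t) = - cint f.
Proof.
by move=> hf; rewrite -mulN1r -cintZ//; apply: eq_cint => t; rewrite mulN1r.
Qed.

Lemma cintB f g : cintg f -> cintg g -> cint (fun t => f t - g t) = cint f - cint g.
Proof. by move=> hf hg; rewrite cintD ?cintN//; exact: cintgN. Qed.

Lemma cintg0 : cintg (fun=> 0).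
Proof. by split; exact: intg_cst. Qed.

Lemma cint0 : cint (fun=> 0) = 0.
Proof. by rewrite /cint /= RI_cst mulr0. Qed.

Lemma cintg_sum n (h : nat -> R -> C) : (forall i, cintg (h i)) ->
  cintg (fun t => \sum_(i < n) h i t).
Proof.
move=> hh; elim: n => [|n IH].
  by under [X in cintg X]eq_fun do rewrite big_ord0; exact: cintg0.
by under [X in cintg X]eq_fun do rewrite big_ord_recr /=; exact: cintgD.
Qed.

Lemma cint_sum n (h : nat -> R -> C) : (forall i, cintg (h i)) ->
  cint (fun t => \sum_(i < n) h i t) = \sum_(i < n) cint (h i).
Proof.
move=> hh; elim: n => [|n IH].
  by rewrite big_ord0 -[RHS]cint0; apply: eq_cint => t; rewrite big_ord0.
rewrite big_ord_recr /= -IH -cintD//; last exact: cintg_sum.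
by apply: eq_cint => t; rewrite big_ord_recr.
Qed.

(* The factor 2 comes from estimating real and imaginary parts separately. *)
Lemma cabs_cint_le f u : cintg f -> intg u ->
  (forall t, per t -> cabs (f t) <= u t) -> cabs (cint f) <= 2 * \I u.
Proof.
move=> [f1 f2] hu fu; apply: le_trans (cabs_le_ReIm _) _ => /=.
rewrite mulr2n mulrDl mul1r; apply: lerD;
  (apply: le_trans (le_normr_Rintegral _ _) _ => //;
   apply: le_Rintegral => //; first exact: intg_norm);
  move=> t Dt; apply: le_trans (fu _ Dt); [exact: Re_le_cabs|exact: Im_le_cabs].
Qed.

Lemma intg_cabs f : cintg f -> intg (fun t => cabs (f t)).
Proof.
move=> [f1 f2]; apply: (@intg_le _ (fun t => `|complex.Re (f t)| + `|complex.Im (f t)|)).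
- apply: (@measurableT_comp _ _ _ _ _ _ (@Num.sqrt R)).
    exact: continuous_measurable_fun (@sqrt_continuous R).
  by apply: measurable_funD; apply: measurable_funX; exact: intg_meas.
- by apply: intgD; exact: intg_norm.
- move=> t Dt; rewrite ger0_norm ?cabs_ge0//; exact: cabs_le_ReIm.
Qed.

End PeriodIntegral.
#[global] Hint Resolve measurable_period : core.

(** * The Schwarz kernel and the Herglotz integral *)

Section Schwarz.
Variable R : realType.
Local Notation C := (R[i]).
Local Notation mu := (@lebesgue_measure R).
Local Notation per := (@period R).
Local Notation "\I u" := (Rintegral mu per u) (at level 10, u at level 9).
Implicit Types (z : C) (u : R -> R) (f k : R -> C).

(* [2 * pi] times the Herglotz integral of [u]; likewise [PC] and [PI] below are
   [2 * pi] times the Poisson integral of a complex and a real function. *)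
Definition SI u z : C := cint (fun t => schwarz t z * (u t)%:C%C).

Lemma cabs_nat n : cabs (n%:R : C) = n%:R.
Proof. by rewrite -(rmorph_nat (real_complex R)) cabsR ger0_norm. Qed.

Lemma disk_gap z : disk z -> 0 < 1 - cabs z.
Proof. by rewrite /disk subr_gt0. Qed.

Lemma expi_sub_ge z t : 1 - cabs z <= cabs (expi t - z).
Proof.
rewrite lerBlDr -(cabs_expi t) -{1}(subrK z (expi t)); exact: cabsD.
Qed.

Lemma expi_sub_neq0 z t : disk z -> expi t - z != 0.
Proof.
by move=> /disk_gap h; rewrite -cabs_gt0; apply: lt_le_trans (expi_sub_ge _ _).
Qed.

Lemma schwarz_le t z : disk z -> cabs (schwarz t z) <= 2 / (1 - cabs z).
Proof.
move=> zd; have h := disk_gap zd; rewrite /schwarz cabsM cabsV.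
rewrite ler_pM ?invr_ge0 ?cabs_ge0//.
  apply: le_trans (cabsD _ _) _; rewrite cabs_expi; move: h; lra.
rewrite lef_pV2 ?posrE ?expi_sub_ge//; apply: lt_le_trans h (expi_sub_ge _ _).
Qed.

Lemma cvg_schwarz t z : disk z ->
  (fun s => schwarz s z : C^o) @ t --> (schwarz t z : C^o).
Proof.
move=> zd; have e : (fun s : R => expi s : C^o) @ t --> (expi t : C^o).
  by apply: cvg_expi; exact: cvg_id.
rewrite /schwarz; apply: cvgCM.
  by apply: cvgCD; [exact: e|exact: cvgC_cst].
apply: cvgCV; first exact: expi_sub_neq0.
by apply: cvgCB; [exact: e|exact: cvgC_cst].
Qed.

Lemma cmeas_schwarz z : disk z -> cmeas (fun t => schwarz t z).
Proof. by move=> zd; apply: cmeas_cont => t; exact: cvg_schwarz. Qed.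

Lemma cintg_schwarz z f : disk z -> cintg f -> cintg (fun t => schwarz t z * f t).
Proof.
move=> zd; apply: (@cintgM _ _ _ (2 / (1 - cabs z))); first exact: cmeas_schwarz.
by move=> t _; exact: schwarz_le.
Qed.

Lemma cintg_SI z u : disk z -> intg u -> cintg (fun t => schwarz t z * (u t)%:C%C).
Proof. by move=> zd hu; apply: cintg_schwarz => //; exact: cintg_real. Qed.

Lemma SI_Rintegral u z : SI u z =
  ((\I (fun t => complex.Re (schwarz t z) * u t)) +i*
   (\I (fun t => complex.Im (schwarz t z) * u t)))%C.
Proof.
by rewrite /SI /cint; congr (_ +i* _)%C; apply: eq_Rintegral => t _;
  rewrite mulrC ?cReZ ?cImZ mulrC.
Qed.

Lemma cabs_cint_kernel k u (B : R) : cmeas k -> intg u ->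
  (forall t, per t -> cabs (k t) <= B) ->
  cabs (cint (fun t => k t * (u t)%:C%C)) <= 2 * (B * \I (fun t => `|u t|)).
Proof.
move=> mk hu kB; rewrite -RintegralZl//; last exact: intg_norm.
apply: cabs_cint_le; first by apply: cintgM; eauto; exact: cintg_real.
  by apply: intgZ; exact: intg_norm.
by move=> t Dt; rewrite cabsM cabsR ler_wpM2r// kB.
Qed.

(** Differentiation under the integral sign without a limit theorem: the error of the difference
    quotient is exactly [h] times an integral whose kernel stays bounded for small [h]. *)
Lemma derivable_SI u z : intg u -> disk z -> @derivable _ C^o C^o (SI u) z 1.
Proof.
move=> hu zd; apply/derivableCP.
set d := 1 - cabs z; have d0 : 0 < d by exact: disk_gap.
(* The derivative of [schwarz t z] with respect to [z]. *)
pose k t : C := 2 * expi t / (expi t - z) ^+ 2.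
exists (cint (fun t => k t * (u t)%:C%C)).
have kc t : (fun s => k s : C^o) @ t --> (k t : C^o).
  have e : (fun s : R => expi s : C^o) @ t --> (expi t : C^o).
    by apply: cvg_expi; exact: cvg_id.
  apply: cvgCM; first by apply: cvgCM; [exact: cvgC_cst|exact: e].
  apply: cvgCV; first by rewrite expf_neq0// expi_sub_neq0.
  have e2 : (fun s : R => expi s - z : C^o) @ t --> (expi t - z : C^o).
    by apply: cvgCB; [exact: e|exact: cvgC_cst].
  by rewrite expr2; under eq_fun do rewrite expr2; exact: cvgCM.
have kB t : cabs (k t) <= 2 / d ^+ 2.
  rewrite /k cabsM cabsV cabsX cabsM cabs_expi mulr1 cabs_nat.
  rewrite ler_pM2l// lef_pV2 ?posrE ?exprn_gt0//; last by rewrite cabs_gt0 expi_sub_neq0.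
  by apply: lerXn2r; rewrite ?nnegrE ?cabs_ge0 ?expi_sub_ge// ltW.
have kI : cintg (fun t => k t * (u t)%:C%C).
  apply: (@cintgM _ _ _ (2 / d ^+ 2)); [exact: cmeas_cont|by move=> *; exact: kB|exact: cintg_real].
apply/cvgC_dist/cvgrPdist_le => e e0.
set A := \I (fun t => `|u t|); have A0 : 0 <= A by apply: Rintegral_ge0.
(* For [cabs h < d / 2] the point [h + z] stays at distance at least [d / 2] from the circle, so the
   second-order kernel is at most [2 / (d / 2 * d ^+ 2)]. *)
pose M := 2 * (4 / d ^+ 3 * A).
have M0 : 0 <= M.
  by rewrite mulr_ge0// mulr_ge0// divr_ge0// exprn_ge0// ltW.
have d20 : 0 < d / 2 by rewrite divr_gt0.
have N1 : \forall h \near (0 : C^o), cabs h < Num.min (d / 2) (e / (M + 1)).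
  have /cvgC_dist/cvgrPdist_lt/(_ (Num.min (d / 2) (e / (M + 1)))) := @cvg_id C^o (nbhs (0 : C^o)).
  rewrite lt_min d20 divr_gt0//=; last by rewrite ltr_wpDl.
  move=> /(_ isT); apply: filterS => h.
  by rewrite sub0r normrN subr0 (ger0_norm (cabs_ge0 _)).
rewrite near_withinE; apply: filterS N1 => h; rewrite lt_min => /andP[h1 h2] h0.
rewrite sub0r normrN (ger0_norm (cabs_ge0 _)).
have zhd : disk (h + z).
  by rewrite /disk; apply: le_lt_trans (cabsD _ _) _; move: h1 d0; rewrite /d; lra.
have -> : h^-1 * (SI u (h + z) - SI u z) - cint (fun t => k t * (u t)%:C%C) =
   h * cint (fun t => (h^-1 * (h^-1 * (schwarz t (h + z) - schwarz t z) - k t)) * (u t)%:C%C).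
  have I1 := cintg_SI zhd hu; have I2 := cintg_SI zd hu.
  have I3 := cintgZ h^-1 (cintgB I1 I2).
  have I5 : cintg (fun t => h^-1 * (h^-1 * (schwarz t (h + z) - schwarz t z) - k t) * (u t)%:C%C).
    apply: (eq_cintg _ (cintgZ h^-1 (cintgB I3 kI))) => t; ring.
  rewrite -(cintZ h I5) -(cintB I1 I2) -(cintZ h^-1 (cintgB I1 I2)) -(cintB I3 kI).
  by apply: eq_cint => t; rewrite !mulrA divff//; ring.
have KE t : h^-1 * (h^-1 * (schwarz t (h + z) - schwarz t z) - k t) =
    2 * expi t / ((expi t - (h + z)) * (expi t - z) ^+ 2).
  rewrite /schwarz /k; field.
  by rewrite h0 expi_sub_neq0// expi_sub_neq0.
rewrite cabsM.
have B1 : cabs (cint (fun t => (h^-1 * (h^-1 * (schwarz t (h + z) - schwarz t z) - k t)) *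
   (u t)%:C%C)) <= M.
  apply: cabs_cint_kernel => //.
    apply: cmeas_cont => t.
    apply: cvgCM; first exact: cvgC_cst.
    apply: cvgCB; last exact: kc; apply: cvgCM; first exact: cvgC_cst.
    by apply: cvgCB; exact: cvg_schwarz.
  move=> t _; rewrite KE cabsM cabsV [cabs (2 * _)]cabsM
    [cabs (_ * _ ^+ 2)]cabsM cabsX cabs_expi mulr1 cabs_nat.
  have -> : 4 / d ^+ 3 = 2 * ((d / 2)^-1 * (d ^+ 2)^-1) by field; rewrite gt_eqF.
  rewrite ler_pM2l// -invfM lef_pV2 ?posrE ?mulr_gt0 ?exprn_gt0//; last 2 first.
  - by rewrite cabs_gt0 expi_sub_neq0.
  - by rewrite cabs_gt0 expi_sub_neq0.
  apply: ler_pM; [exact: ltW|by rewrite exprn_ge0// ltW| |].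
    apply: le_trans (expi_sub_ge _ _); have := cabsD h z; move: h1; rewrite /d; lra.
  by apply: lerXn2r; rewrite ?nnegrE ?cabs_ge0 ?expi_sub_ge// ltW.
  by rewrite cabs_gt0 expi_sub_neq0.
apply: le_trans (ler_wpM2l (cabs_ge0 _) B1) _.
apply: le_trans (_ : e / (M + 1) * M <= _).
  by rewrite ler_wpM2r// ltW.
by rewrite mulrAC ler_pdivrMr ?ltr_wpDl// ler_pM2l// lerDl.
Qed.

Lemma holo_SI u : intg u -> holo (SI u).
Proof. by move=> hu z zd; exact: derivable_SI. Qed.

End Schwarz.

(** * Orthogonality of exponentials and expansion of the kernel *)

Section Fourier.
Variable R : realType.
Local Notation C := (R[i]).
Local Notation mu := (@lebesgue_measure R).
Local Notation per := (@period R).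
Local Notation "\I u" := (Rintegral mu per u) (at level 10, u at level 9).
Implicit Types (z w : C) (u : R -> R) (f : R -> C).

Lemma RI_FTC (F f : R -> R) : (forall t, is_derive t (1 : R) F (f t)) ->
  continuous f -> \I f = F (2 * pi) - F 0.
Proof.
move=> dF cf; have p0 : (0 : R) < 2 * pi by rewrite mulr_gt0 ?pi_gt0.
have cF : continuous F.
  move=> t; apply: differentiable_continuous; apply/derivable1_diffP.
  by have [] := dF t.
rewrite /Rintegral (@continuous_FTC2 _ f F)//.
- exact: continuous_subspaceT.
- split.
  + by move=> t _; have [] := dF t.
  + exact: cvg_at_right_filter (cF 0).
  + exact: cvg_at_left_filter (cF _).
- by move=> t _; rewrite derive1E; have [] := dF t.
Qed.

Lemma expi_2piMz (m : int) : expi (m%:~R * (2 * pi)) = 1 :> C.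
Proof.
have E n : expi (n%:R * (2 * pi)) = 1 :> C.
  by rewrite expiMn /expi mulr_natl cos2pi sin2pi expr1n.
case: m => n; first exact: E.
by rewrite NegzE mulrNz mulNr expiN E invr1.
Qed.

Lemma continuous_scale (x : R) : continuous (fun t : R => x * t).
Proof. by move=> t; apply: cvgM; [exact: cvg_cst|exact: cvg_id]. Qed.

Lemma cint_expi (m : int) :
  cint (fun t => expi (m%:~R * t)) = (if m == 0 then 2 * pi else 0)%:C%C :> C.
Proof.
have [->|m0] := eqVneq m 0.
  rewrite -[2 * pi in RHS]mulr1 -RI_cst -cint_real; apply: eq_cint => t.
  by rewrite mul0r expi0.
have x0 : (m%:~R : R) != 0 by rewrite intr_eq0.
have := expi_2piMz m; set x := m%:~R => -[E1 E2].
have dx t : is_derive t (1 : R) (fun t => x * t) x.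
  by apply: is_derive_eq; rewrite scaler1.
have cS : continuous (fun t => sin (x * t)).
  by move=> t; apply: continuous_comp; [exact: continuous_scale|exact: continuous_sin].
have cC : continuous (fun t => cos (x * t)).
  by move=> t; apply: continuous_comp; [exact: continuous_scale|exact: continuous_cos].
have DS t : is_derive t (1 : R) (fun t => x^-1 * sin (x * t)) (cos (x * t)).
  have D := is_derive1_comp (is_derive_sin (x * t)) (dx t).
  by apply: is_derive_eq; rewrite /GRing.scale/= mulrCA mulVf// mulr1.
have DC t : is_derive t (1 : R) (fun t => x^-1 * - cos (x * t)) (sin (x * t)).
  have D := is_derive1_comp (is_derive_cos (x * t)) (dx t).
  by apply: is_derive_eq; rewrite /GRing.scale/= mulNr opprK mulrCA mulVf// mulr1.
apply: complexP => /=.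
- by rewrite (RI_FTC DS cC) E2 !mulr0 sin0 mulr0 subrr.
- by rewrite (RI_FTC DC cS) E1 mulr0 cos0 subrr.
Qed.

Lemma cvg_expiX n t : (fun s : R => expi s ^+ n : C^o) @ t --> (expi t ^+ n : C^o).
Proof.
have e : (fun s : R => expi s : C^o) @ t --> (expi t : C^o).
  by apply: cvg_expi; exact: cvg_id.
elim: n => [|n IH]; first exact: cvgC_cst.
have -> : (fun s : R => expi s ^+ n.+1 : C^o) = (fun s => expi s * expi s ^+ n).
  by apply/funext => s; rewrite exprS.
by rewrite exprS; exact: (cvgCM _ e IH).
Qed.

Lemma cintg_cont f : (forall t, (fun s => f s : C^o) @ t --> (f t : C^o)) -> cintg f.
Proof.
move=> fc; have cpt : compact per by exact: segment_compact.
have fR : continuous (fun t => complex.Re (f t)) by move=> t; have /cvgCP[] := fc t.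
have fI : continuous (fun t => complex.Im (f t)) by move=> t; have /cvgCP[] := fc t.
split; apply: continuous_compact_integrable => //; exact: continuous_subspaceT.
Qed.

Lemma cvg_expiVX n t :
  (fun s : R => (expi s ^+ n)^-1 : C^o) @ t --> ((expi t ^+ n)^-1 : C^o).
Proof.
by apply: cvgCV; [rewrite expf_neq0 ?expi_neq0|exact: cvg_expiX].
Qed.

Lemma cintg_expiX n : cintg (fun t => expi t ^+ n : C).
Proof. by apply: cintg_cont => t; exact: cvg_expiX. Qed.

Lemma cintg_expiXV n m : cintg (fun t => (expi t ^+ m)^-1 * expi t ^+ n : C).
Proof.
by apply: cintg_cont => t; apply: cvgCM; [exact: cvg_expiVX|exact: cvg_expiX].
Qed.

Lemma cint_expiXV n m : cint (fun t => (expi t ^+ m)^-1 * expi t ^+ n : C) =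
  (if n == m then 2 * pi else 0)%:C%C.
Proof.
have -> : (n == m) = ((n%:Z - m%:Z)%R == 0 :> int) by rewrite subr_eq0 eqz_nat.
rewrite -cint_expi; apply: eq_cint => t.
by rewrite rmorphB/= mulrBl expiD expiN !expiMn mulrC.
Qed.

Lemma cint_expiX n : cint (fun t => expi t ^+ n : C) = (if n == 0%N then 2 * pi else 0)%:C%C.
Proof.
by rewrite -(cint_expiXV n 0); apply: eq_cint => t; rewrite expr0 invr1 mul1r.
Qed.

Definition PC f z : C := cint (fun t => (complex.Re (schwarz t z))%:C%C * f t).

(** With [q = z / expi t] the kernel is [-1 + 2 / (1 - q)]. The remainder of the geometric series is
    kept in closed form, so that it can be bounded uniformly in [t]. *)
Lemma schwarz_expand t z N : disk z ->
  schwarz t z = -1 + 2 * \sum_(m < N) z ^+ m * (expi t ^+ m)^-1 +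
     2 * (z / expi t) ^+ N * expi t / (expi t - z).
Proof.
move=> zd; have e0 := expi_neq0 t; have d0 := expi_sub_neq0 t zd.
have qE : expi t - z = (1 - z / expi t) * expi t by rewrite mulrBl mul1r divfK.
have q1 : 1 - z / expi t != 0.
  by apply: contra d0 => /eqP H; rewrite qE H mul0r.
under eq_bigr do rewrite -exprVn -exprMn.
have -> : \sum_(m < N) (z / expi t) ^+ m = (1 - (z / expi t) ^+ N) / (1 - z / expi t).
  apply: (mulfI q1); rewrite mulrCA divff// mulr1.
  by rewrite -[LHS]opprK -mulNr opprB -subrX1 opprB.
set Q := (z / expi t) ^+ N; rewrite /schwarz; field.
by rewrite d0 e0.
Qed.

Lemma cabs_schwarz_tail t z N : disk z ->
  cabs (2 * (z / expi t) ^+ N * expi t / (expi t - z)) <= 2 * cabs z ^+ N / (1 - cabs z).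
Proof.
move=> zd; have h := disk_gap zd.
rewrite cabsM cabsV !cabsM cabsX cabsM cabsV cabs_expi invr1 !mulr1 cabs_nat.
apply: ler_pM => //; [by rewrite mulr_ge0// exprn_ge0// cabs_ge0|by rewrite invr_ge0 cabs_ge0|].
by rewrite lef_pV2 ?posrE ?expi_sub_ge//; apply: lt_le_trans h (expi_sub_ge _ _).
Qed.

Lemma ReC_conj w : (complex.Re w)%:C%C = (w + conjc w) / 2.
Proof. exact: ReJ_add. Qed.

Lemma conj_expi t : conjc (expi t) = (expi t)^-1 :> C.
Proof. by rewrite -expiN /expi /= cosN sinN. Qed.

Lemma cmeas_Reschwarz z : disk z -> cmeas (fun t => (complex.Re (schwarz t z))%:C%C).
Proof.
move=> zd; apply: cmeas_cont => t; apply: cvg_realC.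
by have /cvgCP[] := @cvg_schwarz R t z zd.
Qed.

Lemma Reschwarz_le t z : disk z -> `|complex.Re (schwarz t z)| <= 2 / (1 - cabs z).
Proof. by move=> zd; apply: le_trans (Re_le_cabs _) (schwarz_le t zd). Qed.

Lemma cintg_PC f z : disk z -> cintg f ->
  cintg (fun t => (complex.Re (schwarz t z))%:C%C * f t).
Proof.
move=> zd; apply: (@cintgM _ _ _ (2 / (1 - cabs z))); first exact: cmeas_Reschwarz.
by move=> t _; rewrite cabsR Reschwarz_le.
Qed.

(** The real part of the kernel contains frequencies of both signs. Against [expi t ^+ n] only the
    term [m = n] of the negative ones contributes, once [N] exceeds [n]. The discrepancy does not
    depend on [N] but is bounded by a multiple of [cabs z ^+ N], hence is 0. *)
Lemma PC_expiX n z : disk z -> PC (fun t => expi t ^+ n) z = (2 * pi)%:C%C * z ^+ n.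
Proof.
move=> zd; have h := disk_gap zd.
pose tail N t : C := 2 * (z / expi t) ^+ N * expi t / (expi t - z).
pose poly N t : C := \sum_(m < N) (z ^+ m * ((expi t ^+ m)^-1 * expi t ^+ n)) +
   \sum_(m < N) (conjc z ^+ m * expi t ^+ (m + n)) - expi t ^+ n.
have E N t : (complex.Re (schwarz t z))%:C%C * expi t ^+ n - poly N t =
     (complex.Re (tail N t))%:C%C * expi t ^+ n.
  rewrite (schwarz_expand t N zd) -/(tail N t) !ReC_conj /poly.
  move: (tail N t) => T.
  have -> : conjc (-1 + 2 * (\sum_(m < N) z ^+ m * (expi t ^+ m)^-1) + T) =
      -1 + 2 * (\sum_(m < N) conjc z ^+ m * expi t ^+ m) + conjc T.
    rewrite !rmorphD rmorphN1 rmorphM rmorph_nat rmorph_sum; congr (_ + _ * _ + _).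
    apply: eq_bigr => m _; rewrite rmorphM; congr (_ * _); first exact: rmorphXn.
    by rewrite fmorphV rmorphXn -[X in (X ^+ _)^-1]/(conjc (expi t)) conj_expi exprVn invrK.
  have -> : \sum_(m < N) z ^+ m * ((expi t ^+ m)^-1 * expi t ^+ n) =
      (\sum_(m < N) z ^+ m * (expi t ^+ m)^-1) * expi t ^+ n.
    by rewrite big_distrl; apply: eq_bigr => m _; exact: mulrA.
  have -> : \sum_(m < N) conjc z ^+ m * expi t ^+ (m + n) =
      (\sum_(m < N) conjc z ^+ m * expi t ^+ m) * expi t ^+ n.
    by rewrite big_distrl; apply: eq_bigr => m _; rewrite exprD mulrA.
  set A := \sum_(_ < N) _; set B := \sum_(_ < N) _.
  by field.
pose a m t : C := z ^+ m * ((expi t ^+ m)^-1 * expi t ^+ n).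
pose b m t : C := conjc z ^+ m * expi t ^+ (m + n).
have Ia m : cintg (a m) by apply: cintgZ; exact: cintg_expiXV.
have Ib m : cintg (b m) by apply: cintgZ; exact: cintg_expiX.
have Isa N := @cintg_sum _ N a Ia; have Isb N := @cintg_sum _ N b Ib.
have Ipoly N : cintg (poly N) := cintgB (cintgD (Isa N) (Isb N)) (@cintg_expiX n).
have Ip N : (n < N)%N -> cint (poly N) = (2 * pi)%:C%C * z ^+ n.
  move=> nN; rewrite (cintB (cintgD (Isa N) (Isb N)) (@cintg_expiX n)) (cintD (Isa N) (Isb N)).
  rewrite (@cint_sum _ N a Ia) (@cint_sum _ N b Ib).
  have Ea m : cint (a m) = z ^+ m * (if n == m then 2 * pi else 0)%:C%C.
    by rewrite /a cintZ ?cint_expiXV//; exact: cintg_expiXV.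
  have Eb m : cint (b m) = conjc z ^+ m * (if (m + n)%N == 0%N then 2 * pi else 0)%:C%C.
    by rewrite /b cintZ ?cint_expiX//; exact: cintg_expiX.
  rewrite (bigD1 (Ordinal nN))//= Ea eqxx big1 ?addr0; last first.
    move=> m mn; rewrite Ea ifN ?mulr0//; apply: contra mn => /eqP nm.
    by apply/eqP/val_inj.
  (* The term [m = 0] of the conjugate sum cancels the subtracted integral of [expi t ^+ n]; the
     terms with [m > 0] integrate to 0. *)
  case: N nN => // N nN; rewrite big_ord_recl /= Eb expr0 mul1r add0n.
  rewrite big1 ?addr0; last by move=> m _; rewrite Eb /= mulr0.
  by rewrite cint_expiX addrK mulrC.
have bound N : (n < N)%N -> cabs (PC (fun t => expi t ^+ n) z - (2 * pi)%:C%C * z ^+ n) <=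
   (2 * (2 * pi) * 2 / (1 - cabs z)) * cabs z ^+ N.
  move=> nN; rewrite -(Ip N nN) /PC -cintB//; last by apply: cintg_PC => //; exact: cintg_expiX.
  have -> : (2 * (2 * pi) * 2 / (1 - cabs z)) * cabs z ^+ N =
    2 * \I (fun=> 2 * cabs z ^+ N / (1 - cabs z)) by rewrite RI_cst; ring.
  apply: cabs_cint_le; [|exact: intg_cst|].
    by apply: cintgB => //; apply: cintg_PC => //; exact: cintg_expiX.
  move=> t _; rewrite E cabsM cabsX cabs_expi expr1n mulr1 cabsR.
  by apply: le_trans (Re_le_cabs _) _; exact: cabs_schwarz_tail.
apply/eqP; rewrite -subr_eq0 -cabs_eq0 eq_le cabs_ge0 andbT.
have L : (fun N => (2 * (2 * pi) * 2 / (1 - cabs z)) * cabs z ^+ N) @ \oo --> (0 : R).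
  rewrite -[X in _ --> X](mulr0 (2 * (2 * pi) * 2 / (1 - cabs z))).
  apply: cvgM; first exact: cvg_cst.
  by apply: cvg_expr; rewrite ger0_norm ?cabs_ge0.
apply: (cvgr_to_ge L); near=> N; apply: bound; near: N; exact: nbhs_infty_gt.
Unshelve. all: by end_near. Qed.

End Fourier.

(** * Taylor polynomials and the reproducing property *)

Section Reproduce.
Variable R : realType.
Local Notation C := (R[i]).
Local Notation mu := (@lebesgue_measure R).
Local Notation per := (@period R).
Local Notation "\I u" := (Rintegral mu per u) (at level 10, u at level 9).
Implicit Types (z w : C) (u : R -> R) (f g : R -> C).

(** Turns an error estimate valid for every truncation order into an exact identity. *)
Lemma le0_geometric (c A x : R) N0 : 0 <= x -> x < 1 ->
  (forall N, (N0 < N)%N -> c <= A * x ^+ N) -> c <= 0.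
Proof.
move=> x0 x1 H.
have L : (fun N => A * x ^+ N) @ \oo --> (0 : R).
  rewrite -[X in _ --> X](mulr0 A).
  apply: cvgM; first exact: cvg_cst.
  by apply: cvg_expr; rewrite ger0_norm.
apply: (cvgr_to_ge L); near=> N; apply: H; near: N; exact: nbhs_infty_gt.
Unshelve. all: by end_near. Qed.

(** [2 * pi] times the Fourier coefficient of index [m]. *)
Definition coef u m : C := cint (fun t => (expi t ^+ m)^-1 * (u t)%:C%C).

(** For [N > 0], the Taylor polynomial of [SI u] at 0 of degree below [N]. The constant term enters
    with a minus sign because the summand [m = 0] counts it twice. *)
Definition spoly u N z : C :=
  - cint (fun t => (u t)%:C%C) + 2 * \sum_(m < N) z ^+ m * coef u m.

Lemma cintg_coef u m : intg u -> cintg (fun t => (expi t ^+ m)^-1 * (u t)%:C%C).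
Proof.
move=> hu; apply: (@cintgM _ _ _ 1); last exact: cintg_real.
  by apply: cmeas_cont => t; exact: cvg_expiVX.
by move=> t _; rewrite cabsV cabsX cabs_expi expr1n invr1.
Qed.

Lemma SI_expand u N z : intg u -> disk z ->
  cabs (SI u z - spoly u N z) <= 2 * ((2 * cabs z ^+ N / (1 - cabs z)) * \I (fun t => `|u t|)).
Proof.
move=> hu zd.
pose a m t : C := z ^+ m * ((expi t ^+ m)^-1 * (u t)%:C%C).
have Ia m : cintg (a m) by apply: cintgZ; exact: cintg_coef.
have I1 := @cintg_sum _ N a Ia; have I2 := cintgZ 2 I1.
have I0 := cintgN (cintg_real hu).
have -> : spoly u N z = cint (fun t => - (u t)%:C%C + 2 * \sum_(m < N) a m t).
  rewrite (cintD I0 I2) (cintN (cintg_real hu)) (cintZ 2 I1) (@cint_sum _ N a Ia).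
  rewrite /spoly; congr (_ + _ * _); apply: eq_bigr => m _.
  by rewrite /a cintZ//; exact: cintg_coef.
rewrite -(cintB (cintg_SI zd hu) (cintgD I0 I2)).
have E t : schwarz t z * (u t)%:C%C - (- (u t)%:C%C + 2 * \sum_(m < N) a m t) =
   (2 * (z / expi t) ^+ N * expi t / (expi t - z)) * (u t)%:C%C.
  rewrite (schwarz_expand t N zd) /a.
  have -> : \sum_(m < N) z ^+ m * ((expi t ^+ m)^-1 * (u t)%:C%C) =
      (\sum_(m < N) z ^+ m * (expi t ^+ m)^-1) * (u t)%:C%C.
    by rewrite big_distrl; apply: eq_bigr => m _; exact: mulrA.
  set A := \sum_(_ < N) _; set T := _ / (_ - z); ring.
rewrite (eq_cint E); apply: cabs_cint_kernel => //; last first.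
  by move=> t _; exact: cabs_schwarz_tail.
apply: cmeas_cont => t.
have e : (fun s : R => expi s : C^o) @ t --> (expi t : C^o).
  by apply: cvg_expi; exact: cvg_id.
apply: cvgCM; last first.
  by apply: cvgCV; [exact: expi_sub_neq0|apply: cvgCB; [exact: e|exact: cvgC_cst]].
apply: cvgCM; last exact: e.
apply: cvgCM; first exact: cvgC_cst.
have -> : (fun s : R => (z / expi s) ^+ N : C^o) = (fun s => z ^+ N * (expi s ^+ N)^-1).
  by apply/funext => s; rewrite exprMn exprVn.
rewrite exprMn exprVn; apply: cvgCM; [exact: cvgC_cst|exact: cvg_expiVX].
Qed.

Lemma PC_D f g z : disk z -> cintg f -> cintg g ->
  PC (fun t => f t + g t) z = PC f z + PC g z.
Proof.
move=> zd hf hg; rewrite /PC -(cintD (cintg_PC zd hf) (cintg_PC zd hg)).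
by apply: eq_cint => t; rewrite mulrDr.
Qed.

Lemma PC_Z c f z : disk z -> cintg f -> PC (fun t => c * f t) z = c * PC f z.
Proof.
move=> zd hf; rewrite /PC -(cintZ c (cintg_PC zd hf)).
by apply: eq_cint => t; rewrite mulrCA.
Qed.

Lemma PC_B f g z : disk z -> cintg f -> cintg g ->
  PC (fun t => f t - g t) z = PC f z - PC g z.
Proof.
move=> zd hf hg; rewrite /PC -(cintB (cintg_PC zd hf) (cintg_PC zd hg)).
by apply: eq_cint => t; rewrite mulrBr.
Qed.

Lemma PC_cst c z : disk z -> PC (fun=> c) z = (2 * pi)%:C%C * c.
Proof.
move=> zd; rewrite -[in RHS](mulr1 c) mulrCA -[X in c * X]/((2 * pi)%:C%C * z ^+ 0) -PC_expiX//.
rewrite -PC_Z//; last exact: cintg_expiX.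
by apply: eq_cint => t; rewrite expr0 mulr1.
Qed.

Lemma cvg_spoly_circle u N (r : R) t :
  (fun s => spoly u N (r%:C%C * expi s) : C^o) @ t --> (spoly u N (r%:C%C * expi t) : C^o).
Proof.
apply: cvgCD; first exact: cvgC_cst.
apply: cvgCM; first exact: cvgC_cst.
elim: N => [|N IH].
  have -> : (fun s : R => \sum_(m < 0) (r%:C%C * expi s) ^+ m * coef u m : C^o) = fun=> 0.
    by apply/funext => s; rewrite big_ord0.
  by rewrite big_ord0; exact: cvgC_cst.
have -> : (fun s : R => \sum_(m < N.+1) (r%:C%C * expi s) ^+ m * coef u m : C^o) =
  fun s => \sum_(m < N) (r%:C%C * expi s) ^+ m * coef u m + (r%:C%C ^+ N * expi s ^+ N) * coef u N.
  by apply/funext => s; rewrite big_ord_recr /= exprMn.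
rewrite big_ord_recr /= exprMn; apply: cvgCD; first exact: IH.
apply: cvgCM; last exact: cvgC_cst.
by apply: cvgCM; [exact: cvgC_cst|exact: cvg_expiX].
Qed.

Lemma cintg_spoly u N (r : R) : cintg (fun t => spoly u N (r%:C%C * expi t)).
Proof. by apply: cintg_cont => t; exact: cvg_spoly_circle. Qed.

(** Reduces to monomials. Used with [r < 1] to approximate [SI u] and with [r = 1] on the unit
    circle itself. *)
Lemma PC_spoly u N (r : R) z : disk z ->
  PC (fun t => spoly u N (r%:C%C * expi t)) z = (2 * pi)%:C%C * spoly u N (r%:C%C * z).
Proof.
move=> zd.
pose a m t : C := (r%:C%C ^+ m * coef u m) * expi t ^+ m.
have Ia m : cintg (a m) by apply: cintgZ; exact: cintg_expiX.
have cc : cintg (fun=> - cint (fun t => (u t)%:C%C)) by split; exact: intg_cst.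
have I1 M := @cintg_sum _ M a Ia.
have -> : PC (fun t => spoly u N (r%:C%C * expi t)) z =
   PC (fun t => - cint (fun t => (u t)%:C%C) + 2 * \sum_(m < N) a m t) z.
  apply: eq_cint => t; congr (_ * (_ + _ * _)); apply: eq_bigr => m _.
  by rewrite /a exprMn mulrAC.
rewrite (PC_D zd cc (cintgZ 2 (I1 N))) (PC_Z 2 zd (I1 N)) PC_cst//.
rewrite /spoly [in RHS]mulrDr; congr (_ + _); rewrite [in RHS]mulrCA; congr (_ * _).
elim: N => [|N IH].
  rewrite big_ord0 mulr0 -[RHS](mulr0 (2 * pi)%:C%C) -(PC_cst 0 zd).
  by apply: eq_cint => t; rewrite big_ord0.
rewrite big_ord_recr /= mulrDr -IH.
have -> : (2 * pi)%:C%C * ((r%:C%C * z) ^+ N * coef u N) = PC (a N) z.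
  by rewrite /a PC_Z ?PC_expiX//; [rewrite exprMn; ring|exact: cintg_expiX].
rewrite -(PC_D zd (I1 N) (Ia N)).
by apply: eq_cint => t; rewrite big_ord_recr.
Qed.

Lemma holo_circle (F : C -> C) (r : R) t : holo F -> 0 <= r < 1 ->
  (fun s => F (r%:C%C * expi s) : C^o) @ t --> (F (r%:C%C * expi t) : C^o).
Proof.
move=> hF r01.
apply: (@continuous_cvg R C^o C^o (nbhs t) _ (fun s => r%:C%C * expi s : C^o) F (r%:C%C * expi t)).
  by apply: holo_continuous => //; exact: disk_radius.
by apply: cvgCM; [exact: cvgC_cst|apply: cvg_expi; exact: cvg_id].
Qed.

Lemma cintg_circle (F : C -> C) (r : R) : holo F -> 0 <= r < 1 ->
  cintg (fun t => F (r%:C%C * expi t)).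
Proof. by move=> hF r01; apply: cintg_cont => t; exact: holo_circle. Qed.

(** The identity is exact for [spoly u N], and on [cabs w <= r] the function [SI u] differs from
    that polynomial by a multiple of [r ^+ N]. *)
Lemma SI_reproduce u (r : R) z : intg u -> 0 <= r < 1 -> disk z ->
  PC (fun t => SI u (r%:C%C * expi t)) z = (2 * pi)%:C%C * SI u (r%:C%C * z).
Proof.
move=> hu r01 zd; have /andP[r0 r1] := r01.
have rzd : disk (r%:C%C * z) by apply: disk_scale; rewrite ?r0 ?ltW.
have p0 : 0 < 2 * pi :> R by rewrite mulr_gt0 ?pi_gt0.
set A := \I (fun t => `|u t|); have A0 : 0 <= A by apply: Rintegral_ge0.
have gz := disk_gap zd.
have gr : 0 < 1 - r by rewrite subr_gt0.
(* The first summand bounds the truncation error under the Poisson integral, the second the one at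
   the point [r z]. *)
pose B := 2 * (2 * pi * (2 / (1 - cabs z) * (2 * (2 / (1 - r) * A)))) +
          2 * pi * (2 * (2 / (1 - r) * A)).
have crz : cabs (r%:C%C * z) <= r.
  by rewrite cabsM cabsR ger0_norm// ler_piMr// ltW.
have tail N (w : C) : cabs w <= r -> disk w ->
   cabs (SI u w - spoly u N w) <= 2 * (2 / (1 - r) * A) * r ^+ N.
  move=> wr wd; apply: le_trans (SI_expand N hu wd) _.
  have -> : 2 * (2 / (1 - r) * A) * r ^+ N = 2 * (2 * r ^+ N / (1 - r) * A) by ring.
  rewrite ler_pM2l// ler_wpM2r//.
  apply: ler_pM; [by rewrite mulr_ge0// exprn_ge0// cabs_ge0|by rewrite invr_ge0 ltW// disk_gap| |].
    by rewrite ler_pM2l// lerXn2r// ?nnegrE ?cabs_ge0.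
  by rewrite lef_pV2 ?posrE ?disk_gap// lerB.
apply/eqP; rewrite -subr_eq0 -cabs_eq0 eq_le cabs_ge0 andbT.
apply: (@le0_geometric _ B r 0%N) => // N _.
have hS : cintg (fun t => SI u (r%:C%C * expi t)) by apply: cintg_circle => //; exact: holo_SI.
have -> : PC (fun t => SI u (r%:C%C * expi t)) z - (2 * pi)%:C%C * SI u (r%:C%C * z) =
  PC (fun t => SI u (r%:C%C * expi t) - spoly u N (r%:C%C * expi t)) z -
  (2 * pi)%:C%C * (SI u (r%:C%C * z) - spoly u N (r%:C%C * z)).
  by rewrite (PC_B zd hS (cintg_spoly u N r)) PC_spoly//; ring.
pose D := 2 * (2 / (1 - r) * A) * r ^+ N.
have -> : B * r ^+ N = 2 * \I (fun=> 2 / (1 - cabs z) * D) + 2 * pi * D.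
  by rewrite RI_cst /B /D; ring.
apply: le_trans (cabsB _ _) _; apply: lerD; last first.
  by rewrite cabsM cabsR gtr0_norm// ler_pM2l//; exact: tail.
apply: cabs_cint_le; [|exact: intg_cst|].
  by apply: cintg_PC => //; apply: cintgB => //; exact: cintg_spoly.
move=> t _; rewrite cabsM cabsR; apply: ler_pM => //; [exact: cabs_ge0|exact: Reschwarz_le|].
apply: tail; last exact: disk_radius.
by rewrite cabsM cabs_expi mulr1 cabsR ger0_norm.
Qed.

End Reproduce.

(** * Fatou's theorem on radial limits *)

Section PoissonKernel.
Variable R : realType.
Local Notation C := (R[i]).
Implicit Types (z w : C) (x y r s t : R).

(** By the mean value theorem, as the cosine is at least [cos 1] on the interval. The sharp constant
    is irrelevant below; only its positivity matters. *)
Lemma sinM1_ge y : 0 <= y <= 1 -> cos 1 * y <= sin y.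
Proof.
move=> /andP[y0 y1].
have [->|yn0] := eqVneq y 0; first by rewrite mulr0 sin0.
have {}y0 : 0 < y by rewrite lt_def yn0.
have [c] : exists2 c : R, c \in `]0, y[%R & sin y - sin 0 = cos c * (y - 0).
  apply: (@MVT _ sin cos) => //; apply: continuous_subspaceT; exact: continuous_sin.
rewrite in_itv/= sin0 !subr0 => /andP[c0 cy] ->.
rewrite ler_wpM2r// ?ltW//.
have pi2 := @pi_ge2 R.
by rewrite ltr_cos ?in_itv/= ?(andP _)//; [lra|apply/andP; split; lra|apply/andP; split; lra].
Qed.

(** By the half-angle formula [1 - cos x = 2 * sin (x / 2) ^+ 2]; hence the range [|x| <= 2]. *)
Lemma one_minus_cos_ge x : `|x| <= 2 -> cos 1 ^+ 2 / 2 * x ^+ 2 <= 1 - cos x.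
Proof.
wlog x0 : x / 0 <= x.
  move=> H; have [/H//|xlt] := leP 0 x.
  by rewrite -(normrN x) -(sqrrN x) -(cosN x); apply: H; rewrite oppr_ge0 ltW.
rewrite ger0_norm// => x2.
have -> : x = (x / 2) *+ 2 by rewrite -mulr_natr divfK.
rewrite cos_mulr2n; set y := x / 2.
have y01 : 0 <= y <= 1 by rewrite /y; lra.
have H := sinM1_ge y01; have c1 := @cos1_gt0 R.
have cy0 : 0 <= cos 1 * y by case/andP: y01 => y0 _; rewrite mulr_ge0// ltW.
have : (cos 1 * y) ^+ 2 <= sin y ^+ 2.
  by rewrite lerXn2r// nnegrE (le_trans cy0).
have -> : cos 1 ^+ 2 / 2 * (y *+ 2) ^+ 2 = 2 * (cos 1 * y) ^+ 2 by field.
have -> : 1 - (cos y ^+ 2 *+ 2 - 1) = 2 * (1 - cos y ^+ 2) by ring.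
by rewrite sin2cos2 ler_pM2l.
Qed.

Lemma cRe_div z w : complex.Re (z / w) =
  (complex.Re z * complex.Re w + complex.Im z * complex.Im w) /
  (complex.Re w ^+ 2 + complex.Im w ^+ 2).
Proof.
by case: z w => a b [c d]; rewrite cReM /= mulrN opprK !mulrA -mulrDl.
Qed.

Lemma poisson_den_gt0 r x : 0 <= r < 1 -> 0 < (1 - r) ^+ 2 + 2 * r * (1 - cos x).
Proof.
move=> /andP[r0 r1]; apply: ltr_wpDr; last by rewrite exprn_gt0// subr_gt0.
by rewrite mulr_ge0 ?mulr_ge0// subr_ge0 cos_le1.
Qed.

(** The usual denominator [1 - 2 r cos (s - t) + r^2] is arranged as a sum of two terms that are
    nonnegative for [0 <= r], which makes lower bounds immediate. *)
Lemma poisson_formula r s t : complex.Re (schwarz s (r%:C%C * expi t)) =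
  (1 - r ^+ 2) / ((1 - r) ^+ 2 + 2 * r * (1 - cos (s - t))).
Proof.
rewrite /schwarz cRe_div !cReD !cImD !cReN !cImN cReZ cImZ /= cosB.
have Es := cos2Dsin2 s; have Et := cos2Dsin2 t.
set a := cos s in Es *; set b := sin s in Es *; set c := cos t in Et *; set d := sin t in Et *.
congr (_ / _).
  transitivity ((a ^+ 2 + b ^+ 2) - r ^+ 2 * (c ^+ 2 + d ^+ 2)); first ring.
  by rewrite Es Et mulr1.
transitivity ((a ^+ 2 + b ^+ 2) + r ^+ 2 * (c ^+ 2 + d ^+ 2) - 2 * r * (a * c + b * d)); first ring.
by rewrite Es Et; ring.
Qed.

Lemma poisson_ge0 r s t : 0 <= r < 1 -> 0 <= complex.Re (schwarz s (r%:C%C * expi t)).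
Proof.
move=> r01; rewrite poisson_formula divr_ge0//; last exact: ltW (poisson_den_gt0 _ r01).
by case/andP: r01 => r0 r1; rewrite subr_ge0 expr_le1// ltW.
Qed.

(** For [r >= 1 / 2] the factor [2 * r] is at least 1, so the denominator is at least [m], while the
    numerator is [(1 - r) * (1 + r)]. *)
Lemma poisson_far r s t m : 1 / 2 <= r < 1 -> 0 < m -> m <= 1 - cos (s - t) ->
  complex.Re (schwarz s (r%:C%C * expi t)) <= 2 / m * (1 - r).
Proof.
move=> /andP[r2 r1] m0 mc; have r0 : 0 <= r by lra.
rewrite poisson_formula ler_pdivrMr ?poisson_den_gt0 ?r0//.
have -> : 2 / m * (1 - r) * ((1 - r) ^+ 2 + 2 * r * (1 - cos (s - t))) =
  (1 - r) * (2 / m * ((1 - r) ^+ 2 + 2 * r * (1 - cos (s - t)))) by ring.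
have -> : 1 - r ^+ 2 = (1 - r) * (1 + r) by ring.
rewrite ler_pM2l ?subr_gt0//.
apply: le_trans (_ : 2 / m * m <= _); first by rewrite divfK ?gt_eqF//; lra.
apply: ler_wpM2l; first by rewrite divr_ge0// ltW.
have h1 : 0 <= (1 - r) ^+ 2 by rewrite sqr_ge0.
have h2 : (1 - cos (s - t)) <= 2 * r * (1 - cos (s - t)).
  by rewrite ler_peMl ?subr_ge0 ?cos_le1//; lra.
by apply: le_trans mc _; apply: le_trans h2 _; rewrite lerDr.
Qed.

(** With [k = cos 1 ^+ 2 / 2 <= 1] the denominator is at least [k * ((1 - r) ^+ 2 + (s - t) ^+ 2)]
    and the numerator at most [2 * (1 - r)], which gives the constant [2 / k]. *)
Lemma poisson_near r s t : 1 / 2 <= r < 1 -> `|s - t| <= 2 ->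
  complex.Re (schwarz s (r%:C%C * expi t)) <=
  4 / cos 1 ^+ 2 * ((1 - r) / ((1 - r) ^+ 2 + (s - t) ^+ 2)).
Proof.
move=> /andP[r2 r1] x2; have r0 : 0 <= r by lra.
have H := one_minus_cos_ge x2; set x := s - t in H *.
have c1 := @cos1_gt0 R; set k := cos 1 ^+ 2 / 2 in H.
have k0 : 0 < k by rewrite divr_gt0// exprn_gt0.
have k1 : k <= 1 / 2.
  by rewrite /k ler_pM2r// -[leRHS](expr1n _ 2) lerXn2r ?nnegrE ?cos_le1// ltW.
have e0 : 0 < (1 - r) ^+ 2 by rewrite exprn_gt0// subr_gt0.
have q0 : 0 < (1 - r) ^+ 2 + x ^+ 2 by rewrite ltr_pwDl// sqr_ge0.
have -> : 4 / cos 1 ^+ 2 = 2 / k by rewrite /k; field; rewrite gt_eqF.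
rewrite poisson_formula ler_pdivrMr ?poisson_den_gt0 ?r0//.
have -> : 1 - r ^+ 2 = (1 - r) * (1 + r) by ring.
set D := _ + 2 * r * _; set q := _ + x ^+ 2 in q0 *.
have -> : 2 / k * ((1 - r) / q) * D = (1 - r) * (2 / k / q * D) by ring.
rewrite ler_pM2l ?subr_gt0//.
apply: le_trans (_ : 2 / k / q * (k * q) <= _).
  have -> : 2 / k / q * (k * q) = 2 by field; rewrite !gt_eqF.
  lra.
apply: ler_wpM2l; first by apply/ltW/divr_gt0 => //; exact: divr_gt0.
rewrite /q /D mulrDr; apply: lerD.
  by rewrite ler_piMl// ?ltW//; lra.
by apply: le_trans H _; rewrite ler_peMl ?subr_ge0 ?cos_le1//; lra.
Qed.

(* Dominates the Poisson kernel by averages over dyadic intervals, to which the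
   Lebesgue differentiation theorem applies. *)
Lemma dyadic_kernel (h x : R) K : 0 < h -> `|x| < 2 ^+ K * h ->
  h / (h ^+ 2 + x ^+ 2) <=
  \sum_(k < K.+1) 4 / (4 ^+ k * h) * (if `|x| < 2 ^+ k * h then 1 else 0).
Proof.
move=> h0; have q0 : 0 < h ^+ 2 + x ^+ 2 by rewrite ltr_pwDl ?sqr_ge0// exprn_gt0.
elim: K => [|K IH] xK.
  rewrite big_ord1 xK mulr1 expr0 mul1r.
  apply: le_trans (_ : 1 / h <= _); last by rewrite ler_pM2r ?invr_gt0// ler1n.
  rewrite ler_pdivrMr// mulrAC mul1r ler_pdivlMr// -expr2 lerDl sqr_ge0//.
rewrite big_ord_recr /= xK mulr1.
have t0 : 0 <= 4 / (4 ^+ K.+1 * h) by rewrite divr_ge0// mulr_ge0// ?exprn_ge0// ltW.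
have [xlt|xge] := ltP `|x| (2 ^+ K * h).
  by apply: le_trans (IH xlt) _; rewrite lerDl.
apply: le_trans (_ : 4 / (4 ^+ K.+1 * h) <= _); last first.
  rewrite lerDr sumr_ge0// => k _; apply: mulr_ge0; last by case: ifP.
  by rewrite divr_ge0// mulr_ge0// ?exprn_ge0// ltW.
(* On the outermost shell [|x| >= 2 ^+ K * h], and the last summand alone suffices; its numerator 4
   compensates for the passage from [K] to [K.+1]. *)
have -> : 4 / (4 ^+ K.+1 * h) = h / (2 ^+ K * h) ^+ 2 :> R.
  rewrite exprS -[4 ^+ K]/((4 : R) ^+ K).
  have -> : (4 : R) ^+ K = (2 ^+ K) ^+ 2 by rewrite -exprM mulnC exprM; congr (_ ^+ _); ring.
  by field; rewrite gt_eqF//= expf_neq0.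
rewrite ler_pM2l// lef_pV2 ?posrE ?exprn_gt0 ?mulr_gt0 ?exprn_gt0//.
apply: le_trans (_ : x ^+ 2 <= _); last by rewrite lerDr sqr_ge0.
by rewrite -(real_normK (num_real x)) lerXn2r// nnegrE ?mulr_ge0 ?exprn_ge0 ?ltW.
Qed.

(** Chooses how many dyadic scales fit between the width [h] and a fixed radius [d]. The upper bound
    ensures that points outside the largest interval are at distance more than [d / 2]. *)
Lemma dyadic_exponent (h d : R) : 0 < h -> h <= d ->
  exists K, 2 ^+ K * h <= d < 2 ^+ K.+1 * h.
Proof.
move=> h0 hd.
have ex : exists n, d < 2 ^+ n * h.
  have /archi_boundP := divr_ge0 (le_trans (ltW h0) hd) (ltW h0).
  set n := Num.bound _ => dn; exists n; rewrite -ltr_pdivrMr//.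
  apply: lt_le_trans dn _; rewrite -natrX ler_nat ltnW// ltn_expl//.
case: (ex_minnP ex) => -[|n] dn minn; first by move: dn; rewrite expr0 mul1r ltNge hd.
exists n; rewrite dn andbT leNgt; apply/negP => /minn; by rewrite ltnn.
Qed.

End PoissonKernel.

(** * Lebesgue points and radial limits of Poisson integrals *)

Section RadialLimits.
Variable R : realType.
Local Notation C := (R[i]).
Local Notation mu := (@lebesgue_measure R).
Local Notation per := (@period R).
Local Notation "\I u" := (Rintegral mu per u) (at level 10, u at level 9).
Implicit Types (z w : C) (u g : R -> R) (x y r s t : R).

Definition PI g z : R := \I (fun s => complex.Re (schwarz s z) * g s).

Lemma PI_Re f z : PI (fun t => complex.Re (f t)) z = complex.Re (PC f z).
Proof. by rewrite /PC /cint /=; apply: eq_Rintegral => t _; rewrite cReZ. Qed.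

Lemma PI_Im f z : PI (fun t => complex.Im (f t)) z = complex.Im (PC f z).
Proof. by rewrite /PC /cint /=; apply: eq_Rintegral => t _; rewrite cImZ. Qed.

Lemma PI_cst c z : disk z -> PI (fun=> c) z = 2 * pi * c.
Proof.
move=> zd; have := @PI_Re (fun=> c%:C%C) z; rewrite PC_cst//= => ->.
by rewrite mulr0 subr0.
Qed.

Lemma meas_Reschwarz z : disk z -> measurable_fun per (fun t => complex.Re (schwarz t z)).
Proof. by move=> /cmeas_schwarz[]. Qed.

Lemma intg_PI g z : disk z -> intg g -> intg (fun t => complex.Re (schwarz t z) * g t).
Proof.
move=> zd; apply: (@intgM _ _ _ (2 / (1 - cabs z))); first exact: meas_Reschwarz.
by move=> t _; exact: Reschwarz_le.
Qed.

Lemma meas_near t h : measurable_fun per (fun s => if `|s - t| < h then 1 else 0 : R).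
Proof.
apply: measurable_funTS; apply: measurable_fun_ifT => //=.
apply: measurable_fun_ltr => //; apply: measurableT_comp => //.
exact: measurable_funB.
Qed.

Lemma intg_near g t h : intg g ->
  intg (fun s => (if `|s - t| < h then 1 else 0) * g s).
Proof.
apply: (@intgM _ _ _ 1); first exact: meas_near.
by move=> s _; case: ifP => _; rewrite ?normr1 ?normr0.
Qed.

(** Brings the Lebesgue point property of the zero extension of [g] into the form required by the
    dyadic kernel. Points of the ball outside the period can only increase the average. *)
Lemma lebesgue_pt_small g t (e : R) : intg g -> per t -> lebesgue_pt (g \_ per) t -> 0 < e ->
  exists2 d : R, 0 < d & forall h, 0 < h < d ->
   \I (fun s => (if `|s - t| < h then 1 else 0) * `|g s - g t|) <= e * h.
Proof.
move=> hg pt lt e0.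
(* The ball of radius [h] has measure [2 * h], so an average below [e / 2] means an integral below
   [e * h]. *)
have e20 : 0 < e / 2 by rewrite divr_gt0.
have /fine_cvgP[fin /cvgrPdist_lt/(_ _ e20) small] := lt.
have : \forall h \near (0 : R)^'+, davg (g \_ per) t h \is a fin_num /\
    `|0 - fine (davg (g \_ per) t h)| < e / 2 by near do split.
rewrite near_withinE => /nbhs_ballP[d /= d0 Hd].
exists d => // h /andP[h0 hd].
have [] := Hd h _ h0; first by rewrite /ball/= sub0r normrN gtr0_norm.
rewrite sub0r normrN /davg /iavg (lebesgue_measure_ball _ (ltW h0)).
set X := (\int[mu]_(y in _) _)%E.
have X0 : (0 <= X)%E by apply: integral_ge0.
have h2 : 0 < h *+ 2 by rewrite pmulrn_lgt0.
rewrite inver gt_eqF//.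
move=> finX.
have {}finX : X \is a fin_num.
  move: finX X0; case: X => [x| |] //.
  by rewrite gt0_muley ?lte_fin ?invr_gt0.
rewrite -(fineK finX) -EFinM /= ger0_norm; last first.
  by rewrite mulr_ge0 ?invr_ge0 ?(ltW h2) ?fine_ge0.
rewrite ltr_pdivrMl// => Xe.
have {Xe} : fine X <= e * h by apply/ltW/(lt_le_trans Xe); rewrite -mulr_natr; lra.
apply: le_trans; rewrite -lee_fin (fineK finX).
have hw : intg (fun s => `|g s - g t|) by apply: intg_norm; apply: intgB => //; exact: intg_cst.
have hF := intg_near t h hw.
rewrite /Rintegral fineK; last by apply: integrable_fin_num hF => //.
rewrite /X [leLHS]integral_mkcond [leRHS]integral_mkcond.
have mg : measurable_fun setT (g \_ per).
  exact: (measurable_restrictT g (measurable_itv `[0, 2 * pi])).1 (intg_meas hg).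
apply: ge0_le_integral => //.
- move=> s _; rewrite /patch; case: ifP => // _; rewrite lee_fin mulr_ge0//.
  by case: ifP.
- exact: ((measurable_restrictT _ (measurable_itv `[0, 2 * pi])).1 (measurable_int _ hF)).
- have mG : measurable_fun (ball t h) (fun y => `|((g \_ per) y - (g \_ per) t)%:E|%E).
    apply: measurable_funTS; apply/measurable_EFinP; apply: measurableT_comp => //.
    exact: measurable_funB.
  exact: ((measurable_restrictT _ (measurable_ball t h)).1 mG).
- move=> s _; rewrite [leLHS]/patch [leRHS]/patch.
  have [sp|sp] := boolP (s \in per); last by case: ifP => // _; exact: abse_ge0.
  rewrite /= /patch sp (mem_set pt); have [sh|sh] := boolP (`|s - t| < h).
    by rewrite mul1r mem_set// /ball/= distrC.
  by rewrite mul0r; case: ifP => // _; rewrite lee_fin.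
Unshelve. all: by end_near. Qed.

(** Differences of two points of the period reach up to [2 * pi], where the circle closes up, so
    [|x|] has to stay away from both ends. *)
Lemma cos_le_away (d x : R) : 0 <= d <= pi -> d <= `|x| <= 2 * pi - d -> cos x <= cos d.
Proof.
move=> /andP[d0 dpi] /andP[dx xd].
have -> : cos x = cos `|x|.
  by have [x0|x0] := leP 0 x; [rewrite ger0_norm|rewrite ltr0_norm// cosN].
have E y : 0 <= y <= pi -> d <= y -> cos y <= cos d.
  move=> y0 dy; rewrite leNgt ltr_cos ?in_itv/=; first by rewrite -leNgt.
  + exact: y0.
  + by rewrite d0.
have [xpi|xpi] := leP `|x| pi; first by apply: E; rewrite ?normr_ge0.
rewrite -cosN -(cosD2pi (- `|x|)) -mulr_natl; apply: E; last by lra.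
by apply/andP; split; lra.
Qed.

(** The scale [k] contributes [4 * e / 2 ^+ k], so the total stays below [8 * e] however many scales
    are used. *)
Lemma sum_dyadic (e h : R) n : 0 < h ->
  \sum_(k < n) 4 / (4 ^+ k * h) * (e * (2 ^+ k * h)) = 8 * e * (1 - (2 ^+ n)^-1).
Proof.
move=> h0; elim: n => [|n IH]; first by rewrite big_ord0 expr0 invr1 subrr mulr0.
rewrite big_ord_recr /= IH exprS.
have -> : (4 : R) ^+ n = (2 ^+ n) ^+ 2 by rewrite -exprM mulnC exprM; congr (_ ^+ _); ring.
have : (2 : R) ^+ n != 0 by rewrite expf_neq0.
move: (2 ^+ n) => q q0; field; by rewrite q0 (gt_eqF h0).
Qed.

Lemma RI_sum n (h : nat -> R -> R) : (forall i, intg (h i)) ->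
  \I (fun t => \sum_(i < n) h i t) = \sum_(i < n) \I (h i).
Proof.
move=> hh; elim: n => [|n IH].
  by rewrite big_ord0 -[RHS](mulr0 (2 * pi)) -RI_cst; apply: eq_Rintegral => t _; rewrite big_ord0.
rewrite big_ord_recr /= -IH -(RintegralD (@measurable_period R) (@intg_sum _ n h hh) (hh n)).
by apply: eq_Rintegral => t _; rewrite big_ord_recr.
Qed.

Lemma ae_filter_mu : Filter (nbhs (almost_everywhere mu)).
Proof. exact: (ae_filter_ringOfSetsType mu). Qed.

Lemma ae_circle_impl (P Q : R -> Prop) : (forall t, per t -> P t -> Q t) ->
  ae_circle P -> ae_circle Q.
Proof.
move=> PQ; apply: (@filterS _ _ ae_filter_mu) => t h pt; exact: PQ (h pt).
Qed.

Lemma ae_circle_and (P Q : R -> Prop) : ae_circle P -> ae_circle Q ->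
  ae_circle (fun t => P t /\ Q t).
Proof.
by apply: (@filterS2 _ _ ae_filter_mu) => t h1 h2 pt; split; [exact: h1|exact: h2].
Qed.

Lemma ae_circleW (P : R -> Prop) : {ae mu, forall t, P t} -> ae_circle P.
Proof. by apply: (@filterS _ _ ae_filter_mu) => t h _. Qed.

Lemma ae_neq x : {ae mu, forall t : R, t != x}.
Proof.
exists [set x]; split; [exact: measurable_set1|exact: lebesgue_measure_set1|].
by move=> y /= /negP; rewrite negbK => /eqP.
Qed.

(** At a Lebesgue point [t] inside the period the difference is the integral of the kernel against
    [g t - g s]. Near [t] the dyadic averages are small; away from [t] the kernel itself is of order
    [1 - r]. *)
Lemma fatou_radial g : intg g ->
  ae_circle (fun t => (fun r => PI g (r%:C%C * expi t)) @ (1 : R)^'- --> 2 * pi * g t).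
Proof.
move=> hg.
have L := lebesgue_differentiation (integrable_locally (measurable_itv `[0, 2 * pi]) hg).
move: (ae_circleW L) (ae_circle_and (ae_circleW (ae_neq 0)) (ae_circleW (ae_neq (2 * pi)))).
move=> /ae_circle_and/[apply]; apply: ae_circle_impl => t pt [Lt [t0 t2]].
have : 0 < t < 2 * pi.
  by move: pt; rewrite /period/= in_itv/= => /andP[? ?]; rewrite !lt_def t0 eq_sym t2 /=; apply/andP.
move=> {t0 t2} /andP[t0 t2].
apply/cvgrPdist_le => e e0.
have c1 := @cos1_gt0 R; pose k0 : R := 4 / cos 1 ^+ 2.
have k00 : 0 < k0 by rewrite divr_gt0// exprn_gt0.
(* The kernel bound costs a factor [k0] and the dyadic sum a factor 8, which leaves [e / 2]. *)
pose e1 := e / (16 * k0); have e10 : 0 < e1 by rewrite divr_gt0// mulr_gt0.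
have [d d0 Hd] := lebesgue_pt_small hg pt Lt e10.
(* The bound by [d] keeps every dyadic interval in the range of [Hd], the bound by 1 permits
   [poisson_near], and the other two keep [s - t] away from [2 * pi] and [- (2 * pi)]. *)
pose D := Num.min (Num.min d 1) (Num.min t (2 * pi - t)) / 2.
have D0 : 0 < D by rewrite divr_gt0// !lt_min d0 ltr01 t0 subr_gt0.
have [Dd D1 Dt Dt2] : [/\ 2 * D <= d, 2 * D <= 1, 2 * D <= t & 2 * D <= 2 * pi - t].
  by rewrite /D [2 * _]mulrC divfK// !ge_min !lexx !orbT.
clearbody D.
have pi2 := @pi_ge2 R.
pose m := 1 - cos (D / 2).
have m0 : 0 < m.
  have D2 : `|D / 2| <= 2 by rewrite ger0_norm; lra.
  apply: lt_le_trans (one_minus_cos_ge D2).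
  by rewrite mulr_gt0 ?exprn_gt0 ?divr_gt0 ?exprn_gt0.
pose w s := `|g s - g t|.
have hw : intg w by apply: intg_norm; apply: intgB => //; exact: intg_cst.
pose W := \I w; have W0 : 0 <= W by apply: Rintegral_ge0 => s _; exact: normr_ge0.
have W1 : 0 < W + 1 by rewrite ltr_wpDl.
near=> r.
have r2 : 1 / 2 <= r by near: r; apply: nbhs_left_ge; lra.
have r1 : r < 1 by near: r; exact: nbhs_left_lt.
have rD : 1 - r <= D.
  have : 1 - D <= r by near: r; apply: nbhs_left_ge; rewrite ltrBlDr ltrDl.
  by lra.
(* Makes the far part at most [e / 2]; [W + 1] replaces [W], which may be 0. *)
have rW : 1 - r <= e * m / (4 * (W + 1)).
  have : 1 - e * m / (4 * (W + 1)) <= r.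
    by near: r; apply: nbhs_left_ge; rewrite ltrBlDr ltrDl divr_gt0 ?mulr_gt0.
  by lra.
have r0 : 0 <= r by lra.
have r01 : 0 <= r < 1 by rewrite r0.
have h0 : 0 < 1 - r by rewrite subr_gt0.
have rd : disk (r%:C%C * expi t) by exact: disk_radius.
have [K /andP[K1 K2]] := dyadic_exponent h0 rD.
pose c k : R := 4 / (4 ^+ k * (1 - r)).
have c0 k : 0 <= c k by rewrite divr_ge0// mulr_ge0// ?exprn_ge0// ltW.
pose ind k s : R := if `|s - t| < 2 ^+ k * (1 - r) then 1 else 0.
have pointwise s : per s -> complex.Re (schwarz s (r%:C%C * expi t)) <=
   k0 * (\sum_(k < K.+1) c k * ind k s) + 2 / m * (1 - r).
  rewrite /period/= in_itv/= => /andP[s0 s2].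
  have S0 : 0 <= \sum_(k < K.+1) c k * ind k s.
    by apply: sumr_ge0 => k _; apply: mulr_ge0 => //; rewrite /ind; case: ifP.
  have [sK|sK] := ltP `|s - t| (2 ^+ K * (1 - r)).
    have := @poisson_near R r s t; rewrite r2 r1 => /(_ isT).
    have stD := lt_le_trans sK K1.
    move=> /(_ _)/le_trans; apply; first by lra.
    apply: le_trans (ler_wpM2l (ltW k00) (dyadic_kernel h0 sK)) _.
    by rewrite lerDl mulr_ge0 ?divr_ge0 ?ltW.
  apply: le_trans (_ : 2 / m * (1 - r) <= _); last by rewrite lerDr mulr_ge0// ltW.
  apply: poisson_far => //; first by rewrite r2.
  rewrite lerB// cos_le_away//; first by apply/andP; split; lra.
  apply/andP; split.
    by apply: le_trans sK; move: K2; rewrite exprS; lra.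
  by rewrite ler_norml; apply/andP; split; lra.
have Iind k : intg (fun s => ind k s * w s) by exact: intg_near.
have Icind k : intg (fun s => c k * (ind k s * w s)) by exact: intgZ.
have Isum := @intg_sum _ K.+1 (fun k s => c k * (ind k s * w s)) Icind.
have Eint : 2 * pi * g t - PI g (r%:C%C * expi t) =
   \I (fun s => complex.Re (schwarz s (r%:C%C * expi t)) * (g t - g s)).
  rewrite -(PI_cst (g t) rd) /PI -(RintegralB _ (intg_PI rd (intg_cst (g t))) (intg_PI rd hg))//.
  by apply: eq_Rintegral => s _; rewrite mulrBr.
rewrite Eint.
have hgt : intg (fun s => g t - g s) by apply: intgB => //; exact: intg_cst.
apply: le_trans (le_normr_Rintegral _ (intg_PI rd hgt)) _ => //.
apply: le_trans (_ : \I (fun s => k0 * (\sum_(k < K.+1) c k * (ind k s * w s)) +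
   2 / m * (1 - r) * w s) <= _).
  apply: le_Rintegral => //.
  - exact: intg_norm (intg_PI rd hgt).
  - by apply: intgD; exact: intgZ.
  - move=> s ps; rewrite normrM ger0_norm ?poisson_ge0// distrC -/(w s).
    apply: le_trans (ler_wpM2r _ (pointwise s ps)) _; first exact: normr_ge0.
    have <- : (\sum_(k < K.+1) c k * ind k s) * w s = \sum_(k < K.+1) c k * (ind k s * w s).
      by rewrite big_distrl; apply: eq_bigr => k _; rewrite /= mulrA.
    by rewrite mulrDl mulrA.
rewrite RintegralD//; try exact: intgZ.
rewrite !RintegralZl// -/W.
have -> : \I (fun s => \sum_(k < K.+1) c k * (ind k s * w s)) =
    \sum_(k < K.+1) c k * \I (fun s => ind k s * w s).
  rewrite (@RI_sum K.+1 (fun k s => c k * (ind k s * w s)) Icind).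
  by apply: eq_bigr => k _; exact: (RintegralZl _ (@measurable_period R) (Iind k)).
rewrite (splitr e); apply: lerD.
  apply: le_trans (_ : k0 * (8 * e1) <= _); last first.
    by rewrite /e1 le_eqVlt; apply/orP; left; apply/eqP; field; rewrite gt_eqF.
  rewrite ler_pM2l//.
  apply: le_trans (_ : \sum_(k < K.+1) 4 / (4 ^+ k * (1 - r)) * (e1 * (2 ^+ k * (1 - r))) <= _).
    apply: ler_sum => k _; apply: ler_wpM2l => //; apply: Hd.
    rewrite mulr_gt0 ?exprn_gt0//=.
    apply: le_lt_trans (_ : 2 ^+ K * (1 - r) < _); last by lra.
    by rewrite ler_pM2r// ler_weXn2l ?ler1n// -ltnS.
  rewrite (sum_dyadic _ _ h0); apply: ler_piMr; first by rewrite mulr_ge0// ltW.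
  by rewrite gerBl invr_ge0 exprn_ge0.
apply: le_trans (_ : 2 / m * (e * m / (4 * (W + 1))) * (W + 1) <= _).
  by apply: ler_pM => //; [rewrite mulr_ge0 ?divr_ge0 ?ltW|rewrite ler_pM2l ?divr_gt0|rewrite lerDl].
rewrite le_eqVlt; apply/orP; left; apply/eqP; field.
by rewrite !gt_eqF.
Unshelve. all: by end_near. Qed.

End RadialLimits.

(** * Boundary values of the Herglotz integral of a bounded function *)

Section L1Limit.
Variable R : realType.
Local Notation mu := (@lebesgue_measure R).
Local Notation per := (@period R).
Local Notation "\I u" := (Rintegral mu per u) (at level 10, u at level 9).

(** The increments are summable in [L^1], so the telescoping series converges absolutely almost
    everywhere. The sum of the absolute increments also dominates the sequence, which upgrades the
    pointwise limit to an [L^1] limit. *)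
Lemma L1_limit (f : nat -> R -> R) (c : R) : (forall n, intg (f n)) ->
  (forall n, \I (fun t => `|f n.+1 t - f n t|) <= c / 2 ^+ n) ->
  exists2 g, intg g & (fun n => \I (fun t => `|f n t - g t|)) @ \oo --> (0 : R).
Proof.
move=> hf fc.
pose d n t := `|f n.+1 t - f n t|.
have hd n : intg (d n) by apply: intg_norm; apply: intgB.
pose S t := (\sum_(0 <= n <oo) (d n t)%:E)%E.
have md n : measurable_fun per (fun t => (d n t)%:E) by exact: measurable_int (hd n).
have d0 n t : (0 <= (d n t)%:E)%E by rewrite lee_fin; exact: normr_ge0.
have mS : measurable_fun per S by apply: ge0_emeasurable_sum.
have S0 t : (0 <= S t)%E by apply: nneseries_ge0.
have geo N : \sum_(0 <= n < N) c / 2 ^+ n = 2 * c * (1 - (2 ^+ N)^-1) :> R.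
  elim: N => [|N IH]; first by rewrite big_nil expr0 invr1 subrr mulr0.
  rewrite big_nat_recr//= IH exprS invfM.
  by field; rewrite expf_neq0.
have c0 : 0 <= c.
  by apply: le_trans (_ : c / 2 ^+ 0 <= _);
    [apply: le_trans (fc 0%N); exact: Rintegral_ge0|rewrite expr0 divr1].
have iS : (\int[mu]_(t in per) S t <= (2 * c)%:E)%E.
  rewrite integral_nneseries//; apply: lime_le.
    by apply: is_cvg_nneseries => n _ _; exact: integral_ge0.
  near=> N.
  apply: le_trans (_ : \sum_(0 <= n < N) (c / 2 ^+ n)%:E <= _)%E.
    apply: lee_sum => n _; have := fc n; rewrite -lee_fin /Rintegral fineK//.
    by apply: integrable_fin_num (hd n).
  rewrite sumEFin geo lee_fin ler_piMr ?mulr_ge0// gerBl invr_ge0 exprn_ge0//.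
have IS : mu.-integrable per S.
  apply/integrableP; split => //; under eq_integral do rewrite gee0_abs//.
  exact: le_lt_trans iS (ltry _).
have finS := integrable_ae (@measurable_period R) IS.
pose G t := (`|f 0%N t|%:E + S t)%E.
have IG : mu.-integrable per G.
  by apply: integrableD => //; exact: intg_norm (hf 0%N).
(* The limit superior is defined and measurable everywhere; it is the limit wherever [S] is
   finite. *)
pose g t := fine (limn_esup (fun n => (f n t)%:E)).
have mfn n : measurable_fun per (fun t => (f n t)%:E) by exact: measurable_int (hf n).
have mg : measurable_fun per (EFin \o g).
  apply/measurable_EFinP; apply: (measurableT_comp (@fine_measurable R setT measurableT)).
  exact: measurable_fun_limn_esup.
have tel n t : f n t = f 0%N t + \sum_(0 <= k < n) (f k.+1 t - f k t).
  by rewrite telescope_sumr// addrC subrK.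
have fcvg : {ae mu, forall t, per t -> (fun n => (f n t)%:E) @ \oo --> (g t)%:E}.
  apply: (@filterS _ _ (@ae_filter_mu R) _ _ _ finS) => t Sfin pt.
  have {}Sfin := Sfin pt.
  have H : cvgn (fun n => f n t).
    have -> : (fun n => f n t) = (fun n => f 0%N t + series (fun k => f k.+1 t - f k t) n).
      by apply/funext => n; rewrite [LHS]tel.
    apply: is_cvgD; first exact: is_cvg_cst.
    apply: (@normed_cvg _ R^o); apply: nondecreasing_is_cvgn.
      by apply: nondecreasing_series => n _ _; exact: normr_ge0.
    exists (fine (S t)) => _ [n _ <-]; rewrite -lee_fin fineK//.
    rewrite /series /= -sumEFin; apply: nneseries_lim_ge => *; exact: d0.
  move/cvg_ex : H => [l Hl].
  have Hl' : (fun n => (f n t)%:E) @ \oo --> l%:E by apply: cvg_EFin; [near=> n|exact: Hl].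
  by rewrite /g (cvg_limn_einf_sup Hl').2.
have dom : {ae mu, forall t n, per t -> (`|(f n t)%:E| <= G t)%E}.
  apply: (@filterS _ _ (@ae_filter_mu R) _ _ _ finS) => t Sfin n pt.
  rewrite tel EFinD; apply: le_trans (lee_abs_add _ _) _; rewrite /G leeD//.
  apply: le_trans (_ : \sum_(0 <= k < n) (d k t)%:E <= _)%E.
    by rewrite sumEFin abse_EFin lee_fin; exact: ler_norm_sum.
  by apply: nneseries_lim_ge => *; exact: d0.
have [ig lim0 _] := dominated_convergence (@measurable_period R) mfn mg fcvg IG dom.
exists g => //.
have {}lim0 : (fun n => (\I (fun t => `|f n t - g t|))%:E) @ \oo --> (0%:E : \bar R).
  apply: cvg_trans lim0; apply: near_eq_cvg; near=> n.
  rewrite /= /Rintegral fineK//.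
  by apply: (integrable_fin_num _ (intg_norm (intgB (hf n) (ig : intg g)))).
by move/fine_cvgP : lim0 => [].
Unshelve. all: by end_near. Qed.

End L1Limit.

(** * Parseval's identity and Bessel's inequality *)

Section Conjugate.
Variable R : realType.
Local Notation C := (R[i]).
Local Notation mu := (@lebesgue_measure R).
Local Notation per := (@period R).
Local Notation "\I u" := (Rintegral mu per u) (at level 10, u at level 9).
Implicit Types (z w : C) (u : R -> R) (a : nat -> C).

Definition tpoly a N (t : R) : C := \sum_(m < N) a m * expi t ^+ m.

Lemma tpolyS a N t : tpoly a N.+1 t = tpoly a N t + a N * expi t ^+ N.
Proof. by rewrite /tpoly big_ord_recr. Qed.

Lemma tpoly0 a t : tpoly a 0 t = 0.
Proof. by rewrite /tpoly big_ord0. Qed.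

Lemma cvg_tpoly a N t : (fun s => tpoly a N s : C^o) @ t --> (tpoly a N t : C^o).
Proof.
elim: N => [|N IH].
  have -> : tpoly a 0 = fun=> 0 by apply/funext => s; exact: tpoly0.
  exact: cvgC_cst.
have -> : tpoly a N.+1 = fun s => tpoly a N s + a N * expi s ^+ N.
  by apply/funext => s; exact: tpolyS.
by apply: cvgCD; [exact: IH|apply: cvgCM; [exact: cvgC_cst|exact: cvg_expiX]].
Qed.

Lemma cvg_conj (T : Type) (F : set_system T) (FF : Filter F) (f : T -> C) (l : C) :
  ((fun s => f s : C^o) @ F --> (l : C^o)) ->
  (fun s => conjc (f s) : C^o) @ F --> (conjc l : C^o).
Proof.
move=> /cvgCP[H1 H2]; apply/cvgCP; split.
  have -> : (fun s => complex.Re (conjc (f s))) = (fun s => complex.Re (f s)).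
    by apply/funext => s; case: (f s).
  by have -> : complex.Re (conjc l) = complex.Re l by case: (l).
have -> : (fun s => complex.Im (conjc (f s))) = (fun s => - complex.Im (f s)).
  by apply/funext => s; case: (f s).
have -> : complex.Im (conjc l) = - complex.Im l by case: (l).
exact: cvgN.
Qed.

Lemma cint_tpoly_orth a N n : (N <= n)%N ->
  cint (fun t => conjc (tpoly a N t) * expi t ^+ n) = 0.
Proof.
have I M : cintg (fun t => conjc (tpoly a M t) * expi t ^+ n).
  by apply: cintg_cont => t; apply: cvgCM; [apply: cvg_conj; exact: cvg_tpoly|exact: cvg_expiX].
elim: N => [|N IH] Nn.
  by rewrite -[RHS](cint0 R); apply: eq_cint => t; rewrite tpoly0 rmorph0 mul0r.
have J : cintg (fun t => conjc (a N) * ((expi t ^+ N)^-1 * expi t ^+ n)).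
  by apply: cintgZ; exact: cintg_expiXV.
rewrite (_ : cint _ = cint (fun t => conjc (tpoly a N t) * expi t ^+ n +
    conjc (a N) * ((expi t ^+ N)^-1 * expi t ^+ n))).
  rewrite (cintD (I N) J) IH ?(ltnW Nn)// add0r (cintZ _ (@cintg_expiXV R n N)).
  by rewrite cint_expiXV gtn_eqF// mulr0.
apply: eq_cint => t; rewrite tpolyS rmorphD rmorphM mulrDl -mulrA; congr (_ + _ * (_ * _)).
by rewrite -exprVn -conj_expi; exact: rmorphXn.
Qed.

Lemma sqr_cabsD z w : cabs (z + w) ^+ 2 =
  cabs z ^+ 2 + 2 * complex.Re (conjc z * w) + cabs w ^+ 2.
Proof.
by case: z w => [p q] [r s]; rewrite !sqr_cabs cReM /=; ring.
Qed.

Lemma intg_sqr_tpoly a N : intg (fun t => cabs (tpoly a N t) ^+ 2).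
Proof.
have cR : continuous (fun t => cabs (tpoly a N t) ^+ 2).
  have -> : (fun t => cabs (tpoly a N t) ^+ 2) = (fun t => cabs (tpoly a N t) * cabs (tpoly a N t)).
    by apply/funext => t; rewrite expr2.
  by move=> t; have H := cvg_cabs _ (@cvg_tpoly a N t); apply: cvgM; exact: H.
apply: continuous_compact_integrable; first exact: segment_compact.
exact: continuous_subspaceT.
Qed.

(** By induction on [N]: the cross term between the new monomial and the earlier ones integrates to
    0. *)
Lemma parseval_tpoly a N :
  \I (fun t => cabs (tpoly a N t) ^+ 2) = 2 * pi * \sum_(m < N) cabs (a m) ^+ 2.
Proof.
elim: N => [|N IH].
  rewrite big_ord0 -RI_cst; apply: eq_Rintegral => t _.
  by rewrite tpoly0 cabs0 expr0n.
have I : cintg (fun t => conjc (tpoly a N t) * expi t ^+ N).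
  by apply: cintg_cont => t; apply: cvgCM; [apply: cvg_conj; exact: cvg_tpoly|exact: cvg_expiX].
have [J _] := cintgZ (a N) I.
rewrite (_ : \I _ = \I (fun t => cabs (tpoly a N t) ^+ 2 +
   (2 * complex.Re (a N * (conjc (tpoly a N t) * expi t ^+ N)) + cabs (a N) ^+ 2))).
  have K := intgZ 2 J; have L := intg_cst (cabs (a N) ^+ 2).
  rewrite (RintegralD (@measurable_period R) (intg_sqr_tpoly a N) (intgD K L)) IH.
  rewrite (RintegralD (@measurable_period R) K L) (RintegralZl _ (@measurable_period R) J).
  have -> : \I (fun t => complex.Re (a N * (conjc (tpoly a N t) * expi t ^+ N))) = 0.
    rewrite -[LHS]/(complex.Re (cint (fun t => a N * (conjc (tpoly a N t) * expi t ^+ N)))).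
    by rewrite (cintZ _ I) cint_tpoly_orth// mulr0.
  by rewrite RI_cst mulr0 add0r [in RHS]big_ord_recr /= [in RHS]mulrDr.
apply: eq_Rintegral => t _; rewrite tpolyS sqr_cabsD mulrCA -addrA.
by rewrite [cabs (_ * _)]cabsM cabsX cabs_expi expr1n mulr1.
Qed.

(** Since [u] is real, integrating it against [expi t ^+ m] gives the conjugate of [coef u m]. *)
Lemma cint_tpoly_u a N u : intg u ->
  cint (fun t => tpoly a N t * (u t)%:C%C) = \sum_(m < N) a m * conjc (coef u m).
Proof.
move=> hu.
have Ie m : cintg (fun t => expi t ^+ m * (u t)%:C%C).
  apply: (@cintgM _ _ _ 1); last exact: cintg_real.
    by apply: cmeas_cont => t; exact: cvg_expiX.
  by move=> t _; rewrite cabsX cabs_expi expr1n.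
have E m : cint (fun t => expi t ^+ m * (u t)%:C%C) = conjc (coef u m).
  have EV (t : R) : (expi t ^+ m)^-1 * (u t)%:C%C =
      ((cos (m%:R * t) * u t) -i* (sin (m%:R * t) * u t))%C.
    by rewrite -expiMn -expiN /expi cosN sinN; simpc; apply: complexP => /=; ring.
  have EE (t : R) : expi t ^+ m * (u t)%:C%C =
      ((cos (m%:R * t) * u t) +i* (sin (m%:R * t) * u t))%C.
    by rewrite -expiMn /expi; simpc; apply: complexP => /=; ring.
  rewrite /coef (eq_cint EE) (eq_cint EV) /cint; apply: complexP => //=.
  have [_ J] := eq_cintg EV (cintg_coef m hu).
  rewrite -[RHS]mulN1r -(RintegralZl _ (@measurable_period R) J).
  by apply: eq_Rintegral => t _; rewrite /= mulN1r opprK.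
have I M := @cintg_sum _ M (fun m t => a m * (expi t ^+ m * (u t)%:C%C))
    (fun m => cintgZ (a m) (Ie m)).
rewrite (_ : cint _ = cint (fun t => \sum_(m < N) a m * (expi t ^+ m * (u t)%:C%C))).
  rewrite (@cint_sum _ N (fun m t => a m * (expi t ^+ m * (u t)%:C%C))
    (fun m => cintgZ (a m) (Ie m))).
  by apply: eq_bigr => m _; rewrite (cintZ _ (Ie m)) E.
by apply: eq_cint => t; rewrite /tpoly big_distrl; apply: eq_bigr => m _; rewrite /= mulrA.
Qed.

Lemma Re_sum_conj (c : nat -> C) (x : R) N :
  complex.Re (\sum_(m < N) (x%:C%C * c m) * conjc (c m)) = x * \sum_(m < N) cabs (c m) ^+ 2.
Proof.
elim: N => [|N IH]; first by rewrite !big_ord0 mulr0.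
rewrite !big_ord_recr /= cReD IH mulrDr -mulrA cReZ; congr (_ + _ * _).
by rewrite sqr_cabs cReM; case: (c N) => p q /=; ring.
Qed.

Lemma bessel u N (B : R) : intg u -> (forall t, per t -> `|u t| <= B) ->
  \sum_(m < N) cabs (coef u m) ^+ 2 <= 2 * pi * \I (fun t => u t ^+ 2).
Proof.
move=> hu uB; have p0 : 0 < 2 * pi :> R by rewrite mulr_gt0 ?pi_gt0.
set S := \sum_(m < N) _.
(* The normalised Fourier coefficients: for them the cross term is minus twice the squared norm of
   the partial sum. *)
pose a m : C := ((2 * pi)^-1)%:C%C * coef u m.
have hu2 : intg (fun t => u t ^+ 2).
  by apply: (intgM (intg_meas hu) uB hu).
have It : cintg (fun t => tpoly a N t * (u t)%:C%C).
  have [ct1 ct2] := cintg_cont (@cvg_tpoly a N).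
  apply: (eq_cintg (f := fun t => (u t)%:C%C * tpoly a N t)); first by move=> t; exact: mulrC.
  apply: (@cintgM _ _ _ B); [exact: cintg_cmeas (cintg_real hu)| |by split].
  by move=> t pt; rewrite cabsR uB.
have [Ir _] := It.
have E : \I (fun t => cabs ((u t)%:C%C - tpoly a N t) ^+ 2) =
   \I (fun t => u t ^+ 2) - (2 * pi)^-1 * S.
  rewrite (_ : \I _ = \I (fun t => u t ^+ 2 +
     ((-2) * complex.Re (tpoly a N t * (u t)%:C%C) + cabs (tpoly a N t) ^+ 2))).
    have K := intgZ (-2) Ir; have L := intg_sqr_tpoly a N.
    rewrite (RintegralD (@measurable_period R) hu2 (intgD K L)).
    rewrite (RintegralD (@measurable_period R) K L) (RintegralZl _ (@measurable_period R) Ir).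
    rewrite parseval_tpoly.
    have -> : \I (fun t => complex.Re (tpoly a N t * (u t)%:C%C)) = (2 * pi)^-1 * S.
      rewrite -[LHS]/(complex.Re (cint (fun t => tpoly a N t * (u t)%:C%C))) cint_tpoly_u//.
      exact: Re_sum_conj.
    have -> : \sum_(m < N) cabs (a m) ^+ 2 = (2 * pi)^-2 * S.
      rewrite /S big_distrr /=; apply: eq_bigr => m _.
      by rewrite /a cabsM cabsR ger0_norm ?invr_ge0 ?ltW// exprMn exprVn.
    congr (_ + _); move: p0; move: (2 * pi) => q q0; field; by rewrite gt_eqF.
  apply: eq_Rintegral => t _; rewrite sqr_cabsD cabsN cabsR real_normK ?num_real// -addrA.
  congr (_ + (_ + _)); rewrite conjc_real [X in _ = _ * complex.Re X]mulrC !cReZ cReN; ring.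
have : 0 <= \I (fun t => cabs ((u t)%:C%C - tpoly a N t) ^+ 2).
  by apply: Rintegral_ge0 => t _; rewrite exprn_ge0// cabs_ge0.
by rewrite E subr_ge0 ler_pdivrMl.
Qed.

End Conjugate.

(** * An integrable boundary function for the Herglotz integral *)

Section BoundaryFunction.
Variable R : realType.
Local Notation C := (R[i]).
Local Notation mu := (@lebesgue_measure R).
Local Notation per := (@period R).
Local Notation "\I u" := (Rintegral mu per u) (at level 10, u at level 9).
Implicit Types (z : C) (u : R -> R) (a : nat -> C).

(** Setting the first [N] coefficients to 0 turns a difference of partial sums into a single
    [tpoly], to which Parseval's identity applies. *)
Definition tail_from N a m : C := if (m < N)%N then 0 else a m.

Lemma spoly_diff u N d t :
  spoly u (N + d) (1%:C%C * expi t) - spoly u N (1%:C%C * expi t) =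
  tpoly (tail_from N (fun m => 2 * coef u m)) (N + d) t.
Proof.
elim: d => [|d IH].
  rewrite addn0 subrr /tpoly big1// => m _.
  by rewrite /tail_from ltn_ord mul0r.
rewrite addnS tpolyS -IH /tail_from ifN -?leqNgt ?leq_addr//.
by rewrite /spoly big_ord_recr /= rmorph1 mul1r; ring.
Qed.

Lemma sum_tail_from a N d : \sum_(m < N + d) cabs (tail_from N a m) ^+ 2 =
  \sum_(m < N + d) cabs (a m) ^+ 2 - \sum_(m < N) cabs (a m) ^+ 2.
Proof.
elim: d => [|d IH].
  rewrite addn0 subrr big1// => m _.
  by rewrite /tail_from ltn_ord cabs0 expr0n.
rewrite addnS !big_ord_recr /= IH /tail_from ifN -?leqNgt ?leq_addr//.
by rewrite addrAC.
Qed.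

(** Integrates [2 * x <= l * x ^+ 2 + l^-1]. The free parameter [l] takes the place of the square
    root in the Cauchy-Schwarz inequality. *)
Lemma L1_le_L2 f (l : R) : 0 < l -> intg (fun t => cabs (f t : C) ^+ 2) -> cintg f ->
  \I (fun t => cabs (f t)) <= (l * \I (fun t => cabs (f t) ^+ 2) + 2 * pi / l) / 2.
Proof.
move=> l0 f2 f1.
have I1 := intgZ l f2; have I2 := intgD I1 (intg_cst l^-1); have I3 := intgZ 2^-1 I2.
apply: le_trans (_ : \I (fun t => 2^-1 * (l * cabs (f t) ^+ 2 + l^-1)) <= _).
  apply: le_Rintegral => //; first exact: intg_cabs.
  move=> t _; move: (cabs (f t)) => x.
  have : 0 <= l * (x - l^-1) ^+ 2 by rewrite mulr_ge0 ?sqr_ge0// ltW.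
  have -> : l * (x - l^-1) ^+ 2 = l * x ^+ 2 - 2 * x + l^-1 by field; rewrite gt_eqF.
  lra.
rewrite (RintegralZl _ (@measurable_period R) I2) (RintegralD (@measurable_period R) I1 (intg_cst l^-1)).
by rewrite (RintegralZl _ (@measurable_period R) f2) RI_cst mulrC.
Qed.

Lemma bounded_tail (b : nat -> R) (A : R) : (forall n, 0 <= b n) ->
  (forall N, \sum_(m < N) b m <= A) ->
  forall e, 0 < e -> exists N, forall M, (N <= M)%N -> forall d,
    \sum_(m < M + d) b m - \sum_(m < M) b m <= e.
Proof.
move=> b0 bA e e0.
pose S N := \sum_(m < N) b m.
have ndS : nondecreasing_seq S.
  apply/nondecreasing_seqP => n; by rewrite /S big_ord_recr /= lerDl.
have cS : cvgn S.
  by apply: nondecreasing_is_cvgn => //; exists A => _ [n _ <-]; exact: bA.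
have leS n : S n <= limn S by exact: nondecreasing_cvgn_le.
have /cvgrPdist_le/(_ _ e0)[N _ HN] := cS.
exists N => M NM d.
have := HN M NM; rewrite ler_norml => /andP[_ h].
by apply: le_trans h; rewrite lerB// -/(S _).
Qed.

(* By Bessel's inequality the partial Fourier sums of [SI u] are Cauchy in [L^2],
   hence in [L^1]; [g] is a limit along a subsequence. *)
Lemma SI_boundary u (B : R) : intg u -> (forall t, per t -> `|u t| <= B) ->
  exists2 g : R -> C, cintg g & forall z, disk z -> PC g z = (2 * pi)%:C%C * SI u z.
Proof.
move=> hu uB; have p0 : 0 < 2 * pi :> R by rewrite mulr_gt0 ?pi_gt0.
have tail k : exists N, forall M, (N <= M)%N -> forall d,
   \sum_(m < M + d) cabs (coef u m) ^+ 2 - \sum_(m < M) cabs (coef u m) ^+ 2 <= (4 ^+ k)^-1.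
  apply: (@bounded_tail (fun m => cabs (coef u m) ^+ 2) (2 * pi * \I (fun t => u t ^+ 2))).
  - by move=> n; rewrite exprn_ge0// cabs_ge0.
  - by move=> N; apply: (bessel _ hu uB).
  - by rewrite invr_gt0 exprn_gt0.
have [n0 Hn0] := choice tail.
(* Increasing and beyond every [n0 k]; the summand [k] gives [k <= n k], by which [cabs z ^+ n k] is
   replaced with [cabs z ^+ k] below. *)
pose n k := (k + \sum_(i < k.+1) n0 i)%N.
have nk k : (n0 k <= n k)%N.
  by rewrite /n big_ord_recr /= addnA leq_addl.
have kn k : (k <= n k)%N by rewrite /n leq_addr.
have nS k : exists d, n k.+1 = (n k + d)%N.
  exists (1 + n0 k.+1)%N; rewrite /n [in LHS]big_ord_recr /=.
  by rewrite addSn addnA -addSn -addn1 -!addnA; congr (_ + _)%N; rewrite addnCA.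
pose s k t := spoly u (n k) (1%:C%C * expi t).
have Is k : cintg (s k) by exact: cintg_spoly.
have close k : \I (fun t => cabs (s k.+1 t - s k t)) <= 5 * pi / 2 ^+ k.
  have [d nd] := nS k.
  pose a := tail_from (n k) (fun m => 2 * coef u m).
  have -> : \I (fun t => cabs (s k.+1 t - s k t)) = \I (fun t => cabs (tpoly a (n k + d) t)).
    by apply: eq_Rintegral => t _; rewrite /s nd spoly_diff.
  (* The squared tail is at most a multiple of [4 ^- k], so [l = 2 ^+ k] makes both terms of order
     [2 ^- k]: [(8 * pi + 2 * pi) / 2] is the constant [5 * pi]. *)
  apply: le_trans (L1_le_L2 (l := 2 ^+ k) _ (intg_sqr_tpoly _ _) _) _.
  - by rewrite exprn_gt0.
  - by apply: cintg_cont => t; exact: cvg_tpoly.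
  rewrite parseval_tpoly /a sum_tail_from.
  have E M : \sum_(m < M) cabs (2 * coef u m) ^+ 2 = 4 * \sum_(m < M) cabs (coef u m) ^+ 2.
    by rewrite big_distrr /=; apply: eq_bigr => m _; rewrite cabsM cabs_nat exprMn -natrX.
  rewrite !E -mulrBr.
  have := Hn0 k (n k) (nk k) d; set D := _ - _ => HD.
  have q0 : 0 < (2 : R) ^+ k by rewrite exprn_gt0.
  have : D <= (2 ^+ k)^-1 ^+ 2 by rewrite exprVn -exprM mulnC exprM -natrX.
  move: (2 ^+ k) q0 => q q0 {}HD.
  apply: le_trans (_ : (q * (2 * pi * (4 * q^-1 ^+ 2)) + 2 * pi / q) / 2 <= _).
    by rewrite ler_pM2r ?invr_gt0// lerD2r !ler_pM2l.
  by rewrite le_eqVlt; apply/orP; left; apply/eqP; field; rewrite gt_eqF.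
have closeR k : \I (fun t => `|complex.Re (s k.+1 t) - complex.Re (s k t)|) <= 5 * pi / 2 ^+ k.
  apply: le_trans (close k).
  apply: (le_Rintegral (@measurable_period R) (intg_norm (intgB (Is k.+1).1 (Is k).1))
    (intg_cabs (cintgB (Is k.+1) (Is k)))) => t _.
  by apply: le_trans (Re_le_cabs (s k.+1 t - s k t));
    rewrite (cReD (s k.+1 t) (- s k t)) (cReN (s k t)).
have closeI k : \I (fun t => `|complex.Im (s k.+1 t) - complex.Im (s k t)|) <= 5 * pi / 2 ^+ k.
  apply: le_trans (close k).
  apply: (le_Rintegral (@measurable_period R) (intg_norm (intgB (Is k.+1).2 (Is k).2))
    (intg_cabs (cintgB (Is k.+1) (Is k)))) => t _.
  by apply: le_trans (Im_le_cabs (s k.+1 t - s k t));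
    rewrite (cImD (s k.+1 t) (- s k t)) (cImN (s k t)).
have [gR hgR limR] := L1_limit (fun k => (Is k).1) closeR.
have [gI hgI limI] := L1_limit (fun k => (Is k).2) closeI.
exists (fun t => (gR t +i* gI t)%C); first by split.
have hg : cintg (fun t => (gR t +i* gI t)%C) by split.
move=> z zd; have gz := disk_gap zd.
set A := \I (fun t => `|u t|).
(* The first part is the [L^1] distance of [s k] from its limit, weighted by the kernel; the second
   is the Taylor remainder of [SI u] at [z]. *)
pose b k := 2 * (2 / (1 - cabs z) * (\I (fun t => `|complex.Re (s k t) - gR t|) +
   \I (fun t => `|complex.Im (s k t) - gI t|))) +
   2 * pi * (2 * (2 / (1 - cabs z) * A)) * cabs z ^+ k.
have blim : b @ \oo --> (0 : R).
  rewrite -[X in _ --> X](addr0 0); apply: cvgD.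
    rewrite -[X in _ --> X](mulr0 2); apply: cvgM; first exact: cvg_cst.
    rewrite -[X in _ --> X](mulr0 (2 / (1 - cabs z))); apply: cvgM; first exact: cvg_cst.
    by rewrite -[X in _ --> X](addr0 0); apply: cvgD.
  rewrite -[X in _ --> X](mulr0 (2 * pi * (2 * (2 / (1 - cabs z) * A)))); apply: cvgM.
    exact: cvg_cst.
  by apply: cvg_expr; rewrite ger0_norm ?cabs_ge0.
apply/eqP; rewrite -subr_eq0 -cabs_eq0 eq_le cabs_ge0 andbT.
apply: (cvgr_to_ge blim); near=> k; rewrite /b.
set g := fun t => (gR t +i* gI t)%C.
have -> : PC g z - (2 * pi)%:C%C * SI u z = PC (fun t => g t - s k t) z -
   (2 * pi)%:C%C * (SI u z - spoly u (n k) z).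
  rewrite (PC_B zd hg (Is k)) /s PC_spoly// rmorph1 mul1r; ring.
apply: le_trans (cabsB _ _) _; apply: lerD; last first.
  rewrite cabsM cabsR gtr0_norm// -[leRHS]mulrA ler_pM2l//.
  apply: le_trans (SI_expand _ hu zd) _.
  have -> : 2 * (2 / (1 - cabs z) * A) * cabs z ^+ k =
      2 * (2 * cabs z ^+ k / (1 - cabs z) * A) by ring.
  rewrite ler_pM2l//; apply: ler_wpM2r; first exact: Rintegral_ge0.
  rewrite ler_pM2r ?invr_gt0// ler_pM2l//.
  by apply: ler_wiXn2l => //; [exact: cabs_ge0|exact: ltW].
have I1 : intg (fun t => `|complex.Re (s k t) - gR t|).
  by apply: intg_norm; apply: intgB; [exact: (Is k).1|].
have I2 : intg (fun t => `|complex.Im (s k t) - gI t|).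
  by apply: intg_norm; apply: intgB; [exact: (Is k).2|].
rewrite -(RintegralD (@measurable_period R) I1 I2).
rewrite -(RintegralZl _ (@measurable_period R) (intgD I1 I2)).
apply: cabs_cint_le; [|exact: intgZ (intgD I1 I2)|].
  by apply: cintg_PC => //; exact: cintgB.
move=> t _; rewrite cabsM cabsR; apply: ler_pM => //; [exact: cabs_ge0|exact: Reschwarz_le|].
rewrite cabsC; apply: le_trans (cabs_le_ReIm _) _.
by rewrite (cReD (s k t)) (cImD (s k t)) (cReN (g t)) (cImN (g t)).
Unshelve. all: by end_near. Qed.

Lemma Re_SI u z : complex.Re (SI u z) = PI u z.
Proof. by rewrite SI_Rintegral. Qed.

(** Fatou's theorem for both components of the boundary function gives the complex limit; a third
    application, to [u] itself, identifies its real part. *)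
Lemma SI_radial u (B : R) : intg u -> (forall t, per t -> `|u t| <= B) ->
  ae_circle (fun t => exists l, radlim (SI u) t l /\ complex.Re l = 2 * pi * u t).
Proof.
move=> hu uB; have [g [hg1 hg2] gE] := SI_boundary hu uB.
have p0 : (2 * pi)%:C%C != 0 :> C.
  by rewrite -cabs_gt0 cabsR normr_gt0 gt_eqF// mulr_gt0 ?pi_gt0.
apply: ae_circle_impl (ae_circle_and (fatou_radial hu)
  (ae_circle_and (fatou_radial hg1) (fatou_radial hg2))).
move=> t pt [F0 [F1 F2]].
have H : (fun r : R => PC g (r%:C%C * expi t) : C^o) @ (1 : R)^'- --> ((2 * pi)%:C%C * g t : C^o).
  by apply/cvgCP; rewrite cReZ cImZ; split;
   [under eq_fun do rewrite -PI_Re|under eq_fun do rewrite -PI_Im].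
exists (g t).
have L : radlim (SI u) t (g t).
  rewrite /radlim.
  have K : (fun r : R => (2 * pi)%:C%C^-1 * PC g (r%:C%C * expi t) : C^o) @ (1 : R)^'- --> (g t : C^o).
    rewrite -[X in _ --> X](mulKf p0); apply: cvgCM; [exact: cvgC_cst|exact: H].
  apply: cvg_trans K; apply: near_eq_cvg; near=> r.
  rewrite gE ?mulKf//; apply: disk_radius; apply/andP; split; near: r.
    by apply: nbhs_left_ge; exact: ltr01.
  exact: nbhs_left_lt.
split => //.
have /cvgCP[L1 _] := L.
have F0' : (fun r : R => complex.Re (SI u (r%:C%C * expi t))) @ (1 : R)^'- --> 2 * pi * u t.
  by under eq_fun do rewrite Re_SI.
exact: cvg_unique L1 F0'.
Unshelve. all: by end_near. Qed.

End BoundaryFunction.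

(** * The boundary argument *)

Section Arguments.
Variable R : realType.
Local Notation C := (R[i]).
Implicit Types (x y : R).

Lemma IVT_pointwise (h : R -> R) (x y v : R) : x <= y ->
  (forall s, x <= s <= y -> {for s, continuous h}) ->
  Num.min (h x) (h y) <= v <= Num.max (h x) (h y) -> exists2 s, x <= s <= y & h s = v.
Proof.
move=> xy hc hv.
have [|s] := @IVT R h x y v xy _ hv.
  by apply: continuous_in_subspaceT => s; rewrite inE/= in_itv/= => /hc.
by rewrite in_itv/= => sxy <-; exists s.
Qed.

Lemma cos_lt1 x : 0 < `|x| <= pi -> cos x < 1.
Proof.
move=> /andP[x0 xpi].
have -> : cos x = cos `|x|.
  by have [h|h] := leP 0 x; [rewrite ger0_norm|rewrite ltr0_norm// cosN].
by rewrite -(cos0 R) ltr_cos// ?in_itv/= ?lexx ?pi_ge0 ?normr_ge0.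
Qed.

(** A continuous lift of a constant point of the circle cannot move: on the way to another value,
    [b s - b x] would take a nonzero value of modulus at most [pi], where the cosine is below 1. *)
Lemma expi_eq_const (b : R -> R) (x y : R) : x <= y ->
  (forall s, x <= s <= y -> {for s, continuous b}) ->
  (forall s, x <= s <= y -> expi (b s) = expi (b x) :> C) -> b y = b x.
Proof.
move=> xy bc be.
have E s : x <= s <= y -> cos (b s - b x) = 1.
  move=> /be [E1 E2]; rewrite cosB E1 E2 -!expr2; exact: cos2Dsin2.
apply/eqP; rewrite -subr_eq0; apply/negPn/negP => d0.
pose h s := `|b s - b x|.
have hc s : x <= s <= y -> {for s, continuous h}.
  move=> /bc cs; apply: (@cvg_norm _ R^o); apply: cvgB => //; exact: cvg_cst.
have hy : 0 < h y by rewrite normr_gt0.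
have hx : h x = 0 by rewrite /h subrr normr0.
have m0 : 0 < Num.min (h y) pi by rewrite lt_min hy pi_gt0.
have [|s /E cE hs] := @IVT_pointwise h x y (Num.min (h y) pi) xy hc.
  by rewrite hx (min_l (ltW hy)) (max_r (ltW hy)) (ltW m0)/= ge_min lexx.
have : cos (b s - b x) < 1.
  by apply: cos_lt1; rewrite -/(h s) hs m0 ge_min lexx orbT.
by rewrite cE ltxx.
Qed.

(** Squaring removes the sign [(-1) ^ m]; the double angle reduces the claim to the period [2 * pi]
    of the cosine. *)
Lemma sqr_sin_shift x (m : int) : sin (x - m%:~R * pi) ^+ 2 = sin x ^+ 2.
Proof.
have E y : cos (2 * y) = 1 - 2 * sin y ^+ 2.
  by rewrite mulr_natl cos_mulr2n cos2sin2; ring.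
have H : cos (2 * (x - m%:~R * pi)) = cos (2 * x).
  have -> : 2 * (x - m%:~R * pi) = 2 * x + (- m)%:~R * (2 * pi) by rewrite mulrNz; ring.
  by have := @expi_2piMz R (- m); rewrite cosD => -[-> ->]; rewrite mulr1 mulr0 subr0.
by move: H; rewrite !E => H; lra.
Qed.

(** Here [cos y] lies in [[0, 1]], so [1 - cos y <= 1 - cos y ^+ 2]. *)
Lemma sin_small y : `|y| <= pi / 2 -> cos 1 ^+ 2 / 2 * y ^+ 2 <= sin y ^+ 2.
Proof.
move=> yp; have p2 := @pihalf_lt2 R.
apply: le_trans (one_minus_cos_ge _) _; first by apply: le_trans yp (ltW p2).
have c0 : 0 <= cos y by apply: cos_ge0_pihalf; rewrite -ler_norml.
have c1 := cos_le1 y.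
rewrite sin2cos2 lerB// expr2; exact: ler_piMr.
Qed.

(** Once [|sin b| < 1], continuity confines [b] to the open interval of radius [pi / 2] about a
    single multiple of [pi], since leaving it means passing a point where the sine is 1 or -1. In
    that interval the sine controls the distance to the centre. *)
Lemma arg_limit (b : R -> R) : (forall s, 0 <= s < 1 -> {for s, continuous b}) ->
  (fun s => sin (b s)) @ (1 : R)^'- --> (0 : R) ->
  exists m : int, b @ (1 : R)^'- --> m%:~R * pi.
Proof.
move=> bc sb; have pi0 := @pi_gt0 R.
have SB e : 0 < e -> \forall r \near (1 : R)^'-, `|sin (b r)| < e.
  move=> e0; have /cvgrPdist_lt/(_ _ e0) := sb.
  by apply: filterS => r; rewrite sub0r normrN.
have [r0 r01 Hr] : exists2 r0, 0 <= r0 < 1 & forall r, r0 <= r < 1 -> `|sin (b r)| < 1.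
  have := SB 1 ltr01; rewrite near_withinE => /nbhs_ballP[d /= d0 Hd].
  exists (Num.max 0 (1 - d / 2)).
    by rewrite le_max lexx/= gt_max ltr01/= ltrBlDr ltrDl divr_gt0.
  move=> r; rewrite ge_max => /andP[/andP[rr0 rd] r1]; apply: Hd => //.
  by rewrite /ball/= gtr0_norm ?subr_gt0//; lra.
(* Rounds [b r0 / pi] to a nearest integer. *)
pose m := Num.floor (b r0 / pi + 1 / 2).
have key r : r0 <= r < 1 -> `|b r - m%:~R * pi| < pi / 2.
  move=> /andP[r0r r1].
  have r00 : 0 <= r0 by case/andP: r01.
  have not_eq s : r0 <= s < 1 -> `|b s - m%:~R * pi| != pi / 2.
    move=> /Hr sl; apply/eqP => E.
    have : sin (b s) ^+ 2 = 1.
      rewrite -(sqr_sin_shift _ m); move: E; set y := _ - _.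
      have [y0|y0] := leP 0 y.
        by rewrite ger0_norm// => ->; rewrite sin_pihalf expr1n.
      by rewrite ltr0_norm// => E; rewrite -sqrrN -sinN E sin_pihalf expr1n.
    move=> E2; have : `|sin (b s)| ^+ 2 < 1 by rewrite expr_lt1.
    by rewrite real_normK ?num_real// E2 ltxx.
  have start : `|b r0 - m%:~R * pi| <= pi / 2.
    have := floor_itv (b r0 / pi + 1 / 2); rewrite -/m => /andP[m1 m2].
    have E : b r0 = b r0 / pi * pi by rewrite divfK ?gt_eqF.
    rewrite E -mulrBl normrM (gtr0_norm pi0) mulrC ler_pM2l//.
    by rewrite ler_norml; move: m2; rewrite intrD; lra.
  rewrite ltNge; apply/negP => bad.
  have hc s : r0 <= s <= r -> {for s, continuous (fun s => `|b s - m%:~R * pi|)}.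
    move=> /andP[s0 sr]; apply: (@cvg_norm _ R^o); apply: cvgB; last exact: cvg_cst.
    by apply: bc; rewrite (le_trans r00 s0) (le_lt_trans sr r1).
  have [|s] := @IVT_pointwise _ r0 r (pi / 2) r0r hc.
    by rewrite ge_min start/= le_max bad orbT.
  move=> /andP[s0 sr]; apply/eqP/not_eq; by rewrite s0 (le_lt_trans sr r1).
exists m; apply/cvgrPdist_lt => e e0.
have k0 : 0 < cos 1 ^+ 2 / 2 :> R by rewrite divr_gt0// exprn_gt0// cos1_gt0.
set k := cos 1 ^+ 2 / 2 in k0.
have ke : 0 < Num.sqrt k * e by rewrite mulr_gt0// sqrtr_gt0.
near=> r.
have rr : r0 <= r < 1.
  apply/andP; split; near: r; last exact: nbhs_left_lt.
  by apply: nbhs_left_ge; case/andP: r01.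
have := sin_small (ltW (key r rr)); rewrite sqr_sin_shift -/k => H1.
have H2 : `|sin (b r)| < Num.sqrt k * e.
  by near: r; exact: SB.
rewrite distrC.
have : k * `|b r - m%:~R * pi| ^+ 2 < k * e ^+ 2.
  rewrite real_normK ?num_real//; apply: le_lt_trans H1 _.
  rewrite -(sqr_sqrtr (ltW k0)) -exprMn -(real_normK (num_real (sin _))).
  by rewrite ltr_pXn2r// nnegrE ltW.
by rewrite ltr_pM2l// ltr_pXn2r// nnegrE// ltW.
Unshelve. all: by end_near. Qed.

End Arguments.

(** * The bounded argument as a Poisson integral of indicator functions *)

Section ArgRepresentation.
Variable R : realType.
Local Notation C := (R[i]).
Local Notation mu := (@lebesgue_measure R).
Local Notation per := (@period R).
Implicit Types (z w c : C) (u g : R -> R).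

Definition outer_fun c u z : C := c * cexp (((2 * pi)^-1)%:C%C * SI u z).

Lemma outerP (g : C -> C) : outer g -> exists c u, cabs c = 1 /\ intg u /\
  forall z, disk z -> g z = outer_fun c u z.
Proof.
move=> [c [u [c1 [hu gE]]]]; exists c, u; split => //; split => // z zd.
by rewrite gE// /outer_fun SI_Rintegral.
Qed.

Lemma cabs_outer c u z : cabs c = 1 -> cabs (outer_fun c u z) = expR ((2 * pi)^-1 * PI u z).
Proof. by move=> c1; rewrite cabsM c1 mul1r cabs_cexp cReZ Re_SI. Qed.

Lemma derivableC_cst (k : C) z : @derivable _ C^o C^o (fun=> k) z 1.
Proof. exact: (@derivable_cst C C^o C^o k z 1). Qed.

Lemma derivableCM (f g : C -> C) z : @derivable _ C^o C^o f z 1 ->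
  @derivable _ C^o C^o g z 1 -> @derivable _ C^o C^o (fun w => f w * g w) z 1.
Proof. move=> df dg; exact: (@derivableM C C^o f g z 1 df dg). Qed.

Lemma derivableCD (f g : C -> C) z : @derivable _ C^o C^o f z 1 ->
  @derivable _ C^o C^o g z 1 -> @derivable _ C^o C^o (fun w => f w + g w) z 1.
Proof. move=> df dg; exact: (@derivableD C C^o C^o f g z 1 df dg). Qed.

Lemma derivableCV (f : C -> C) z : f z != 0 -> @derivable _ C^o C^o f z 1 ->
  @derivable _ C^o C^o (fun w => (f w)^-1) z 1.
Proof. move=> f0 df; exact: (@derivableV C C^o f z 1 f0 df). Qed.

Lemma holo_outer c u : intg u -> holo (outer_fun c u).
Proof.
move=> hu z zd; have dS := derivable_SI hu zd.
have d1 := derivableCM (@derivableC_cst ((2 * pi)^-1)%:C%C z) dS.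
exact: (derivableCM (@derivableC_cst c z) (derivable_compC d1 (@derivable_cexp R _))).
Qed.

(** Samples the radius along a sequence, as dominated convergence, Fatou's lemma and the
    measurability of countable unions and intersections require. *)
Definition rho (n : nat) : R := 1 - (n.+2%:R)^-1.

Lemma rho01 n : 0 <= rho n < 1.
Proof.
rewrite /rho subr_ge0 ltrBlDr ltrDl invr_gt0 ltr0n andbT.
by rewrite invf_le1 ?ltr0n// ler1n.
Qed.

Lemma cvg_rho : rho @ \oo --> (1 : R)^'-.
Proof.
have L : rho @ \oo --> (1 : R).
  rewrite -[X in _ --> X]subr0; apply: cvgB; first exact: cvg_cst.
  have := @cvg_harmonic R; rewrite -(cvg_shiftS (@harmonic R)); exact.
move=> P; rewrite /at_left /within /= => HP.
have : \forall n \near \oo, rho n < 1 -> P (rho n) by exact: (L _ HP).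
by apply: filterS => n; apply; case/andP: (rho01 n).
Qed.

Lemma PI_D g1 g2 z : disk z -> intg g1 -> intg g2 ->
  PI (fun t => g1 t + g2 t) z = PI g1 z + PI g2 z.
Proof.
move=> zd h1 h2; rewrite /PI -(RintegralD (@measurable_period R) (intg_PI zd h1) (intg_PI zd h2)).
by apply: eq_Rintegral => t _; rewrite mulrDr.
Qed.

Lemma PI_Z x g z : disk z -> intg g -> PI (fun t => x * g t) z = x * PI g z.
Proof.
move=> zd h1; rewrite /PI -(RintegralZl _ (@measurable_period R) (intg_PI zd h1)).
by apply: eq_Rintegral => t _; rewrite mulrCA.
Qed.

Lemma PI_sum n (h : nat -> R -> R) z : disk z -> (forall i, intg (h i)) ->
  PI (fun t => \sum_(i < n) h i t) z = \sum_(i < n) PI (h i) z.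
Proof.
move=> zd hh; elim: n => [|n IH].
  rewrite big_ord0 -[RHS](mulr0 (2 * pi)) -(PI_cst 0 zd).
  by apply: eq_Rintegral => t _; rewrite big_ord0.
rewrite big_ord_recr /= -IH -(PI_D zd (@intg_sum _ n h hh) (hh n)).
by apply: eq_Rintegral => t _; rewrite big_ord_recr.
Qed.

Lemma PI_dct (f : nat -> R -> R) g (M : R) z : disk z ->
  (forall n, measurable_fun per (f n)) -> (forall n t, per t -> `|f n t| <= M) ->
  measurable_fun per g -> ae_circle (fun t => (fun n => f n t) @ \oo --> g t) ->
  (fun n => PI (f n) z) @ \oo --> PI g z.
Proof.
move=> zd mf fM mg fg.
have If n : intg (f n) by exact: intg_bounded (mf n) (fM n).
have mk := meas_Reschwarz zd.
pose F n t := (complex.Re (schwarz t z) * f n t)%:E.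
have mF n : measurable_fun per (F n) by exact: measurable_int (intg_PI zd (If n)).
have mG : measurable_fun per (fun t => (complex.Re (schwarz t z) * g t)%:E).
  by apply/measurable_EFinP; exact: measurable_funM.
have cF : {ae mu, forall t, per t -> (fun n => F n t) @ \oo --> (complex.Re (schwarz t z) * g t)%:E}.
  apply: (@filterS _ _ (@ae_filter_mu R) _ _ _ fg) => t H pt.
  apply: cvg_EFin; first by near=> n.
  by apply: cvgM; [exact: cvg_cst|exact: H].
pose B := 2 / (1 - cabs z) * M.
have IB : mu.-integrable per (EFin \o (fun=> B)) := intg_cst B.
have dF : {ae mu, forall t n, per t -> (`|F n t| <= B%:E)%E}.
  apply: aeW => t n pt; rewrite lee_fin normrM.
  by apply: ler_pM => //; [exact: Reschwarz_le|exact: fM].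
have [ig _ lim0] := dominated_convergence (@measurable_period R) mF mG cF IB dF.
have fin : (\int[mu]_(t in per) (complex.Re (schwarz t z) * g t)%:E)%E \is a fin_num.
  exact: (integrable_fin_num _ ig).
rewrite /PI /Rintegral; apply: fine_cvg; rewrite fineK//.
Unshelve. all: by end_near. Qed.

Variables (c : C) (u : R -> R) (a : C -> R) (M : R).
Hypothesis c1 : cabs c = 1.
Hypothesis hu : intg u.
Hypothesis ac : forall z, disk z -> {for z, continuous (a : C^o -> R)}.
Hypothesis aE : forall z, disk z -> outer_fun c u z = (cabs (outer_fun c u z))%:C%C * expi (a z).
Hypothesis aM : forall z, disk z -> `|a z| <= M.

(** An argument of [outer_fun c u] up to the constant argument of [c]. *)
Let V z := (2 * pi)^-1 * complex.Im (SI u z).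

Lemma arg_ray z (s : R) : disk (s%:C%C * z) -> {for s, continuous (fun x : R => a (x%:C%C * z))}.
Proof.
move=> zd.
apply: (@continuous_cvg R C^o R (nbhs s) _ (fun t => t%:C%C * z : C^o) a (s%:C%C * z)).
  exact: ac.
by apply: cvgCM; [apply: cvg_realC; exact: cvg_id|exact: cvgC_cst].
Qed.

Lemma arg_circle (r t : R) : 0 <= r < 1 -> {for t, continuous (fun x : R => a (r%:C%C * expi x))}.
Proof.
move=> r01.
apply: (@continuous_cvg R C^o R (nbhs t) _ (fun t => r%:C%C * expi t : C^o) a (r%:C%C * expi t)).
  by apply: ac; exact: disk_radius.
by apply: cvgCM; [exact: cvgC_cst|apply: cvg_expi; exact: cvg_id].
Qed.

(** [expi (a w - V w)] is the constant [c], so the continuous function [a - V] is constant along the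
    ray from 0 to [z]. *)
Lemma arg_SI z : disk z -> a z = V z + (a 0 - V 0).
Proof.
move=> zd.
have ds (s : R) : 0 <= s <= 1 -> disk (s%:C%C * z) by move=> h; apply: disk_scale.
pose b s := a (s%:C%C * z) - V (s%:C%C * z).
have E w : disk w -> expi (a w - V w) = c.
  move=> wd; have := aE wd; rewrite cabs_outer//.
  rewrite /outer_fun /cexp cReZ cImZ Re_SI -/(V w) expiD expiN => H.
  have e0 : (expR ((2 * pi)^-1 * PI u w))%:C%C != 0 :> C.
    by rewrite -cabs_gt0 cabsR normr_gt0 gt_eqF// expR_gt0.
  apply: (mulfI e0); rewrite mulrA -H mulrA [c * _]mulrC mulfK ?expi_neq0//.
have bc s : 0 <= s <= 1 -> {for s, continuous b}.
  move=> s01; apply: cvgB; first by apply: arg_ray; exact: ds.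
  apply: cvgM; first exact: cvg_cst.
  by have /cvgCP[] := holo_ray (holo_SI hu) (ds _ s01).
have /(_ _)/eqP := @expi_eq_const R b 0 1 ler01 bc.
rewrite /b mul0r mul1r => /(_ _)/eqP H.
have <- : a z - V z = a 0 - V 0.
  apply: H => s s01; rewrite !E//; [by rewrite /disk cabs0|exact: ds].
by rewrite addrC subrK.
Qed.

Lemma PI_arg (r : R) z : 0 <= r < 1 -> disk z ->
  PI (fun t => a (r%:C%C * expi t)) z = 2 * pi * a (r%:C%C * z).
Proof.
move=> r01 zd; have /andP[r0 r1] := r01.
have rzd : disk (r%:C%C * z) by apply: disk_scale; rewrite // r0 ltW.
have [_ IV] := cintg_circle (holo_SI hu) r01.
have IV2 := intgZ (2 * pi)^-1 IV.
rewrite (arg_SI rzd) mulrDr.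
rewrite (_ : PI _ z = PI (fun t => V (r%:C%C * expi t) + (a 0 - V 0)) z); last first.
  by apply: eq_Rintegral => t _; rewrite arg_SI//; exact: disk_radius.
rewrite (PI_D zd IV2 (intg_cst _)) (PI_Z _ zd IV) (PI_cst _ zd); congr (_ + _).
rewrite (PI_Im (fun t => SI u (r%:C%C * expi t))) SI_reproduce// cImZ /V mulrCA; ring.
Qed.

Hypothesis rad : ae_circle (fun t => exists l, radlim (outer_fun c u) t l /\ complex.Im l = 0).

Lemma cvg_cabs_outer : ae_circle (fun t =>
  (fun r => cabs (outer_fun c u (r%:C%C * expi t))) @ (1 : R)^'- --> expR (u t)).
Proof.
apply: ae_circle_impl (fatou_radial hu) => t _ H.
have -> : (fun r : R => cabs (outer_fun c u (r%:C%C * expi t))) =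
   (fun r => expR ((2 * pi)^-1 * PI u (r%:C%C * expi t))).
  by apply/funext => r; exact: cabs_outer.
have p0 : 2 * pi != 0 :> R by rewrite gt_eqF// mulr_gt0 ?pi_gt0.
have K : (fun r : R => (2 * pi)^-1 * PI u (r%:C%C * expi t)) @ (1 : R)^'- --> u t.
  rewrite -[X in _ --> X](mulKf p0); apply: cvgM; [exact: cvg_cst|exact: H].
exact: (cvg_comp _ _ K (@continuous_expR R (u t))).
Qed.

Lemma near_radius_disk (t : R) : \forall r \near (1 : R)^'-, disk (r%:C%C * expi t).
Proof.
near=> r; apply: disk_radius; apply/andP; split; near: r; last exact: nbhs_left_lt.
by apply: nbhs_left_ge; exact: ltr01.
Unshelve. all: by end_near. Qed.

(** The sine of the argument is the imaginary part divided by the modulus, and the modulus has the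
    positive limit [expR (u t)]. *)
Lemma sin_arg : ae_circle (fun t =>
  (fun r => sin (a (r%:C%C * expi t))) @ (1 : R)^'- --> (0 : R)).
Proof.
apply: ae_circle_impl (ae_circle_and cvg_cabs_outer rad) => t _ [H [l [/cvgCP[_ Hl] l0]]].
rewrite l0 in Hl.
have e0 : expR (u t) != 0 by rewrite gt_eqF// expR_gt0.
have K : (fun r : R => complex.Im (outer_fun c u (r%:C%C * expi t)) *
   (cabs (outer_fun c u (r%:C%C * expi t)))^-1) @ (1 : R)^'- --> (0 : R).
  by rewrite -[X in _ --> X](mul0r (expR (u t))^-1); apply: cvgM => //; apply: cvgV.
apply: cvg_trans K; apply: near_eq_cvg; near=> r.
have rd : disk (r%:C%C * expi t) by near: r; exact: near_radius_disk.
rewrite [in complex.Im _]aE// cImZ /= mulrC mulKf//.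
by rewrite cabs_outer// gt_eqF// expR_gt0.
Unshelve. all: by end_near. Qed.

Lemma arg_radial : ae_circle (fun t => exists m : int,
  (fun n => a ((rho n)%:C%C * expi t)) @ \oo --> m%:~R * pi).
Proof.
apply: ae_circle_impl sin_arg => t _ H.
have [m Hm] := @arg_limit R (fun r => a (r%:C%C * expi t)) (fun s s01 =>
  @arg_ray (expi t) s (disk_radius t s01)) H.
by exists m; exact: (cvg_comp _ _ cvg_rho Hm).
Qed.

(* Almost everywhere, the points where the boundary argument is at least [j * pi]:
   that argument is [pi] times a sum of indicator functions of these sets. *)
Definition jump_set (j : int) : set R :=
  \bigcup_N \bigcap_(n in [set n | (N <= n)%N])
    [set t | (j%:~R - 1 / 2) * pi < a ((rho n)%:C%C * expi t)].

Lemma measurable_arg_circle n : measurable_fun setT (fun t => a ((rho n)%:C%C * expi t)).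
Proof. by apply: continuous_measurable_fun => t; apply: arg_circle; exact: rho01. Qed.

Lemma measurable_jump_set j : measurable (jump_set j).
Proof.
apply: bigcup_measurable => N _; apply: bigcap_measurable; first by exists N => /=.
move=> n _.
have -> : [set t | (j%:~R - 1 / 2) * pi < a ((rho n)%:C%C * expi t)] =
  (fun t => a ((rho n)%:C%C * expi t)) @^-1` `](j%:~R - 1 / 2) * pi, +oo[.
  by apply/seteqP; split => t /=; rewrite in_itv/= andbT.
by rewrite -[X in measurable X]setTI; apply: measurable_arg_circle.
Qed.

(** The threshold lies midway between [(j - 1) * pi] and [j * pi], so a limit [m * pi] never falls
    on it, and exceeding it eventually amounts to [j <= m]. *)
Lemma jump_setE t (m j : int) :
  (fun n => a ((rho n)%:C%C * expi t)) @ \oo --> m%:~R * pi ->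
  (t \in jump_set j) = (j <= m).
Proof.
move=> Hm; have pi0 := @pi_gt0 R; apply/idP/idP.
- rewrite inE => -[N _ HN].
  have : (j%:~R - 1 / 2) * pi <= m%:~R * pi :> R.
    apply: (cvgr_to_ge Hm); near=> n; apply: ltW; apply: HN => /=.
    by near: n; exact: nbhs_infty_ge.
  rewrite ler_pM2r// => jm.
  have : (j%:~R : R) < (m + 1)%:~R by rewrite intrD; lra.
  by rewrite ltr_int ltzD1.
- move=> jm; rewrite inE.
  have : (j%:~R - 1 / 2) * pi < m%:~R * pi :> R.
    rewrite ltr_pM2r//; have : (j%:~R : R) <= m%:~R by rewrite ler_int.
    by lra.
  move=> /(cvgr_gt _ Hm)[N _ HN].
  by exists N => // n /= Nn; exact: HN.
Unshelve. all: by end_near. Qed.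

Lemma arg_representation : exists (L : nat) (E : nat -> set R),
  (forall i, measurable (E i)) /\
  forall z, disk z -> \sum_(i < 2 * L) PI (\1_(E i) : R -> R) z = 2 * a z + 2 * pi * L%:R.
Proof.
have d0 : disk (0 : C) by rewrite /disk cabs0.
have M0 : 0 <= M by apply: le_trans (aM d0).
pose L := Num.bound M.
have ML : M < L%:R by exact: archi_boundP.
(* The index of the jump runs from [1 - L] to [L]. For [|m| <= L] exactly [m + L] of these indices
   are at most [m], which is why [L] is subtracted in [g]. *)
pose E i := jump_set (i%:Z + 1 - L%:Z).
exists L, E; split; first by move=> i; exact: measurable_jump_set.
move=> z zd; have pi0 := @pi_gt0 R; have pi2 := @pi_ge2 R.
pose g t : R := pi * \sum_(i < 2 * L) \1_(E i) t - pi * L%:R.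
have Ichi i : intg (\1_(E i)).
  apply: (@intg_bounded _ _ 1).
    by apply: measurable_funTS; apply: measurable_indic; exact: measurable_jump_set.
  by move=> t _; rewrite indicE; case: (_ \in _); rewrite /= ?normr1 ?normr0.
have Isum := @intg_sum _ (2 * L) (fun i => \1_(E i)) Ichi.
have Ig : intg g by apply: intgB; [exact: intgZ|exact: intg_cst].
have count n (k : nat) : \sum_(i < n) ((i < k)%N)%:R = (minn n k)%:R :> R.
  elim: n => [|n IH]; first by rewrite big_ord0 min0n.
  rewrite big_ord_recr /= IH -natrD; congr (_%:R).
  by case: ltnP; lia.
have gcvg : ae_circle (fun t => (fun n => a ((rho n)%:C%C * expi t)) @ \oo --> g t).
  apply: ae_circle_impl arg_radial => t _ [m Hm].
  suff -> : g t = m%:~R * pi by [].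
  have mM : `|m%:~R * pi| <= M.
    have Hn : (fun n => `|a ((rho n)%:C%C * expi t)|) @ \oo --> `|m%:~R * pi|
      by exact: (@cvg_norm _ R^o _ _ _ _ _ Hm).
    apply: (cvgr_to_le Hn); near=> n.
    by apply: aM; apply: disk_radius; exact: rho01.
  have mL : `|m| <= L%:Z.
    rewrite -(ler_int R) intr_norm.
    have : `|m%:~R * pi| < L%:R * pi :> R.
      by apply: le_lt_trans mM (lt_le_trans ML _); rewrite ler_peMr//; lra.
    by rewrite normrM (gtr0_norm pi0) ltr_pM2r// => /ltW.
  have [k mk] : exists k : nat, m = k%:Z - L%:Z.
    by exists (absz (m + L%:Z)); move: mL; lia.
  have k2 : (k <= 2 * L)%N by move: mL; rewrite mk; lia.
  rewrite /g; have -> : \sum_(i < 2 * L) \1_(E i) t = k%:R :> R.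
    rewrite -[in RHS](minn_idPr k2) -count; apply: eq_bigr => i _.
    rewrite indicE /E (jump_setE _ Hm); congr (nat_of_bool _)%:R.
    by rewrite mk; lia.
  by rewrite mk rmorphB/= -mulrBr mulrC.
have LHS := @PI_dct (fun n t => a ((rho n)%:C%C * expi t)) g M z zd
  (fun n => measurable_funTS (measurable_arg_circle n))
  (fun n t _ => aM (disk_radius t (rho01 n))) (intg_meas Ig) gcvg.
have RHS : (fun n => PI (fun t => a ((rho n)%:C%C * expi t)) z) @ \oo --> 2 * pi * a z.
  have -> : (fun n => PI (fun t => a ((rho n)%:C%C * expi t)) z) =
      (fun n => 2 * pi * a ((rho n)%:C%C * z)).
    by apply/funext => n; apply: PI_arg => //; exact: rho01.
  apply: cvgM; first exact: cvg_cst.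
  have z1 : disk (1%:C%C * z) by rewrite rmorph1 mul1r.
  have -> : a z = a (1%:C%C * z) by rewrite rmorph1 mul1r.
  have /cvg_at_left_filter H := @arg_ray z 1 z1.
  exact: (cvg_comp _ _ cvg_rho H).
(* Two evaluations of one limit: dominated convergence on the circle, and reproduction at
   [rho n * z] followed by continuity of [a] at [z]. *)
have : PI g z = 2 * pi * a z by exact: cvg_unique LHS RHS.
have -> : PI g z = pi * \sum_(i < 2 * L) PI (\1_(E i)) z + 2 * pi * - (pi * L%:R).
  rewrite -(PI_cst _ zd) -(@PI_sum (2 * L) (fun i => \1_(E i))) // -PI_Z // -PI_D //.
    exact: intgZ.
  exact: intg_cst.
move=> H; apply: (mulfI (lt0r_neq0 pi0)); move: H; set S := \sum_(_ < _) _ => H.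
have -> : pi * S = (pi * S + 2 * pi * - (pi * L%:R)) + 2 * pi * (pi * L%:R) by ring.
by rewrite H; ring.
Unshelve. all: by end_near. Qed.

End ArgRepresentation.

(** * Factorization into Cayley transforms *)

Section Cayley.
Variable R : realType.
Local Notation C := (R[i]).
Local Notation per := (@period R).
Implicit Types (z w : C) (u : R -> R) (E : set R).

(* The inverse of [Tmap], from the closed upper half plane to the closed disk. *)
Definition cayley w : C := 'i%C * (w - 'i%C) / (w + 'i%C).

Lemma addi_neq0 w : 0 <= complex.Im w -> w + 'i%C != 0.
Proof.
move=> w0; apply/eqP => /(congr1 (@complex.Im R)).
rewrite cImD /= => /eqP; rewrite gt_eqF//; lra.
Qed.

Lemma i_neq0 : ('i%C : C) != 0.
Proof. by rewrite eq_complex /= oner_eq0 andbF. Qed.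

Lemma cabs_i : cabs ('i%C : C) = 1.
Proof. by rewrite /cabs /= expr0n expr1n add0r sqrtr1. Qed.

Lemma cabs_cayley_le1 w : 0 <= complex.Im w -> cabs (cayley w) <= 1.
Proof.
move=> w0; have n0 := addi_neq0 w0.
rewrite /cayley cabsM cabsV cabsM cabs_i mul1r ler_pdivrMr ?cabs_gt0// mul1r.
rewrite /cabs ler_wsqrtr// !cReD !cImD !cReN !cImN /= oppr0 !addr0 lerD2l.
rewrite -subr_ge0 (_ : _ - _ = 4 * complex.Im w) ?mulr_ge0//; ring.
Qed.

Lemma cabs_cayley_real w : complex.Im w = 0 -> cabs (cayley w) = 1.
Proof.
move=> w0; have n0 : w + 'i%C != 0 by apply: addi_neq0; rewrite w0.
rewrite /cayley cabsM cabsV cabsM cabs_i mul1r.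
have -> : cabs (w - 'i%C) = cabs (w + 'i%C).
  by rewrite /cabs !cReD !cImD !cReN !cImN /= w0 oppr0 !addr0 !add0r sqrrN.
by rewrite divff// cabs_eq0.
Qed.

Lemma Tmap_cayley w : 0 <= complex.Im w -> Tmap (cayley w) = w.
Proof.
move=> w0; have n0 := addi_neq0 w0; have i0 := i_neq0.
have ii : 'i%C * 'i%C = -1 :> C by rewrite -expr2 sqr_i.
rewrite /Tmap /cayley !mulrA ii !mulN1r mulNr opprK.
have -> : 1 + (w - 'i%C) / (w + 'i%C) = 2 * w / (w + 'i%C) by field.
have -> : 1 - (w - 'i%C) / (w + 'i%C) = 2 * 'i%C / (w + 'i%C) by field.
by field; rewrite n0 i0.
Qed.

(** ['i] is the pole of [Tmap]; avoiding it makes the composition with [Tmap] meaningful throughout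
    the disk. *)
Lemma cayley_neq_i w : 0 <= complex.Im w -> cayley w != 'i%C.
Proof.
move=> w0; have n0 := addi_neq0 w0; apply/eqP => H.
have : cayley w * (w + 'i%C) = 'i%C * (w + 'i%C) by rewrite H.
rewrite /cayley divfK// => /(mulfI i_neq0)/(congr1 (@complex.Im R)).
rewrite !cImD cImN /=; lra.
Qed.

Lemma holo_cayley (w : C -> C) : holo w -> (forall z, disk z -> 0 <= complex.Im (w z)) ->
  holo (cayley \o w).
Proof.
move=> hw w0 z zd.
have d1 := derivableCD (hw z zd) (@derivableC_cst R (- 'i%C) z).
have d2 := derivableCD (hw z zd) (@derivableC_cst R 'i%C z).
exact: (derivableCM (derivableCM (@derivableC_cst R 'i%C z) d1)
  (@derivableCV R (fun x => w x + 'i%C) z (addi_neq0 (w0 z zd)) d2)).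
Qed.

Lemma inner_cayley (w : C -> C) : holo w ->
  (forall z, disk z -> 0 <= complex.Im (w z)) ->
  ae_circle (fun t => exists l, radlim w t l /\ complex.Im l = 0) ->
  inner (cayley \o w).
Proof.
move=> hw w0 wr; split.
  split; first exact: holo_cayley.
  by exists 1 => z zd; apply: cabs_cayley_le1; exact: w0.
apply: ae_circle_impl wr => t _ [l [wl l0]]; exists (cayley l); split.
  have n0 : l + 'i%C != 0 by apply: addi_neq0; rewrite l0.
  apply: cvgCM.
    by apply: cvgCM; [exact: cvgC_cst|apply: cvgCB; [exact: wl|exact: cvgC_cst]].
  by apply: cvgCV n0 _; apply: cvgCD; [exact: wl|exact: cvgC_cst].
exact: cabs_cayley_real.
Qed.

Lemma Re_schwarz_ge0 t z : disk z -> 0 <= complex.Re (schwarz t z).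
Proof.
move=> zd; rewrite /schwarz cRe_div divr_ge0//; last by rewrite addr_ge0 ?sqr_ge0.
rewrite !cReD !cImD !cReN !cImN /=.
have Et := cos2Dsin2 t; have : cabs z ^+ 2 <= 1 by rewrite expr_le1 ?cabs_ge0// ltW.
rewrite sqr_cabs; move: Et; move: (cos t) (sin t) (complex.Re z) (complex.Im z) => p q x y.
move=> Et H; rewrite (_ : _ + _ = (p ^+ 2 + q ^+ 2) - (x ^+ 2 + y ^+ 2)); last ring.
by rewrite Et subr_ge0.
Qed.

Lemma intg_indic E : measurable E -> intg (\1_E : R -> R).
Proof.
move=> mE; apply: (@intg_bounded _ _ 1).
  by apply: measurable_funTS; exact: measurable_indic.
by move=> t _; rewrite indicE; case: (_ \in _); rewrite /= ?normr1 ?normr0.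
Qed.

Lemma PI_indic E z : measurable E -> disk z -> 0 <= PI (\1_E : R -> R) z <= 2 * pi.
Proof.
move=> mE zd; apply/andP; split.
  by apply: Rintegral_ge0 => t _; rewrite mulr_ge0 ?Re_schwarz_ge0// indicE.
rewrite -[leRHS]mulr1 -(PI_cst 1 zd); apply: (le_Rintegral (@measurable_period R)
  (intg_PI zd (intg_indic mE)) (intg_PI zd (intg_cst 1))) => t _.
by rewrite ler_wpM2l ?Re_schwarz_ge0// indicE; case: (_ \in _).
Qed.

(* Its boundary argument is [pi] on [E] and [0] elsewhere. *)
Definition half_plane_fun E z : C := cexp ('i%C * (2^-1)%:C%C * SI (\1_E : R -> R) z).

Lemma half_plane_funE E z : half_plane_fun E z =
  (expR (- (2^-1 * complex.Im (SI (\1_E : R -> R) z))))%:C%C * expi (2^-1 * PI (\1_E : R -> R) z).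
Proof.
rewrite /half_plane_fun /cexp -mulrA (cReM 'i%C) (cImM 'i%C) cReZ cImZ Re_SI /=.
by rewrite !mul0r !mul1r !add0r.
Qed.

Lemma holo_half_plane E : measurable E -> holo (half_plane_fun E).
Proof.
move=> mE z zd; have dS := derivable_SI (intg_indic mE) zd.
have d1 := derivableCM (@derivableC_cst R ('i%C * (2^-1)%:C%C) z) dS.
exact: (derivable_compC d1 (@derivable_cexp R _)).
Qed.

Lemma Im_half_plane_ge0 E z : measurable E -> disk z -> 0 <= complex.Im (half_plane_fun E z).
Proof.
move=> mE zd; rewrite half_plane_funE cImZ /=.
have /andP[p0 p1] := PI_indic mE zd.
apply: mulr_ge0; first by rewrite ltW// expR_gt0.
by apply: sin_ge0_pi; apply/andP; split; lra.
Qed.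

Lemma half_plane_radial E : measurable E ->
  ae_circle (fun t => exists l, radlim (half_plane_fun E) t l /\ complex.Im l = 0).
Proof.
move=> mE; have ub t : per t -> `|(\1_E : R -> R) t| <= 1.
  by move=> _; rewrite indicE; case: (_ \in _); rewrite /= ?normr1 ?normr0.
apply: ae_circle_impl (SI_radial (intg_indic mE) ub) => t _ [l [ll lE]].
exists (cexp ('i%C * (2^-1)%:C%C * l)); split.
  by apply: cvg_cexp; apply: cvgCM; [exact: cvgC_cst|exact: ll].
rewrite /cexp cImZ -mulrA (cReM 'i%C) (cImM 'i%C) cReZ cImZ lE /= indicE !mul0r !mul1r !add0r.
case: (_ \in _) => /=; last by rewrite !mulr0 sin0 mulr0.
by rewrite mulr1 mulKf// sinpi mulr0.
Qed.

Lemma inner_half_plane E : measurable E -> inner (cayley \o half_plane_fun E).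
Proof.
move=> mE; apply: inner_cayley; first exact: holo_half_plane.
  by move=> z zd; exact: Im_half_plane_ge0.
exact: half_plane_radial.
Qed.

Lemma inner_cayley_cst w : complex.Im w = 0 -> inner (fun=> cayley w : C).
Proof.
move=> w0; split.
  split; first by move=> z zd; exact: derivableC_cst.
  by exists 1 => z zd; rewrite cabs_cayley_real.
apply: aeW => t _; exists (cayley w); split; first exact: cvgC_cst.
exact: cabs_cayley_real.
Qed.

Lemma holo_prod n (h : nat -> C -> C) : (forall i, holo (h i)) ->
  holo (fun z => \prod_(i < n) h i z).
Proof.
move=> hh z zd; elim: n => [|n IH].
  have -> : (fun z => \prod_(i < 0) h i z) = fun=> 1 by apply/funext => w; rewrite big_ord0.
  exact: derivableC_cst.
have -> : (fun z => \prod_(i < n.+1) h i z) = fun z => (\prod_(i < n) h i z) * h n z.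
  by apply/funext => w; rewrite big_ord_recr.
exact: (derivableCM IH (hh n z zd)).
Qed.

Lemma half_plane_neq0 E z : half_plane_fun E z != 0.
Proof. exact: cexp_neq0. Qed.

(** Only the argument of the product matters for showing that the quotient is real, so the modulus
    is left as an unspecified nonzero real [x]. *)
Lemma prod_half_plane n (E : nat -> set R) z : exists2 x : R, x != 0 &
  \prod_(i < n) half_plane_fun (E i) z =
  x%:C%C * expi (2^-1 * \sum_(i < n) PI (\1_(E i) : R -> R) z).
Proof.
elim: n => [|n [x x0 IH]].
  by exists 1; rewrite ?oner_eq0// !big_ord0 mulr0 expi0 mul1r.
exists (x * expR (- (2^-1 * complex.Im (SI (\1_(E n) : R -> R) z)))).
  by rewrite mulf_neq0// gt_eqF// expR_gt0.
rewrite !big_ord_recr /= IH half_plane_funE mulrDr expiD rmorphM /=; ring.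
Qed.

Lemma outer_factorization (Rf : C -> C) : RO Rf -> bounded_arg Rf ->
  exists (n : nat) (phi : nat -> C -> C),
    (forall i, (i < n)%N -> inner (phi i) /\ forall z, disk z -> phi i z != 'i%C) /\
    (forall z, disk z -> Rf z = \prod_(i < n) Tmap (phi i z)).
Proof.
move=> [[_ rad] /outerP[c [u [c1 [hu RE]]]]] [a [ac [aE [M aM]]]].
have aE' z : disk z -> outer_fun c u z = (cabs (outer_fun c u z))%:C%C * expi (a z).
  by move=> zd; rewrite -RE//; exact: aE.
have rad' : ae_circle (fun t => exists l, radlim (outer_fun c u) t l /\ complex.Im l = 0).
  apply: ae_circle_impl rad => t _ [l [ll l0]]; exists l; split => //.
  apply: cvg_trans ll; apply: near_eq_cvg; near=> r; rewrite RE//.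
  by near: r; exact: near_radius_disk.
have [L [E [mE EE]]] := arg_representation c1 hu ac aE' aM rad'.
pose P z := \prod_(i < 2 * L) half_plane_fun (E i) z.
have P0 z : P z != 0 by apply/prodf_neq0 => i _; exact: half_plane_neq0.
have hP : holo P by apply: (@holo_prod (2 * L) (fun i => half_plane_fun (E i))) => i;
  exact: holo_half_plane.
pose Q z := outer_fun c u z * (P z)^-1.
have hQ : holo Q.
  move=> z zd; have d1 := @holo_outer R c u hu z zd; have d2 := @derivableCV R P z (P0 z) (hP z zd).
  exact: (@derivableCM R (outer_fun c u) (fun w => (P w)^-1) z d1 d2).
have Qr z : disk z -> complex.Im (Q z) = 0.
  move=> zd; have [x x0 Px] := prod_half_plane (2 * L) E z.
  rewrite /Q aE'// /P Px EE//.
  (* The product has argument [a z + L * pi], so the quotient has argument [- L * pi] and is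
     real. *)
  have -> : 2^-1 * (2 * a z + 2 * pi * L%:R) = a z + L%:R * pi by field.
  have xC : x%:C%C != 0 :> C by rewrite -cabs_gt0 cabsR normr_gt0.
  have -> : (cabs (outer_fun c u z))%:C%C * expi (a z) / (x%:C%C * expi (a z + L%:R * pi)) =
     (cabs (outer_fun c u z) / x)%:C%C * expi (0 - L%:Z%:~R * pi).
    rewrite sub0r expiN expiD rmorphM fmorphV /=; field.
    by rewrite xC !expi_neq0.
  rewrite cImZ /=; have /eqP := @sqr_sin_shift R 0 L%:Z.
  by rewrite sin0 expr0n sqrf_eq0 => /eqP->; rewrite mulr0.
have d0 : disk (0 : C) by rewrite /disk cabs0.
have q0 := Qr 0 d0.
(* The additional last factor carries the real constant [Q 0], whose image under [cayley] is
   unimodular. *)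
exists (2 * L).+1, (fun i => if (i < 2 * L)%N then cayley \o half_plane_fun (E i)
  else (fun=> cayley (Q 0))).
split.
  move=> i _; case: ifP => _; split.
  - exact: inner_half_plane.
  - by move=> z zd; apply: cayley_neq_i; exact: Im_half_plane_ge0.
  - exact: inner_cayley_cst.
  - by move=> z zd; apply: cayley_neq_i; rewrite q0.
move=> z zd; rewrite big_ord_recr /= ltnn Tmap_cayley ?q0//.
have -> : \prod_(i < 2 * L) Tmap ((if (i < 2 * L)%N then
    cayley \o half_plane_fun (E i) else (fun=> cayley (Q 0))) z) = P z.
  by apply: eq_bigr => i _; rewrite ltn_ord /= Tmap_cayley//; exact: Im_half_plane_ge0.
by rewrite -(holo_real_cst hQ Qr zd) /Q RE// mulrCA divff// mulr1.
Unshelve. all: by end_near. Qed.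

End Cayley.

(** * Hardy spaces *)

Section HardyClass.
Variable R : realType.
Local Notation C := (R[i]).
Local Notation mu := (@lebesgue_measure R).
Local Notation per := (@period R).
Local Notation "\I u" := (Rintegral mu per u) (at level 10, u at level 9).
Implicit Types (z w c : C) (u v g : R -> R) (q r t : R).

Lemma fatou_ae (h : nat -> R -> R) v (M : \bar R) :
  (forall n, measurable_fun per (h n)) -> (forall n t, per t -> 0 <= h n t) ->
  measurable_fun per v -> (forall t, per t -> 0 <= v t) ->
  ae_circle (fun t => h ^~ t @ \oo --> v t) ->
  (forall n, \int[mu]_(t in per) (h n t)%:E <= M)%E ->
  (\int[mu]_(t in per) (v t)%:E <= M)%E.
Proof.
move=> mh h0 mv v0 hv hM.
have mE n : measurable_fun per (fun t => (h n t)%:E) by exact/measurable_EFinP.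
have E0 n t : per t -> (0 <= (h n t)%:E)%E by move=> pt; rewrite lee_fin h0.
apply: (@le_trans _ _ (\int[mu]_(t in per) limn_einf (fun n => (h n t)%:E))%E).
  apply: ae_ge0_le_integral => //.
  - exact/measurable_EFinP.
  - move=> t pt; rewrite limn_einf_lim; apply: lime_ge; first exact: is_cvg_einfs.
    by apply: nearW => n; apply: le_ereal_inf_tmp => _ [k /= _ <-]; exact: E0.
  - apply: measurableT_comp => //; apply: measurable_fun_limn_esup => n.
    by apply: measurableT_comp; [|exact: mE].
  - apply: (@ae_circle_impl _ _ _ _ hv) => t pt ht.
    have ct : (fun n => (h n t)%:E) @ \oo --> (v t)%:E.
      by apply: cvg_EFin => //; exact: nearW.
    by have [-> _] := cvg_limn_einf_sup ct.
apply: (le_trans (@fatou _ _ _ mu per (@measurable_period R) _ mE E0)).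
rewrite limn_einf_lim; apply: lime_le; first exact: is_cvg_einfs.
apply: nearW => n; apply: le_trans (hM n); apply: ereal_inf_lbound; by exists n => /=.
Qed.

Lemma PI_ae_ge0 g z : disk z -> intg g -> ae_circle (fun t => 0 <= g t) -> 0 <= PI g z.
Proof.
move=> zd hg g0; have hk := intg_PI zd hg.
suff -> : PI g z = \I (fun t => `|complex.Re (schwarz t z) * g t|).
  by apply: Rintegral_ge0 => t _; exact: normr_ge0.
rewrite /PI /Rintegral; congr fine; apply: ae_eq_integral.
- exact: measurable_period.
- exact: (measurable_int _ hk).
- exact: (measurable_int _ (intg_norm hk)).
- apply: (@ae_circle_impl _ _ _ _ g0) => t pt gt0 /=.
  by rewrite ger0_norm// mulr_ge0// Re_schwarz_ge0.
Qed.

Lemma PI_ae_le u (B : R) z : disk z -> intg u -> ae_circle (fun t => u t <= B) ->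
  PI u z <= 2 * pi * B.
Proof.
move=> zd hu uB.
have := @PI_ae_ge0 (fun t => B + (-1) * u t) z zd.
rewrite PI_D ?PI_cst ?PI_Z// ?mulN1r ?subr_ge0; try exact: intg_cst; last exact: intgZ.
apply; first by apply: intgD; [exact: intg_cst|exact: intgZ].
by apply: (@ae_circle_impl _ _ _ _ uB) => t _ ut; rewrite mulN1r subr_ge0.
Qed.

(* Jensen: integrate the tangent line of the exponential at the mean value of [u]. *)
Lemma expR_PI_le u z : disk z -> intg u -> intg (fun t => expR (u t)) ->
  expR ((2 * pi)^-1 * PI u z) <= (2 * pi)^-1 * PI (fun t => expR (u t)) z.
Proof.
move=> zd hu he; have p2 : 0 < 2 * pi :> R by rewrite mulr_gt0 ?pi_gt0.
set m := _ * PI u z; rewrite -(ler_pM2l p2) mulrA divff ?gt_eqF// mul1r -subr_ge0.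
have h1 : intg (fun t => (- expR m) * (1 - m)) by exact: intg_cst.
have h2 : intg (fun t => (- expR m) * u t) by exact: intgZ.
suff -> : PI (fun t => expR (u t)) z - 2 * pi * expR m =
    PI (fun t => expR (u t) + ((- expR m) * (1 - m) + (- expR m) * u t)) z.
  apply: PI_ae_ge0 => //; first by apply: intgD => //; exact: intgD.
  apply: ae_circleW; apply: aeW => t.
  have := expR_ge1Dx (u t - m); rewrite expRD expRN.
  rewrite -(ler_pM2l (expR_gt0 m)) mulrCA divff ?gt_eqF ?expR_gt0//; lra.
rewrite PI_D//; last exact: intgD.
rewrite PI_D// PI_cst// PI_Z//.
have -> : PI u z = 2 * pi * m by rewrite /m mulVKf ?gt_eqF.
ring.
Qed.

(* Being the mean value property of the harmonic function [PI u], this needs no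
   Fubini theorem. *)
Lemma PI_mean u r : intg u -> 0 <= r < 1 ->
  \I (fun t => PI u (r%:C%C * expi t)) = 2 * pi * \I u.
Proof.
move=> hu r01.
have s0 t : schwarz t 0 = 1 :> C by rewrite /schwarz addr0 subr0 divff ?expi_neq0.
have d0 : disk (0 : C) by rewrite /disk cabs0.
have := congr1 (@complex.Re R) (SI_reproduce hu r01 d0).
rewrite mulr0 cReZ Re_SI -PI_Re /PI => E.
have -> : \I u = \I (fun s => complex.Re (schwarz s 0) * u s).
  by apply: eq_Rintegral => t _; rewrite s0 mul1r.
rewrite -E; apply: eq_Rintegral => t _; by rewrite s0 mul1r Re_SI.
Qed.

(* Replaces the sharp bound [4x / (1 + x)^2], which also tends to 1 as [x -> 1] but
   involves a division, hence an extra measurability argument. *)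
Definition koebe_minorant (x : R) : R := Num.max (x * (2 - x)) 0.

Lemma cabs_koebe_ge w : w != 1 -> koebe_minorant (cabs w) <= cabs (koebe w).
Proof.
move=> w1; rewrite /koebe_minorant ge_max cabs_ge0 andbT.
have d0 : 0 < cabs (1 - w) by rewrite cabs_gt0 subr_eq0 eq_sym.
have dle : cabs (1 - w) <= 1 + cabs w by apply: (le_trans (cabsB _ _)); rewrite cabs1.
rewrite /koebe cabsM cabsN cabsM cabs_nat cabsV cabsX ler_pdivlMr ?exprn_gt0//.
have x0 := cabs_ge0 w; move: (cabs w) (cabs (1 - w)) x0 d0 dle => x d x0 d0 dle.
have [x2|x2] := leP x 2; last first.
  have : 0 <= x * (x - 2) * d ^+ 2 by rewrite !mulr_ge0 ?exprn_ge0 ?(ltW d0)//; lra.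
  lra.
have : x * (2 - x) * d ^+ 2 <= x * (2 - x) * (1 + x) ^+ 2.
  rewrite ler_wpM2l//; first by rewrite mulr_ge0//; lra.
  by rewrite lerXn2r ?nnegrE ?(ltW d0)//; lra.
(* This product equals [4 * x - x * (2 - x) * (1 + x) ^+ 2]. *)
have : 0 <= x * (x - 1) ^+ 2 * (x + 2) by rewrite mulr_ge0 ?addr_ge0// mulr_ge0// sqr_ge0.
by move=> ? ?; lra.
Qed.

Lemma koebe_minorant_ge0 x : 0 <= koebe_minorant x.
Proof. by rewrite /koebe_minorant le_max lexx orbT. Qed.

Lemma cvg_koebe_minorant (x : nat -> R) : x @ \oo --> (1 : R) ->
  (fun n => koebe_minorant (x n)) @ \oo --> (1 : R).
Proof.
move=> hx; have -> : (1 : R) = Num.max (1 * (2 - 1)) 0.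
  by rewrite mul1r (_ : 2 - 1 = 1 :> R) ?max_l//; ring.
apply: (@continuous_cvg _ _ _ _ _ (fun n => x n * (2 - x n)) (fun y => Num.max y 0)).
  by apply: continuous_max; [exact: cvg_id|exact: cvg_cst].
by apply: cvgM => //; apply: cvgB => //; exact: cvg_cst.
Qed.

(** The positive limit keeps the sequence eventually in the branch where [powR] is
    [expR (q * ln x)]. *)
Lemma cvg_powR (x : nat -> R) (l q : R) : 0 < l -> x @ \oo --> l ->
  (fun n => x n `^ q) @ \oo --> l `^ q.
Proof.
move=> l0 xl; rewrite {2}/powR gt_eqF//.
have : (fun n => expR (q * ln (x n))) @ \oo --> expR (q * ln l).
  apply: (@continuous_cvg _ _ _ _ _ (fun n => q * ln (x n)) expR); first exact: continuous_expR.
  apply: cvgM; first exact: cvg_cst.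
  by apply: (@continuous_cvg _ _ _ _ _ x (@ln R)) => //; exact: continuous_ln.
apply: cvg_trans; apply: near_eq_cvg.
have : \forall n \near \oo, 0 < x n by exact: (cvgr_gt _ xl).
by apply: filterS => n xn; rewrite /powR gt_eqF.
Qed.

Section KoebeMultiple.
Variables (f phi : C -> C) (c : C) (u : R -> R).
Hypotheses (iphi : inner phi) (phi1 : forall z, disk z -> phi z != 1).
Hypotheses (c1 : cabs c = 1) (hu : intg u).
Hypothesis fE : forall z, disk z -> f z = koebe (phi z) * outer_fun c u z.

(** Where [phi] tends to 1 the Koebe factor blows up. This minorant of [|f|] depends on [phi] only
    through its modulus, whose radial limit is 1 almost everywhere. *)
Let h (n : nat) t : R := koebe_minorant (cabs (phi ((rho R n)%:C%C * expi t))) *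
  cabs (outer_fun c u ((rho R n)%:C%C * expi t)).

Let h_le n t : h n t <= cabs (f ((rho R n)%:C%C * expi t)).
Proof.
have zd := disk_radius t (rho01 R n).
by rewrite fE// cabsM ler_wpM2r ?cabs_ge0// cabs_koebe_ge// phi1.
Qed.

Let h_ge0 n t : 0 <= h n t.
Proof. by rewrite mulr_ge0 ?cabs_ge0// koebe_minorant_ge0. Qed.

Let cvg_h : ae_circle (fun t => (fun n => h n t) @ \oo --> expR (u t)).
Proof.
apply: (@ae_circle_impl _ _ _ _ (ae_circle_and iphi.2 (cvg_cabs_outer c1 hu))).
move=> t _ [[l [hl l1]] ho].
have L : (fun n => cabs (phi ((rho R n)%:C%C * expi t))) @ \oo --> (1 : R).
  rewrite -l1; apply: (@cvg_comp _ _ _ (rho R) (fun r => cabs (phi (r%:C%C * expi t)))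
    _ _ _ (@cvg_rho R)).
  exact: cvg_cabs.
have O : (fun n => cabs (outer_fun c u ((rho R n)%:C%C * expi t))) @ \oo --> expR (u t).
  exact: (@cvg_comp _ _ _ (rho R) (fun r => cabs (outer_fun c u (r%:C%C * expi t)))
    _ _ _ (@cvg_rho R) ho).
by rewrite -[expR _]mul1r; apply: cvgM => //; exact: cvg_koebe_minorant.
Qed.

Let measurable_cabs_circle (F : C -> C) r : holo F -> 0 <= r < 1 ->
  measurable_fun per (fun t => cabs (F (r%:C%C * expi t))).
Proof. by move=> hF r01; apply: intg_meas; apply: intg_cabs; exact: cintg_circle. Qed.

Let mh n : measurable_fun per (h n).
Proof.
have mphi := measurable_cabs_circle iphi.1.1 (rho01 R n).
have mo := measurable_cabs_circle (@holo_outer R c u hu) (rho01 R n).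
apply: measurable_funM => //; apply: measurable_maxr => //.
by apply: measurable_funM => //; apply: measurable_funB.
Qed.

Lemma bounded_outer_factor (M : R) : (forall z, disk z -> cabs (f z) <= M) ->
  exists B : R, forall z, disk z -> cabs (outer_fun c u z) <= B.
Proof.
(* The maximum with 1 makes the bound positive, so that its logarithm can be compared with [u]. *)
move=> fM; exists (Num.max M 1) => z zd; rewrite cabs_outer//.
have M0 : 0 < Num.max M 1 by rewrite lt_max ltr01 orbT.
rewrite -[leRHS]lnK ?posrE// ler_expR.
have p2 : 0 < 2 * pi :> R by rewrite mulr_gt0 ?pi_gt0.
rewrite mulrC ler_pdivrMr// mulrC.
apply: PI_ae_le => //; apply: (@ae_circle_impl _ _ _ _ cvg_h) => t _ ht.
rewrite -ler_expR lnK ?posrE//.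
rewrite -(cvg_lim _ ht)//; apply: limr_le; first by apply/cvg_ex; exists (expR (u t)).
apply: nearW => n; apply: (le_trans (h_le n t)); rewrite le_max fM//.
exact: disk_radius (rho01 R n).
Qed.

(** The constant [M] is inherited unchanged: it bounds the integral of [expR (q * u t)], and
    averaging the normalised Poisson integral over a circle returns that integral. *)
Lemma hardy_outer_factor q : 0 < q ->
  (exists M : R, forall r, 0 <= r < 1 ->
    (\int[mu]_(t in per) ((cabs (f (r%:C%C * expi t))) `^ q)%:E <= M%:E)%E) ->
  holo f ->
  exists M : R, forall r, 0 <= r < 1 ->
    (\int[mu]_(t in per) ((cabs (outer_fun c u (r%:C%C * expi t))) `^ q)%:E <= M%:E)%E.
Proof.
move=> q0 [M fM] hf; exists M => r r01.
have mpow (F : C -> C) s : holo F -> 0 <= s < 1 ->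
    measurable_fun per (fun t => cabs (F (s%:C%C * expi t)) `^ q).
  move=> hF s01; apply: (@measurableT_comp _ _ _ _ _ _ ((@powR R)^~ q));
    first exact: measurable_powR.
  exact: measurable_cabs_circle.
have hqu : intg (fun t => q * u t) by exact: intgZ.
have mw : measurable_fun per (fun t => expR (q * u t)).
  by apply: measurableT_comp => //; exact: intg_meas.
have wM : (\int[mu]_(t in per) (expR (q * u t))%:E <= M%:E)%E.
  apply: (@fatou_ae (fun n t => h n t `^ q)) => //.
  - move=> n; apply: (@measurableT_comp _ _ _ _ _ _ ((@powR R)^~ q)) => //.
  - by move=> n t _; exact: powR_ge0.
  - apply: (@ae_circle_impl _ _ _ _ cvg_h) => t _ ht.
    have -> : expR (q * u t) = expR (u t) `^ q by rewrite -expRM mulrC.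
    by apply: cvg_powR => //; exact: expR_gt0.
  - move=> n; apply: le_trans (fM _ (rho01 R n)); apply: ge0_le_integral => //.
    + by move=> t _; rewrite lee_fin powR_ge0.
    + apply/measurable_EFinP; apply: (@measurableT_comp _ _ _ _ _ _ ((@powR R)^~ q)) => //.
      exact: mh.
    + by apply/measurable_EFinP; apply: mpow => //; exact: rho01.
    + by move=> t _; rewrite lee_fin ge0_ler_powR ?nnegrE ?cabs_ge0 ?h_ge0// ltW.
have hw : intg (fun t => expR (q * u t)).
  apply/integrableP; split; first exact/measurable_EFinP.
  apply: le_lt_trans (ltry M); apply: le_trans wM.
  by under eq_integral => t _ do rewrite /= ger0_norm ?expR_ge0//.
have Iw : \I (fun t => expR (q * u t)) <= M.
  rewrite -lee_fin /Rintegral fineK//; exact: integrable_fin_num hw.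
have p2 : 0 < 2 * pi :> R by rewrite mulr_gt0 ?pi_gt0.
pose g t := PI (fun t => expR (q * u t)) (r%:C%C * expi t).
have hg : intg g.
  by have [] := cintg_circle (holo_SI hw) r01; under eq_fun do rewrite Re_SI.
have hP : intg (fun t => (2 * pi)^-1 * g t) by exact: intgZ.
apply: (@le_trans _ _ (\int[mu]_(t in per) ((2 * pi)^-1 * g t)%:E)%E).
  apply: ge0_le_integral => //.
  - by move=> t _; rewrite lee_fin powR_ge0.
  - by apply/measurable_EFinP; exact: (mpow _ _ (@holo_outer R c u hu) r01).
  - exact: (measurable_int _ hP).
  - move=> t _; have zd := disk_radius t r01; rewrite lee_fin cabs_outer// -expRM.
    apply: le_trans (expR_PI_le zd hqu hw).
    by rewrite PI_Z// ler_expR mulrC mulrCA.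
have finP : (\int[mu]_(t in per) ((2 * pi)^-1 * g t)%:E)%E \is a fin_num.
  exact: (integrable_fin_num _ hP).
rewrite -(fineK finP) lee_fin; apply: le_trans Iw.
have := (RintegralZl (2 * pi)^-1 (@measurable_period R) hg); rewrite /Rintegral => ->.
by rewrite -/(Rintegral mu per g) (PI_mean hw r01) mulKf ?gt_eqF.
Qed.

End KoebeMultiple.

(** Formulated for any [g] that agrees with [Rf] on the disk, because the product of the Cayley
    transforms is known to equal [Rf] only there. *)
Lemma koebe_factor_hardy (f Kf Rf : C -> C) (p : \bar R) : koebe_inner Kf -> outer Rf ->
  (forall z, disk z -> f z = Kf z * Rf z) -> Hardy p f ->
  forall g : C -> C, (forall z, disk z -> Rf z = g z) -> Hardy p g.
Proof.
move=> [phi [iphi hphi]] oR fE pf g gE.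
have [c [u [c1 [hu RE]]]] := outerP oR.
have phi1 z : disk z -> phi z != 1 by move=> /hphi[].
have fO z : disk z -> f z = koebe (phi z) * outer_fun c u z.
  by move=> zd; rewrite fE// RE//; have [_ ->] := hphi z zd.
have gO z : disk z -> outer_fun c u z = g z by move=> zd; rewrite -gE// RE.
have hg : holo g.
  by move=> z zd; exact: (derivable_eq_disk zd gO (@holo_outer R c u hu z zd)).
case: p pf => [q|[_ [M fM]]|[]].
  move=> [q0 [hf hM]]; split; first exact: q0.
  split; first exact: hg.
  have [B HB] := hardy_outer_factor iphi phi1 c1 hu fO q0 hM hf.
  exists B => r r01; apply: le_trans (HB r r01).
  by under eq_integral => t _ do rewrite -(gO _ (disk_radius t r01)).
have [B HB] := bounded_outer_factor iphi phi1 c1 hu fO fM.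
by split; [exact: hg|exists B => z zd; rewrite -gO// HB].
Qed.

End HardyClass.

Theorem theorem4p1 (R : realType) (f Kf Rf : R[i] -> R[i]) :
  Rplus f -> koebe_inner Kf -> RO Rf ->
  (forall z, disk z -> f z = Kf z * Rf z) ->
  bounded_arg Rf ->
  exists (N : nat) (phi : nat -> R[i] -> R[i]),
    (forall n, (n < N)%N ->
       inner (phi n) /\ forall z, disk z -> phi n z != 'i%C) /\
    (forall z, disk z -> f z = Kf z * \prod_(n < N) Tmap (phi n z)) /\
    (forall p : \bar R, (0 < p)%E -> Hardy p f ->
       Hardy p (fun z => \prod_(n < N) Tmap (phi n z))).
Proof.
move=> _ hK hR fE bR.
have [N [phi [iphi RE]]] := outer_factorization hR bR.
exists N, phi; split=> //; split=> [z zd|p _ hp].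
  by rewrite fE// RE.
exact: (koebe_factor_hardy hK hR.2 fE hp RE).
Qed.
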